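(* For every $\eta\in(0,1)$ there are constants $c_3,c_4,c_5>0$ (depending only on $\eta$) such that for every positive integer $q$ and every $\lambda>1$: (i) if $q>c_3\lambda^{3+\eta}$ then the Glauber dynamics mixes rapidly on the class of connected graphs of maximum degree $4$; (ii) if $q>c_4\lambda^{2+\eta}$ then the Glauber dynamics mixes rapidly on the class of toroidal $L$-grids ($L\ge 3$); (iii) if $q\ge 2$ and $q<c_5\lambda^{8/3-\eta}$ then the Glauber dynamics mixes slowly for almost all $4$-regular graphs, i.e. there is $b>0$ such that for $G$ uniform in $\mathcal{G}_{n,4}$, a.a.s. $\tau(\mathcal{M}_{\mathrm{GD}}(G,\lambda,q))\ge 2^{bn}$. In particular, for all sufficiently large $\lambda$ there is a positive integer $q$ such that the Glauber dynamics of the $q$-state Potts model at activity $\lambda$ mixes rapidly on toroidal grids but slowly for almost all $4$-regular graphs.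
   Context: Potts model: for a graph $G=(V,E)$ with $n=|V|$, a positive integer $q$, $[q]=\{1,\dots,q\}$ and $\lambda>1$, a configuration is any $\sigma\in\Omega=[q]^V$; $\mu(\sigma)$ is the number of monochromatic edges. The Gibbs distribution is $\pi(\sigma)=\lambda^{\mu(\sigma)}/Z(G,\lambda,q)$ with $Z(G,\lambda,q)=\sum_{\sigma\in\Omega}\lambda^{\mu(\sigma)}$. The Glauber dynamics $\mathcal{M}_{\mathrm{GD}}(G,\lambda,q)$: from $X_t$, choose a vertex $v$ uniformly at random, choose $c\in[q]$ with probability proportional to $\lambda^{n(X_t,v,c)}$ ($n(X,v,c)$ = number of neighbours of $v$ coloured $c$ in $X$), and recolour $v$ with $c$. $\tau(\mathcal{M},\varepsilon)=\max_x\min\{t:\|P^t(x,\cdot)-\pi\|_{TV}\le\varepsilon\}$, $\tau(\mathcal{M})=\tau(\mathcal{M},1/(2e))$. ''Mixes rapidly on a class'' means: for every fixed $\varepsilon>0$ there is a polynomial $p$ with $\tau(\mathcal{M}_{\mathrm{GD}}(G,\lambda,q),\varepsilon)\le p(n)$ for every $n$-vertex graph $G$ of the class. The toroidal $L$-grid has vertex set $(\mathbb{Z}/L\mathbb{Z})^2$, with $(a,b)\sim(c,d)$ iff ($a-c=\pm1$ and $b=d$) or ($b-d=\pm1$ and $a=c$) in $\mathbb{Z}/L\mathbb{Z}$. $\mathcal{G}_{n,\Delta}$ is the uniform space of $\Delta$-regular simple graphs on $\{1,\dots,n\}$; a.a.s. means with probability tending to $1$ as $n\to\infty$. *)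

(* Defs.v *)
From Stdlib Require Import Reals ClassicalDescription.
From mathcomp Require Import all_boot.

Set Implicit Arguments.
Unset Strict Implicit.
Unset Printing Implicit Defensive.

Open Scope R_scope.

Notation "\rsum_ ( i : T ) F" := (\big[Rplus/0]_(i : T) F)
  (at level 41, F at level 41, i, T at level 50).

Definition pbool (P : Prop) : bool :=
  if excluded_middle_informative P then true else false.

Definition peval (p : list R) (x : R) : R :=
  List.fold_right (fun a acc => (a + x * acc)) 0 p.

Section Potts.
Variables (V : finType) (e : rel V) (q : nat) (lam : R).

Definition config := {ffun V -> 'I_q}.

Definition mono_edges (x : config) : nat :=
  #|[set E : {set V} | [exists u : V, [exists v : V,
        (E == [set u; v]) && e u v && (x u == x v)]]]|.

Definition Zpart : R := \rsum_(x : config) (lam ^ mono_edges x).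

Definition gibbs (x : config) : R := (lam ^ mono_edges x / Zpart).

Definition nbr_col (x : config) (v : V) (c : 'I_q) : nat :=
  #|[set w | e v w && (x w == c)]|.

Definition glauber_P (x y : config) : R :=
  (/ INR #|V| *
   \rsum_(v : V)
     (if [forall w, (w != v) ==> (x w == y w)]
      then lam ^ nbr_col x v (y v) / \rsum_(c : 'I_q) (lam ^ nbr_col x v c)
      else 0)).

Fixpoint glauber_Pt (t : nat) (x y : config) : R :=
  match t with
  | 0 => if x == y then 1 else 0
  | t'.+1 => \rsum_(z : config) (glauber_Pt t' x z * glauber_P z y)
  end.

Definition tv_dist (t : nat) (x : config) : R :=
  (/ 2 * \rsum_(y : config) Rabs (glauber_Pt t x y - gibbs y)).

(* tau(M, eps) <= T, i.e. max_x min {t : TV <= eps} <= T. *)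
Definition mix_time_le (eps T : R) : Prop :=
  forall x : config, exists t : nat, (INR t <= T) /\ (tv_dist t x <= eps).

(* tau(M, eps) >= T (including the case where the minimum is over an
   empty set, i.e. tau = infinity). *)
Definition mix_time_ge (eps T : R) : Prop :=
  exists x : config, forall t : nat, (tv_dist t x <= eps) -> (T <= INR t).

End Potts.

(* tau(M) = tau(M, 1/(2e)) *)
Definition eps0 : R := (/ (2 * exp 1)).

Definition simple_graph (V : finType) (e : rel V) : Prop :=
  symmetric e /\ irreflexive e.
Definition connected_graph (V : finType) (e : rel V) : Prop :=
  forall u v, connect e u v.
Definition max_deg_le (V : finType) (e : rel V) (k : nat) : Prop :=
  forall v, (#|[set w | e v w]| <= k)%N.

Definition torus_adj (L : nat) : rel ('I_L * 'I_L) :=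
  fun u v =>
    ((u.2 == v.2) &&
       ((nat_of_ord u.1 == (v.1 + 1)%N %% L) || (nat_of_ord v.1 == (u.1 + 1)%N %% L)))
    || ((u.1 == v.1) &&
       ((nat_of_ord u.2 == (v.2 + 1)%N %% L) || (nat_of_ord v.2 == (u.2 + 1)%N %% L))).

Arguments torus_adj L : clear implicits.

Definition rapid_maxdeg4 (q : nat) (lam : R) : Prop :=
  forall eps : R, (0 < eps) -> exists p : list R,
    forall (n : nat) (e : rel 'I_n),
      (0 < n)%N -> simple_graph e -> connected_graph e -> max_deg_le e 4 ->
      mix_time_le e q lam eps (peval p (INR n)).

Definition rapid_torus (q : nat) (lam : R) : Prop :=
  forall eps : R, (0 < eps) -> exists p : list R,
    forall L : nat, (3 <= L)%N ->
      mix_time_le (torus_adj L) q lam eps (peval p (INR (L * L)%N)).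

Definition adj_of (n : nat) (A : {set 'I_n * 'I_n}) : rel 'I_n :=
  fun u v => (u, v) \in A.

Definition reg4 (n : nat) (A : {set 'I_n * 'I_n}) : bool :=
  [forall u : 'I_n, (u, u) \notin A]
  && [forall u : 'I_n, [forall v : 'I_n, ((u, v) \in A) == ((v, u) \in A)]]
  && [forall u : 'I_n, #|[set v | (u, v) \in A]| == 4%N].

Definition slow_aas (q : nat) (lam : R) : Prop :=
  exists b : R, (0 < b) /\
    Un_cv (fun n : nat =>
      (INR #|[set A : {set 'I_n * 'I_n} | reg4 A &&
               pbool (mix_time_ge (adj_of A) q lam eps0 (Rpower 2 (b * INR n)))]|
       / INR #|[set A : {set 'I_n * 'I_n} | reg4 A]|)) 1.

(* Main.v *)
(** Rapid mixing. Write [A_S f] for the conditional expectation of [f] given the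
    colours outside a block [S]. If the edges touching a set [T] inside [S] number
    at most [kappa |T|] (at most [kappa (|T| - 1)] when only edges inside [T] count),
    then expanding the partition function of [S] over the colour classes shows that
    it is at most [q^|S| (1 + O(lambda^kappa / q))], whatever the boundary condition;
    so the conditional law on [S] is nearly uniform, and averaging the [A_S] over one
    block per vertex contracts the total oscillation of a function by [1 - 1/(2n)].
    Log-convexity of [t |-> |P^t f|^2] turns this into a spectral gap of the block
    dynamics, which is compared with single-site updates; no coupling is needed.
    Connected blocks of size [k] give [kappa = 3 + 1/k], and [l x l] squares of the
    torus, whose rows and columns are paths, give [kappa = 2 + 2/l].

    Slow mixing. The bottleneck consists of the configurations with exactly
    [w = n / D] vertices [W] not coloured [c0]. Such a configuration has
    [2n - 4w + e(W) + mono(W)] monochromatic edges; revealing the colours of [W] in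
    order bounds the sum over colourings by [(2q)^w (lambda / q^(1/4))^e(W)].
    A switching argument shows that a uniform 4-regular graph contains [k] given
    edges with probability at most [(8/n)^k], which controls the exponential moments
    of [e(W)]. With [D] of order [q^(1/2)] and [q < c lambda^(8/3)], the expected
    weight of the bottleneck is at most [4^-w lambda^(2n)], and Markov's inequality
    bounds its conductance for almost all graphs. *)

Require Import Defs.
From Stdlib Require Import Reals ClassicalDescription.
From mathcomp Require Import all_boot all_order all_algebra perm.
From mathcomp Require Import Rstruct ring lra zify.
Set Implicit Arguments.
Unset Strict Implicit.
Unset Printing Implicit Defensive.
Import Order.TTheory GRing.Theory Num.Theory.
Local Open Scope ring_scope.

(** * Block conditional expectations in L2 of a positive weight *)

(** Blocks are used because single sites give too weak a threshold: one vertex of degree 4 costs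
    lambda^4, whereas a connected set of k vertices has k - 1 spanning-tree edges counted from both
    ends, leaving 4k - (k - 1) = 3k + 1 touching edges. In the torus each direction has degree 2, a
    path of l vertices meets l + 1 edges, and the two directions add up. The passage through L2
    serves the return to single sites: Poincare inequalities for blocks and for sites can be
    compared directly.

    The exponent 8/3 comes from one balance. With Q = q^(1/4), an inner edge of W carries a factor
    lambda^2 / Q. The switching bound affords n / w per inner edge at the price 81^w; the remaining
    r = lambda^2 w / (Q n) is raised to at most 2w, the largest number of inner edges. The choices
    of W and of its colours cost (6 n q / w)^w, and after division by lambda^(4w) there remains (486
    Q^2 w / n)^w, hence n / w of order Q^2. The requirement r >= 1 then reads lambda^2 >= C Q^3,
    which is q <= c lambda^(8/3). *)

Section Projections.
Variables (R : archiRealFieldType) (V : finType) (q : nat).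
Local Notation Om := {ffun V -> 'I_q}.
Variable w : Om -> R.
Hypothesis w_gt0 : forall x, 0 < w x.
Implicit Types (x y z : Om) (f g : Om -> R) (S T : {set V}) (v : V) (c : 'I_q).

Definition agree S x y := [forall u, (u \notin S) ==> (x u == y u)].
Definition upd x v c : Om := [ffun u => if u == v then c else x u].

Lemma agreeP S x y : reflect (forall u, u \notin S -> x u = y u) (agree S x y).
Proof.
apply: (iffP forallP) => H u; first by move=> uS; apply/eqP; have /implyP := H u; apply.
by apply/implyP => uS; apply/eqP/H.
Qed.

Lemma agree_refl S x : agree S x x. Proof. by apply/agreeP. Qed.

Lemma agree_sym S x y : agree S x y = agree S y x.
Proof. by apply/agreeP/agreeP => H u uS; rewrite H. Qed.

Lemma agree_trans S x y z : agree S x y -> agree S y z -> agree S x z.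
Proof. by move=> /agreeP H1 /agreeP H2; apply/agreeP => u uS; rewrite H1 ?H2. Qed.

Lemma agree_eql S x y z : agree S x y -> agree S x z = agree S y z.
Proof.
move=> xy; apply/idP/idP => H; last exact: agree_trans xy H.
by rewrite agree_sym in xy; exact: agree_trans xy H.
Qed.

Lemma agree_sub S T x y : S \subset T -> agree S x y -> agree T x y.
Proof.
move=> ST /agreeP H; apply/agreeP => u uT; apply: H; apply: contra uT.
by move/(subsetP ST).
Qed.

Lemma agree_setT x y : agree setT x y.
Proof. by apply/agreeP => u; rewrite in_setT. Qed.

Lemma upd_same x v c : upd x v c v = c. Proof. by rewrite ffunE eqxx. Qed.
Lemma upd_diff x v c u : u != v -> upd x v c u = x u.
Proof. by rewrite ffunE => /negbTE ->. Qed.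
Lemma agree_upd x v c : agree [set v] x (upd x v c).
Proof. by apply/agreeP => u; rewrite inE => uv; rewrite upd_diff. Qed.
Lemma upd_upd x v c c' : upd (upd x v c) v c' = upd x v c'.
Proof. by apply/ffunP => u; rewrite !ffunE; case: eqP. Qed.
Lemma upd_id x v : upd x v (x v) = x.
Proof. by apply/ffunP => u; rewrite !ffunE; case: eqP => [->|]. Qed.
Lemma agree1E x y v : agree [set v] x y -> y = upd x v (y v).
Proof.
move=> /agreeP H; apply/ffunP => u; rewrite ffunE; case: eqP => [->//|/eqP uv].
by rewrite H // inE.
Qed.

(* [(x, c) |-> (upd x v c, x v)] is an involution. *)
Lemma sum_upd (F : Om -> R) v :
  \sum_x \sum_(c : 'I_q) F (upd x v c) = q%:R * \sum_x F x.
Proof.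
pose h (p : Om * 'I_q) := (upd p.1 v p.2, p.1 v).
have hK : involutive h.
  by move=> [x c]; rewrite /h /= upd_same upd_upd upd_id.
rewrite pair_big /= (reindex_inj (inv_inj hK)) /=.
under eq_bigr => p _ do rewrite upd_upd upd_id.
rewrite -(pair_big xpredT xpredT (fun x (_ : 'I_q) => F x)) /= mulr_sumr.
by apply: eq_bigr => x _; rewrite sumr_const card_ord mulr_natl.
Qed.

Lemma sum_agree1 (F : Om -> R) x v :
  \sum_(y | agree [set v] x y) F y = \sum_(c : 'I_q) F (upd x v c).
Proof.
rewrite (reindex_onto (fun c => upd x v c) (fun y => y v)) /=; last first.
  by move=> y /agree1E ->; rewrite upd_same.
by apply: eq_bigl => c; rewrite agree_upd upd_same eqxx.
Qed.

Definition block_sum S x := \sum_(y | agree S x y) w y.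
Definition cond_exp S f x := (\sum_(y | agree S x y) w y * f y) / block_sum S x.
Definition inner_prod f g := \sum_x w x * f x * g x.
Definition sqnorm f := inner_prod f f.
Definition total f := \sum_x w x * f x.
Definition block_inv S f := forall x y, agree S x y -> f x = f y.

Lemma block_sum_gt0 S x : 0 < block_sum S x.
Proof.
rewrite /block_sum (bigD1 x) ?agree_refl //=; apply: ltr_wpDr => //.
by apply: sumr_ge0 => y _; apply: ltW.
Qed.

Lemma block_sum_inv S : block_inv S (block_sum S).
Proof. by move=> x y xy; apply: eq_bigl => z; apply: agree_eql. Qed.

Lemma cond_exp_inv S f : block_inv S (cond_exp S f).
Proof.
move=> x y xy; rewrite /cond_exp (block_sum_inv xy); congr (_ / _).
by apply: eq_bigl => z; apply: agree_eql.
Qed.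

Lemma cond_exp_of_inv S f : block_inv S f -> cond_exp S f =1 f.
Proof.
move=> Hf x; rewrite /cond_exp.
under eq_bigr => y xy do rewrite -(Hf _ _ xy).
by rewrite -mulr_suml mulrC mulKf // gt_eqF // block_sum_gt0.
Qed.

Lemma eq_inner_prod f f' g g' : f =1 f' -> g =1 g' -> inner_prod f g = inner_prod f' g'.
Proof. by move=> H1 H2; apply: eq_bigr => x _; rewrite H1 H2. Qed.

Lemma eq_sqnorm f f' : f =1 f' -> sqnorm f = sqnorm f'.
Proof. by move=> H; apply: eq_inner_prod. Qed.

Lemma inner_prodC f g : inner_prod f g = inner_prod g f.
Proof. by apply: eq_bigr => x _; rewrite mulrAC. Qed.

(** Both sides sum [w x * w y / block_sum w S x] against [f y * g x] over pairs equal outside [S];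
    this kernel is symmetric because [block_sum] is constant on such pairs. *)
Lemma inner_prod_cond_exp S f g : inner_prod (cond_exp S f) g = inner_prod f (cond_exp S g).
Proof.
pose G x y := w x * w y * f y * g x / block_sum S x.
have -> : inner_prod (cond_exp S f) g = \sum_x \sum_y (if agree S x y then G x y else 0).
  apply: eq_bigr => x _; rewrite -big_mkcond /= /cond_exp.
  rewrite (_ : _ * _ * _ = (\sum_(y | agree S x y) w y * f y) * (w x * g x / block_sum S x)).
    by rewrite mulr_suml; apply: eq_bigr => y _; rewrite /G; ring.
  by ring.
rewrite exchange_big /=; apply: eq_bigr => y _; rewrite -big_mkcond /= /cond_exp.
rewrite !mulrA [RHS]mulrAC mulr_sumr.
rewrite (eq_bigl (fun x => agree S y x)); last by move=> x; rewrite agree_sym.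
by apply: eq_bigr => x xy; rewrite /G (block_sum_inv xy); ring.
Qed.

Lemma inner_prodDl f f' g : inner_prod (fun x => f x + f' x) g = inner_prod f g + inner_prod f' g.
Proof. by rewrite -big_split; apply: eq_bigr => x _; rewrite /=; ring. Qed.
Lemma inner_prodBl f f' g : inner_prod (fun x => f x - f' x) g = inner_prod f g - inner_prod f' g.
Proof. by rewrite -sumrB; apply: eq_bigr => x _; rewrite /=; ring. Qed.
Lemma inner_prodZl a f g : inner_prod (fun x => a * f x) g = a * inner_prod f g.
Proof. by rewrite mulr_sumr; apply: eq_bigr => x _; rewrite /=; ring. Qed.
Lemma inner_prodBr f g g' : inner_prod f (fun x => g x - g' x) = inner_prod f g - inner_prod f g'.
Proof. by rewrite inner_prodC inner_prodBl !(inner_prodC f). Qed.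
Lemma inner_prodDr f g g' : inner_prod f (fun x => g x + g' x) = inner_prod f g + inner_prod f g'.
Proof. by rewrite inner_prodC inner_prodDl !(inner_prodC f). Qed.
Lemma inner_prodZr a f g : inner_prod f (fun x => a * g x) = a * inner_prod f g.
Proof. by rewrite inner_prodC inner_prodZl inner_prodC. Qed.

Lemma sqnorm_ge0 f : 0 <= sqnorm f.
Proof.
by apply: sumr_ge0 => x _; rewrite -mulrA; apply: mulr_ge0; [apply: ltW|apply: sqr_ge0].
Qed.

Lemma sqnorm_sub f g : sqnorm (fun x => f x - g x) = sqnorm f - 2%:R * inner_prod f g + sqnorm g.
Proof. by rewrite /sqnorm inner_prodBl !inner_prodBr (inner_prodC g f); ring. Qed.

Lemma sqnorm_add f g : sqnorm (fun x => f x + g x) = sqnorm f + 2%:R * inner_prod f g + sqnorm g.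
Proof. by rewrite /sqnorm inner_prodDl !inner_prodDr (inner_prodC g f); ring. Qed.

Lemma sqnorm_scale a f : sqnorm (fun x => a * f x) = a ^+ 2 * sqnorm f.
Proof. by rewrite /sqnorm inner_prodZl inner_prodZr; ring. Qed.

Lemma sqnorm_add_le f g : sqnorm (fun x => f x + g x) <= 2%:R * sqnorm f + 2%:R * sqnorm g.
Proof. have := sqnorm_ge0 (fun x => f x - g x); rewrite sqnorm_sub sqnorm_add; lra. Qed.

(* AM-GM form of Cauchy-Schwarz, avoiding square roots. *)
Lemma inner_prod_amgm t f g : 0 < t -> 2%:R * inner_prod f g <= t * sqnorm f + sqnorm g / t.
Proof.
move=> t0; have := sqnorm_ge0 (fun x => t * f x - g x).
rewrite sqnorm_sub sqnorm_scale inner_prodZl => H.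
have : 0 <= (t ^+ 2 * sqnorm f - 2%:R * (t * inner_prod f g) + sqnorm g) / t by rewrite divr_ge0 // ltW.
have -> : (t ^+ 2 * sqnorm f - 2%:R * (t * inner_prod f g) + sqnorm g) / t =
    t * sqnorm f - 2%:R * inner_prod f g + sqnorm g / t.
  by field; rewrite gt_eqF.
by lra.
Qed.

Lemma Cauchy_Schwarz f g : inner_prod f g ^+ 2 <= sqnorm f * sqnorm g.
Proof.
have /orP[/eqP Nf0 | Nf0] : (sqnorm f == 0) || (0 < sqnorm f) by rewrite -le0r sqnorm_ge0.
  rewrite Nf0 mul0r.
  have f0 x : f x = 0.
    have H : forall i, true -> 0 <= w i * f i * f i.
      by move=> i _; rewrite -mulrA; apply: mulr_ge0; [apply: ltW|apply: sqr_ge0].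
    have /eqP := psumr_eq0P H Nf0 (i := x) isT.
    by rewrite -mulrA mulf_eq0 gt_eqF //= mulf_eq0 orbb => /eqP.
  by rewrite /inner_prod big1 ?expr0n // => x _; rewrite f0; ring.
have := sqnorm_ge0 (fun x => inner_prod f g * f x - sqnorm f * g x).
rewrite sqnorm_sub !sqnorm_scale inner_prodZl inner_prodZr => H.
have : 0 <= sqnorm f * (sqnorm f * sqnorm g - inner_prod f g ^+ 2).
  by apply: le_trans H _; rewrite le_eqVlt; apply/orP; left; apply/eqP; ring.
by rewrite pmulr_rge0 // subr_ge0.
Qed.

Lemma inner_prod_cond_exp_self S f : inner_prod (cond_exp S f) f = sqnorm (cond_exp S f).
Proof.
rewrite /sqnorm inner_prod_cond_exp [RHS]inner_prod_cond_exp; apply: eq_inner_prod => // x.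
by rewrite [RHS]cond_exp_of_inv //; apply: cond_exp_inv.
Qed.

Lemma sqnorm_pythagoras S f : sqnorm f = sqnorm (cond_exp S f) + sqnorm (fun x => f x - cond_exp S f x).
Proof. by rewrite sqnorm_sub inner_prodC inner_prod_cond_exp_self; ring. Qed.

(** The projection fixes [g], so [f - A f = (f - g) - A (f - g)], and Pythagoras applies to
    [f - g]. *)
Lemma cond_exp_minimizes S f g : block_inv S g ->
  sqnorm (fun x => f x - cond_exp S f x) <= sqnorm (fun x => f x - g x).
Proof.
move=> Hg; rewrite [leRHS](sqnorm_pythagoras S).
rewrite (_ : sqnorm (fun x => f x - cond_exp S f x) =
   sqnorm (fun x => (f x - g x) - cond_exp S (fun y => f y - g y) x)); last first.
  apply: eq_sqnorm => x; have := cond_exp_of_inv Hg x; rewrite /cond_exp.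
  under [X in _ = _ - X / _]eq_bigr => y _ do rewrite mulrBr.
  by rewrite sumrB mulrBl => ->; ring.
by rewrite lerDr sqnorm_ge0.
Qed.

Lemma total_cond_exp S f : total (cond_exp S f) = total f.
Proof.
have -> : total (cond_exp S f) = inner_prod (cond_exp S f) (fun=> 1) by apply: eq_bigr => x _; rewrite mulr1.
rewrite inner_prod_cond_exp; apply: eq_bigr => x _.
by rewrite cond_exp_of_inv ?mulr1 // => ? ?.
Qed.

End Projections.

(** * Contraction of oscillations *)

(* Turns exponential decay with an uncontrolled constant [C] into a one-step contraction. *)
Lemma log_convex_ratio (R : archiRealFieldType) (a : nat -> R) (C rho : R) :
  0 < rho -> (forall t, 0 <= a t) -> (forall t, a t.+1 ^+ 2 <= a t * a t.+2) ->
  (forall t, a t <= C * rho ^+ t) -> a 1%N <= rho * a 0%N.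
Proof.
move=> rho0 a_ge0 a_lc a_le; rewrite leNgt; apply/negP => a1.
have a0 : 0 < a 0%N.
  rewrite lt0r a_ge0 andbT; apply/eqP => a00; move: a1 (a_lc 0%N).
  rewrite a00 mulr0 mul0r => a1 H; move: (sqr_ge0 (a 1%N)).
  have := exprn_gt0 2 a1; lra.
pose r := a 1%N / a 0%N.
have rrho : rho < r by rewrite ltr_pdivlMr.
have r0 : 0 < r by apply: lt_trans rrho.
(* Log-convexity makes successive ratios nondecreasing, so a first ratio above [rho] persists
   forever. *)
have ar t : 0 < a t /\ r * a t <= a t.+1.
  elim: t => [|t [at0 IH]]; first by rewrite /r divfK ?gt_eqF.
  have aS : 0 < a t.+1 by apply: lt_le_trans IH; apply: mulr_gt0.
  split => //; rewrite -(ler_pM2l at0); apply: le_trans (a_lc t).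
  by rewrite mulrA [a t * r]mulrC expr2; apply: ler_wpM2r => //; apply: ltW.
have art t : a 0%N * r ^+ t <= a t.
  elim: t => [|t IH]; first by rewrite expr0 mulr1.
  apply: le_trans (ar t).2; rewrite exprS mulrCA; apply: ler_wpM2l => //; exact: ltW.
pose k := r / rho - 1.
have k0 : 0 < k by rewrite /k subr_gt0 ltr_pdivlMr // mul1r.
have bern t : 1 + t%:R * k <= (1 + k) ^+ t.
  elim: t => [|t IH]; first by rewrite mul0r addr0 expr0.
  rewrite exprS -natr1; apply: (@le_trans _ _ ((1 + k) * (1 + t%:R * k))).
    have : 0 <= t%:R * k * k :> R by rewrite !mulr_ge0 // ltW.
    by lra.
  by apply: ler_wpM2l => //; lra.
(* [(r / rho) ^ t] stays below [C / a 0] yet grows at least linearly by Bernoulli, which would bound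
   every natural number. *)
have bd t : t%:R <= C / a 0%N / k.
  rewrite ler_pdivlMr // ler_pdivlMr //.
  apply: (@le_trans _ _ ((1 + k) ^+ t * a 0%N)).
    by apply: ler_wpM2r; [exact: ltW|have := bern t; lra].
  have -> : 1 + k = r / rho by rewrite /k; lra.
  rewrite expr_div_n mulrAC ler_pdivrMr ?exprn_gt0 // mulrC.
  by apply: le_trans (a_le t).
have C0 : 0 <= C / a 0%N / k by have := bd 0%N; rewrite mulr0n.
by have := lt_le_trans (archi_boundP C0) (bd _); rewrite ltxx.
Qed.

Section Contraction.
Variables (R : archiRealFieldType) (V : finType) (q : nat).
Local Notation Om := {ffun V -> 'I_q}.
Variable w : Om -> R.
Hypothesis w_gt0 : forall x, 0 < w x.
Implicit Types (x y z : Om) (f g : Om -> R) (S T : {set V}) (v : V) (c : 'I_q) (d : V -> R).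

(** Dobrushin's vector of single-site oscillations, as an upper bound rather than a supremum, so
    that each step may choose a convenient [d]. *)
Definition Lip f d := forall x y v, agree [set v] x y -> `|f x - f y| <= d v.

Lemma Lip_osc f d S x y : Lip f d -> agree S x y -> `|f x - f y| <= \sum_(v in S) d v.
Proof.
move=> Hf; move Em : #|S| => m; elim: m S x Em => [|m IH] S x Em xy.
  move/eqP: Em; rewrite cards_eq0 => /eqP S0; rewrite S0 big_set0.
  suff -> : x = y by rewrite subrr normr0.
  by apply/ffunP => u; move/agreeP: xy; apply; rewrite S0 inE.
have /card_gt0P[v vS] : (0 < #|S|)%N by rewrite Em.
pose z := upd x v (y v).
have xz : agree [set v] x z by exact: agree_upd.
have zy : agree (S :\ v) z y.
  apply/agreeP => u; rewrite !inE negb_and negbK => /orP[/eqP->|uS].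
    by rewrite upd_same.
  rewrite upd_diff; first by move/agreeP: xy; apply.
  by apply: contraNneq uS => ->.
rewrite (big_setD1 v vS) /=.
have -> : f x - f y = (f x - f z) + (f z - f y) by ring.
apply: le_trans (ler_normD _ _) _; apply: lerD; first exact: Hf.
by apply: IH => //; rewrite (cardsD1 v) vS in Em; case: Em.
Qed.

Lemma reindex_agree S x x' v (F : Om -> R) : v \notin S -> agree [set v] x x' ->
  \sum_(y | agree S x' y) F y = \sum_(y | agree S x y) F (upd y v (x' v)).
Proof.
move=> vS xx'.
have xE := agree1E xx'.
have x'E : x = upd x' v (x v) by apply: agree1E; rewrite agree_sym.
rewrite (reindex_onto (fun y => upd y v (x' v)) (fun y => upd y v (x v))) /=; last first.
  move=> y /agreeP/(_ v vS) x'y; rewrite upd_upd x'y; exact: upd_id.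
apply: eq_bigl => y; apply/andP/idP => [[H1 /eqP H2]|H].
  apply/agreeP => u uS; case: (eqVneq u v) => [->|uv].
    by rewrite -H2 upd_same.
  by move/agreeP: H1 => /(_ u uS); rewrite upd_diff // => <-; rewrite xE upd_diff.
split.
  apply/agreeP => u uS; case: (eqVneq u v) => [->|uv]; first by rewrite upd_same.
  by rewrite upd_diff //; move/agreeP: H => <- //; rewrite x'E upd_diff.
by rewrite upd_upd; apply/eqP; move/agreeP: H => /(_ v vS) ->; exact: upd_id.
Qed.

Lemma card_agree S x : #|[pred y | agree S x y]| = (q ^ #|S|)%N.
Proof.
have -> : #|[pred y | agree S x y]| =
    #|family (fun u => if u \in S then predT else pred1 (x u))|.
  apply: eq_card => y; rewrite inE; apply/agreeP/familyP => H u.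
    by case: ifP => // /negbT uS; rewrite inE H.
  by move=> uS; have := H u; rewrite (negbTE uS) inE => /eqP.
rewrite card_family foldrE big_map big_enum /= (bigID (mem S)) /=.
rewrite [X in (_ * X)%N]big1 ?muln1; last by move=> u /negbTE ->; rewrite card1.
rewrite (eq_bigr (fun=> q)); first by rewrite prod_nat_const.
by move=> u ->; rewrite card_ord.
Qed.

(** Away from [S] and [B], recolouring [v] transports the conditional law unchanged, so only [d v]
    appears. For [v] in [B] the two conditional laws are each compared with the uniform law on [S],
    at a cost of [2 * eps] times the oscillation inside [S]. *)
Lemma cond_exp_Lip S (B : {set V}) (eps : R) f d :
  0 <= eps -> (forall v, 0 <= d v) ->
  (forall x y, agree S x y -> (1 - eps) * block_sum w S x <= w y * q%:R ^+ #|S|) ->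
  (forall v x x' y, v \notin S -> v \notin B -> agree [set v] x x' -> agree S x y ->
     w y / block_sum w S x = w (upd y v (x' v)) / block_sum w S x') ->
  Lip f d ->
  Lip (cond_exp w S f) (fun v => if v \in S then 0 else
     d v + (if v \in B then 4%:R * eps * \sum_(u in S) d u else 0)).
Proof.
move=> eps0 d0 Hunif Hloc Hf x x' v xx'.
case: ifPn => vS.
  by rewrite (cond_exp_inv w f (agree_sub _ xx')) ?sub1set // subrr normr0.
pose D := \sum_(u in S) d u.
have D0 : 0 <= D by apply: sumr_ge0.
case: ifPn => vB; last first.
  rewrite addr0 /cond_exp [X in _ - X / _](reindex_agree _ vS xx') !mulr_suml -sumrB.
  rewrite (eq_bigr (fun y => w y / block_sum w S x * (f y - f (upd y v (x' v))))); last first.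
    by move=> y xy; rewrite ![_ * f _ / _]mulrAC -(Hloc _ _ _ _ vS vB xx' xy) mulrBr.
  apply: le_trans (ler_norm_sum _ _ _) _.
  apply: (@le_trans _ _ (\sum_(y | agree S x y) w y / block_sum w S x * d v)).
    apply: ler_sum => y _; rewrite normrM ger0_norm; last first.
      by rewrite divr_ge0 ?ltW // block_sum_gt0.
    apply: ler_wpM2l; first by rewrite divr_ge0 ?ltW // block_sum_gt0.
    exact/Hf/agree_upd.
  by rewrite -!mulr_suml divff ?mul1r // gt_eqF // block_sum_gt0.
pose m : R := q%:R ^+ #|S|.
have m0 : 0 < m.
  rewrite exprn_gt0 // ltr0n; case: (q) (x v) => [[]//|//].
pose U y := (\sum_(z | agree S y z) f z) / m.
have AU y : `|cond_exp w S f y - U y| <= 2%:R * eps * D.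
  have sumu : \sum_(z | agree S y z) m^-1 = 1.
    rewrite sumr_const card_agree -[_ *+ _]mulr_natr natrX mulVf //; exact: lt0r_neq0.
  have sump : \sum_(z | agree S y z) w z / block_sum w S y = 1.
    by rewrite -mulr_suml divff // gt_eqF // block_sum_gt0.
  have -> : cond_exp w S f y - U y =
      \sum_(z | agree S y z) (w z / block_sum w S y - m^-1) * (f z - f y).
    rewrite (eq_bigr (fun z => w z * f z / block_sum w S y - f z / m -
        (f y * (w z / block_sum w S y) - f y * m^-1))); last by move=> z _; ring.
    by rewrite !sumrB -!mulr_sumr sumu sump /cond_exp /U !mulr_suml; ring.
  apply: le_trans (ler_norm_sum _ _ _) _.
  (* A lower bound p >= (1 - eps) / m suffices: |p - 1/m| <= (p - 1/m) + 2 eps / m, and the first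
     bracket sums to zero. *)
  apply: (@le_trans _ _ (\sum_(z | agree S y z)
      (w z / block_sum w S y - m^-1 + 2%:R * eps * m^-1) * D)).
    apply: ler_sum => z yz; rewrite normrM; apply: ler_pM => //.
      have H : (1 - eps) / m <= w z / block_sum w S y.
        rewrite ler_pdivrMr // mulrAC ler_pdivlMr ?block_sum_gt0 //; exact: Hunif.
      have e0 : 0 <= eps / m by rewrite divr_ge0 // ltW.
      by rewrite ler_norml; apply/andP; split; lra.
    by rewrite distrC; apply: Lip_osc; rewrite // agree_sym in yz *.
  rewrite -mulr_suml big_split sumrB sump sumu -mulr_sumr sumu /=; lra.
have UU : `|U x - U x'| <= d v.
  rewrite /U [X in _ - X / _](reindex_agree _ vS xx') -mulrBl -sumrB.
  rewrite normrM [X in _ * X]ger0_norm ?invr_ge0 ?(ltW m0) // ler_pdivrMr //.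
  apply: le_trans (ler_norm_sum _ _ _) _.
  apply: (@le_trans _ _ (\sum_(y | agree S x y) d v)).
    by apply: ler_sum => y _; apply: Hf; apply: agree_upd.
  by rewrite sumr_const card_agree -[_ *+ _]mulr_natr natrX.
have -> : cond_exp w S f x - cond_exp w S f x' =
  (cond_exp w S f x - U x) + (U x - U x') - (cond_exp w S f x' - U x') by ring.
apply: le_trans (ler_normB _ _) _.
have := ler_normD (cond_exp w S f x - U x) (U x - U x').
have := AU x; have := AU x'; rewrite -/D; lra.
Qed.

End Contraction.

(** * Spectral gap of block dynamics and comparison with single sites *)

Section Gap.
Variables (R : archiRealFieldType) (V : finType) (q : nat).
Local Notation Om := {ffun V -> 'I_q}.
Variable w : Om -> R.
Hypothesis w_gt0 : forall x, 0 < w x.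
Implicit Types (x y z : Om) (f g : Om -> R) (S T : {set V}) (v : V) (c : 'I_q) (d : V -> R).
Local Notation A := (cond_exp w).
Local Notation N := (sqnorm w).
Local Notation ip := (inner_prod w).
Local Notation n := (#|V|%:R : R).

Definition block_avg (Sb : V -> {set V}) f x := n^-1 * \sum_u A (Sb u) f x.

Lemma inner_prod_sum f (I : finType) (F : I -> Om -> R) :
  ip (fun x => \sum_i F i x) f = \sum_i ip (F i) f.
Proof.
rewrite /inner_prod exchange_big /=; apply: eq_bigr => x _.
by rewrite mulr_sumr mulr_suml.
Qed.

Lemma inner_prod_avg Sb f g : ip (block_avg Sb f) g = n^-1 * \sum_u ip (A (Sb u) f) g.
Proof. by rewrite /block_avg inner_prodZl inner_prod_sum. Qed.

Lemma inner_prod_avgC Sb f g : ip (block_avg Sb f) g = ip f (block_avg Sb g).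
Proof.
rewrite inner_prod_avg [RHS]inner_prodC inner_prod_avg; congr (_ * _); apply: eq_bigr => u _.
by rewrite inner_prod_cond_exp inner_prodC.
Qed.

Lemma total_block_avg Sb f : (0 < #|V|)%N -> total w (block_avg Sb f) = total w f.
Proof.
move=> V0; have -> : total w (block_avg Sb f) = n^-1 * \sum_u total w (A (Sb u) f).
  rewrite /total /block_avg exchange_big /= mulr_sumr; apply: eq_bigr => x _.
  by rewrite mulrCA mulr_sumr.
rewrite (eq_bigr (fun=> total w f)); last by move=> u _; rewrite total_cond_exp.
by rewrite sumr_const -[total w f *+ _]mulr_natl mulKf // pnatr_eq0 -lt0n.
Qed.

Section Block.
Variables (Sb B : V -> {set V}) (eps : R).
Hypothesis Sb_self : forall u, u \in Sb u.
Hypothesis eps_ge0 : 0 <= eps.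
Hypothesis Bsmall : forall u, 4%:R * eps * #|B u|%:R <= 2%:R^-1.
Hypothesis Hunif : forall u x y, agree (Sb u) x y ->
  (1 - eps) * block_sum w (Sb u) x <= w y * q%:R ^+ #|Sb u|.
Hypothesis Hloc : forall u v x x' y, v \notin Sb u -> v \notin B u ->
  agree [set v] x x' -> agree (Sb u) x y ->
  w y / block_sum w (Sb u) x = w (upd y v (x' v)) / block_sum w (Sb u) x'.
Hypothesis V0 : (0 < #|V|)%N.

Let n0 : 0 < n. Proof. by rewrite ltr0n. Qed.

(** Block [u] erases the oscillation it contains and, by [Bsmall], recreates at most half of it on
    its boundary. Since [u] lies in its own block, the net loss is at least [d u / 2]; averaging
    over [u] gives the factor. *)
Lemma avg_contract f d : (forall v, 0 <= d v) -> Lip f d ->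
  exists d', [/\ forall v, 0 <= d' v, Lip (block_avg Sb f) d' &
    \sum_v d' v <= (1 - (2%:R * n)^-1) * \sum_v d v].
Proof.
move=> d0 Hf.
pose du u v := if v \in Sb u then 0 else
  d v + (if v \in B u then 4%:R * eps * \sum_(s in Sb u) d s else 0).
have du0 u v : 0 <= du u v.
  rewrite /du; case: ifP => // _; rewrite addr_ge0 //; case: ifP => // _.
  by rewrite !mulr_ge0 ?sumr_ge0.
have Hdu u : Lip (A (Sb u) f) (du u).
  by apply: cond_exp_Lip (@Hunif u) (@Hloc u) Hf.
exists (fun v => n^-1 * \sum_u du u v); split.
- by move=> v; rewrite mulr_ge0 ?invr_ge0 ?(ltW n0) // sumr_ge0.
- move=> x y v xy; rewrite /block_avg -mulrBr -sumrB normrM ger0_norm ?invr_ge0 ?(ltW n0) //.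
  rewrite ler_pM2l ?invr_gt0 //; apply: le_trans (ler_norm_sum _ _ _) _.
  by apply: ler_sum => u _; apply: Hdu.
rewrite -mulr_sumr exchange_big /=.
have Hu u : \sum_v du u v <= \sum_v d v - 2%:R^-1 * d u.
  have -> : \sum_v du u v = \sum_(v | v \notin Sb u) d v +
     \sum_(v | v \notin Sb u) (if v \in B u then 4%:R * eps * \sum_(s in Sb u) d s else 0).
    by rewrite -big_split [RHS]big_mkcond /=; apply: eq_bigr => v _; rewrite /du; case: ifP.
  set D := \sum_(s in Sb u) d s.
  have D0 : 0 <= D by apply: sumr_ge0.
  have -> : \sum_v d v = D + \sum_(v | v \notin Sb u) d v by rewrite (bigID (mem (Sb u))).
  have HB : \sum_(v | v \notin Sb u) (if v \in B u then 4%:R * eps * D else 0)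
       <= 2%:R^-1 * D.
    apply: (@le_trans _ _ (\sum_(v in B u) 4%:R * eps * D)).
      rewrite big_mkcond [leRHS]big_mkcond /=; apply: ler_sum => v _.
      by case: (v \in B u); case: ifP => // _; rewrite !mulr_ge0.
    by rewrite sumr_const -[_ *+ _]mulr_natr mulrAC; apply: ler_wpM2r.
  have dD : d u <= D.
    by rewrite /D (bigD1 u) //= lerDl; apply: sumr_ge0.
  lra.
have -> : (1 - (2%:R * n)^-1) * \sum_v d v = n^-1 * \sum_u (\sum_v d v - 2%:R^-1 * d u).
  rewrite sumrB sumr_const -mulr_sumr -[_ *+ _]mulr_natl; field.
  by rewrite pnatr_eq0 -lt0n.
by rewrite ler_pM2l ?invr_gt0 //; apply: ler_sum.
Qed.

Lemma iter_avg_contract f : exists2 D, 0 <= D & forall t, exists d,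
  [/\ forall v, 0 <= d v, Lip (iter t (block_avg Sb) f) d &
    \sum_v d v <= (1 - (2%:R * n)^-1) ^+ t * D].
Proof.
pose M := \sum_x `|f x|.
have M0 : 0 <= M by apply: sumr_ge0.
have HM x : `|f x| <= M by rewrite /M (bigD1 x) //= lerDl sumr_ge0.
have th0 : 0 <= 1 - (2%:R * n)^-1.
  rewrite subr_ge0 invf_le1 ?mulr_gt0 //.
  have : 1 <= n by rewrite ler1n.
  lra.
exists (\sum_(v : V) 2%:R * M); first by apply: sumr_ge0 => v _; rewrite mulr_ge0.
elim=> [|t [d [d0 Hd Hs]]].
  exists (fun=> 2%:R * M); split; first by move=> v; rewrite mulr_ge0.
    move=> x y v _ /=; apply: le_trans (ler_normB _ _) _.
    by have := HM x; have := HM y; lra.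
  by rewrite expr0 mul1r.
have [d' [d'0 Hd' Hs']] := avg_contract d0 Hd.
exists d'; split => //; apply: le_trans Hs' _.
by rewrite exprS -mulrA; apply: ler_wpM2l.
Qed.

Lemma mean0_osc f D x : (0 < total w (fun=> 1)) -> total w f = 0 ->
  (forall y z, `|f y - f z| <= D) -> `|f x| <= D.
Proof.
move=> W0 f0 HD.
have E : total w (fun=> 1) * f x = \sum_y w y * (f x - f y).
  under [RHS]eq_bigr => y _ do rewrite mulrBr.
  rewrite sumrB -[X in _ = _ - X]/(total w f) f0 subr0 mulr_suml.
  by apply: eq_bigr => y _; rewrite mulr1.
rewrite -(ler_pM2l W0) -[X in X * `|_|]gtr0_norm // -normrM E.
apply: le_trans (ler_norm_sum _ _ _) _; rewrite mulr_suml; apply: ler_sum => y _.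
by rewrite mulr1 normrM gtr0_norm // ler_pM2l.
Qed.

Lemma block_poincare f : total w f = 0 ->
  N f <= 2%:R * \sum_u N (fun x => f x - A (Sb u) f x).
Proof.
move=> f0.
(* Without any colour there are no configurations and both sides vanish; otherwise the total weight
   is positive. *)
case: (pickP (mem {: Om})) => [x0 _|no]; last first.
  rewrite /sqnorm /inner_prod big1 ?mulr_ge0 ?sumr_ge0 // => [u _|x _]; first exact: sqnorm_ge0.
  by have := no x.
have W0 : 0 < total w (fun=> 1).
  rewrite /total (bigD1 x0) //= mulr1; apply: ltr_wpDr => //.
  by apply: sumr_ge0 => y _; rewrite mulr1 ltW.
pose th := 1 - (2%:R * n)^-1.
have th0 : 0 < th.
  rewrite /th subr_gt0 invf_lt1 ?mulr_gt0 //.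
  have : 1 <= n by rewrite ler1n.
  lra.
have [D D0 HD] := iter_avg_contract f.
have tot0 t : total w (iter t (block_avg Sb) f) = 0.
  by elim: t => //= t IH; rewrite total_block_avg.
have bd t : N (iter t (block_avg Sb) f) <= (total w (fun=> 1) * D ^+ 2) * (th ^+ 2) ^+ t.
  have [d [d0 Hd Hs]] := HD t.
  have H x : `|iter t (block_avg Sb) f x| <= th ^+ t * D.
    apply: mean0_osc => // y z; apply: le_trans Hs.
    have := Lip_osc Hd (agree_setT y z).
    by rewrite [X in _ <= X -> _](eq_bigl xpredT) // => v; rewrite in_setT.
  rewrite /sqnorm /inner_prod /total !mulr_suml; apply: ler_sum => x _.
  rewrite mulr1 -mulrA -[leRHS]mulrA ler_pM2l // -expr2 -real_normK ?num_real //.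
  have -> : D ^+ 2 * (th ^+ 2) ^+ t = (th ^+ t * D) ^+ 2.
    by rewrite [RHS]exprMn exprAC [RHS]mulrC.
  by rewrite ler_pXn2r ?nnegrE ?mulr_ge0 ?exprn_ge0 // ltW.
have lc t : N (iter t.+1 (block_avg Sb) f) ^+ 2 <=
    N (iter t (block_avg Sb) f) * N (iter t.+2 (block_avg Sb) f).
  by rewrite {1}/sqnorm [iter t.+1 _ _]/= inner_prod_avgC; apply: Cauchy_Schwarz.
have HP := log_convex_ratio (exprn_gt0 2 th0) (fun t => sqnorm_ge0 w_gt0 _) lc bd.
rewrite /= in HP.
(* The weight [th] balances the two terms: since [N (block_avg Sb f) <= th ^+ 2 * N f], both are at
   most [th * N f]. *)
have HA := inner_prod_amgm w_gt0 f (block_avg Sb f) th0.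
have HP' : N (block_avg Sb f) / th <= th * N f.
  by rewrite ler_pdivrMr // mulrAC -expr2.
have HI : ip f (block_avg Sb f) <= th * N f by lra.
(* The Dirichlet form of the averaged projections, by Pythagoras block by block. *)
have E : \sum_u N (fun x => f x - A (Sb u) f x) = n * (N f - ip f (block_avg Sb f)).
  rewrite -inner_prod_avgC inner_prod_avg.
  rewrite (eq_bigr (fun u => N f - ip (A (Sb u) f) f)); last first.
    by move=> u _; rewrite [N f](sqnorm_pythagoras w_gt0 (Sb u)) inner_prod_cond_exp_self //; ring.
  rewrite sumrB sumr_const -[_ *+ _]mulr_natl mulrBr mulVKf //.
  by rewrite pnatr_eq0 -lt0n.
rewrite E mulrA.
have -> : N f = 2%:R * n * ((2%:R * n)^-1 * N f).
  by rewrite mulVKf // mulf_neq0 // ?pnatr_eq0 // -lt0n.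
rewrite ler_pM2l ?mulr_gt0 //; rewrite mulVKf ?mulf_neq0 ?pnatr_eq0 // -?lt0n //.
move: HI; rewrite /th; lra.
Qed.

End Block.

(** * Comparison of a block with its single sites *)

Section Compare.
Variable M : R.
Hypothesis M1 : 1 <= M.
Hypothesis Mw : forall x v c, w x <= M * w (upd x v c).

(** Uniform recolouring stands in for [cond_exp w [set v]]: it preserves independence of the other
    sites, which a conditional expectation may destroy, so its composition over a block no longer
    depends on the block. The price is the factor [M]. *)
Definition unif_avg v f x := (\sum_(c : 'I_q) f (upd x v c)) / q%:R.

Let q_gt0 x v : 0 < q%:R :> R.
Proof. by rewrite ltr0n; case: (q) (x v) => [[]|]. Qed.

Lemma sqr_sum_le (F : 'I_q -> R) : (\sum_c F c) ^+ 2 <= q%:R * \sum_c F c ^+ 2.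
Proof.
case: (posnP q) => [q0|q0].
  by rewrite !big1 ?mulr0 ?expr0n // => -[m Hm]; exfalso; rewrite q0 in Hm.
have qr : 0 < q%:R :> R by rewrite ltr0n.
pose m := (\sum_c F c) / q%:R.
have : 0 <= \sum_c (F c - m) ^+ 2 by apply: sumr_ge0 => c _; apply: sqr_ge0.
under eq_bigr => c _ do rewrite sqrrB.
rewrite big_split sumrB /= sumr_const card_ord sumrMnl -mulr_suml => H.
have : 0 <= q%:R * (\sum_c F c ^+ 2 - (\sum_c F c) * m *+ 2 + m ^+ 2 *+ q).
  by rewrite mulr_ge0 // ltW.
rewrite -[m ^+ 2 *+ q]mulr_natl /m.
have -> : q%:R * (\sum_c F c ^+ 2 - (\sum_c F c) * ((\sum_c F c) / q%:R) *+ 2 +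
  q%:R * ((\sum_c F c) / q%:R) ^+ 2) = q%:R * (\sum_c F c ^+ 2) - (\sum_c F c) ^+ 2.
  by field; rewrite gt_eqF.
by rewrite subr_ge0.
Qed.

(** Convexity of the square, after which [Mw] moves the weight to the recoloured configuration. *)
Lemma sqnorm_unif_avg v f : N (unif_avg v f) <= M * N f.
Proof.
apply: (@le_trans _ _ (\sum_x \sum_c M / q%:R * (w (upd x v c) * f (upd x v c) * f (upd x v c)))).
  apply: ler_sum => x _; have qr := q_gt0 x v.
  rewrite /unif_avg -mulrA -expr2 expr_div_n.
  have H := sqr_sum_le (fun c => f (upd x v c)).
  apply: (@le_trans _ _ (w x * ((\sum_c f (upd x v c) ^+ 2) / q%:R))).
    rewrite ler_pM2l // ler_pdivrMr ?exprn_gt0 //.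
    by rewrite [q%:R ^+ 2]expr2 mulrA divfK ?gt_eqF // [leRHS]mulrC.
  rewrite mulr_suml mulr_sumr; apply: ler_sum => c _.
  have := ler_wpM2r (_ : 0 <= f (upd x v c) ^+ 2 / q%:R) (Mw x v c).
  rewrite divr_ge0 ?sqr_ge0 ?(ltW qr) // => /(_ isT) /le_trans; apply.
  by rewrite le_eqVlt; apply/orP; left; apply/eqP; ring.
rewrite (sum_upd (fun x => M / q%:R * (w x * f x * f x))) /sqnorm /inner_prod !mulr_sumr.
apply: ler_sum => x _; have qr := q_gt0 x v.
by rewrite le_eqVlt; apply/orP; left; apply/eqP; field; rewrite gt_eqF.
Qed.

Lemma unif_avg_upd v f x c : unif_avg v f (upd x v c) = unif_avg v f x.
Proof. by congr (_ / _); apply: eq_bigr => c' _; rewrite upd_upd. Qed.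

Lemma unif_avg_of_inv v f : block_inv [set v] f -> unif_avg v f =1 f.
Proof.
move=> Hf x; have qr := q_gt0 x v; rewrite /unif_avg.
under eq_bigr => c _ do rewrite -(Hf _ _ (agree_upd x v c)).
by rewrite sumr_const card_ord -[_ *+ _]mulr_natr mulfK // gt_eqF.
Qed.

Lemma unif_avg_sub v f g x : unif_avg v (fun y => f y - g y) x = unif_avg v f x - unif_avg v g x.
Proof. by rewrite /unif_avg sumrB mulrBl. Qed.

(** [unif_avg v] fixes [A [set v] f], so [f] may be replaced by [g = f - A [set v] f] on the
    left. *)
Lemma sqnorm_sub_unif_avg v f : N (fun x => f x - unif_avg v f x) <=
  (2%:R + 2%:R * M) * N (fun x => f x - A [set v] f x).
Proof.
pose g x := f x - A [set v] f x.
have -> : N (fun x => f x - unif_avg v f x) = N (fun x => g x + (-1) * unif_avg v g x).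
  apply: eq_sqnorm => x; rewrite {2}/g unif_avg_sub (unif_avg_of_inv (cond_exp_inv _ _)) /g; ring.
apply: le_trans (sqnorm_add_le w_gt0 _ _) _; rewrite sqnorm_scale.
have := sqnorm_unif_avg v g; rewrite -/g; lra.
Qed.

Lemma unif_avg_inv v v' f : block_inv [set v'] f -> block_inv [set v'] (unif_avg v f).
Proof.
move=> Hf x y xy; congr (_ / _); apply: eq_bigr => c _; apply: Hf.
apply/agreeP => u; rewrite !ffunE; case: eqP => // _; by move/agreeP: xy; apply.
Qed.

Lemma unif_avgs_inv (vs : seq V) f v : v \in vs -> block_inv [set v] (foldr unif_avg f vs).
Proof.
elim: vs => //= u vs IH; rewrite inE => /orP[/eqP ->|/IH]; last exact: unif_avg_inv.
by move=> x y /agree1E ->; rewrite unif_avg_upd.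
Qed.

Lemma block_inv_of_sites S f : (forall v, v \in S -> block_inv [set v] f) -> block_inv S f.
Proof.
move=> H x y xy.
(* Outside [S] a crude global bound is enough: the oscillation across [S] only adds up the zeros. *)
have L : Lip f (fun v => if v \in S then 0 else \sum_x `|f x| + \sum_x `|f x|).
  move=> x' y' v' xy'; case: ifPn => vS; first by rewrite (H _ vS _ _ xy') subrr normr0.
  apply: le_trans (ler_normB _ _) _.
  by apply: lerD; [rewrite (bigD1 x')|rewrite (bigD1 y')] => //=; rewrite lerDl sumr_ge0.
have := Lip_osc L xy; rewrite big1; last by move=> v ->.
by rewrite normr_le0 subr_eq0 => /eqP.
Qed.

(** One vertex at a time, writing [f - U g = (f - U f) + U (f - g)] for the uniform recolouring [U];
    each vertex costs at most a factor [4 + 4 * M]. *)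
Lemma sqnorm_sub_unif_avgs (vs : seq V) f : N (fun x => f x - foldr unif_avg f vs x) <=
  (4%:R + 4%:R * M) ^+ size vs * \sum_(v <- vs) N (fun x => f x - A [set v] f x).
Proof.
elim: vs => [|v vs IH] /=.
  rewrite big_nil mulr0 (_ : N _ = 0) // /sqnorm /inner_prod big1 // => x _; rewrite subrr; ring.
set g := foldr unif_avg f vs in IH *.
have -> : N (fun x => f x - unif_avg v g x) =
   N (fun x => (f x - unif_avg v f x) + unif_avg v (fun y => f y - g y) x).
  by apply: eq_sqnorm => x; rewrite unif_avg_sub; ring.
apply: le_trans (sqnorm_add_le w_gt0 _ _) _; rewrite big_cons.
have H1 := sqnorm_sub_unif_avg v f; have H2 := sqnorm_unif_avg v (fun y => f y - g y).
set s := \sum_(_ <- _) _ in IH *.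
have s0 : 0 <= s by apply: sumr_ge0 => u _; apply: sqnorm_ge0.
set a := N (fun x => f x - A [set v] f x) in H1 *.
have a0 : 0 <= a by apply: sqnorm_ge0.
set k := (4%:R + 4%:R * M) ^+ size vs in IH *.
have M_ge1 := M1.
have k1 : 1 <= k by apply: exprn_ege1; lra.
set b := N (fun x => f x - g x) in IH H2.
have H3 : M * b <= M * (k * s) by apply: ler_wpM2l => //; lra.
have H4 : (4%:R + 4%:R * M) * a <= (4%:R + 4%:R * M) * (k * a).
  apply: ler_wpM2l; first by lra.
  by rewrite -{1}[a]mul1r; apply: ler_wpM2r.
have ks : 0 <= k * s by rewrite mulr_ge0 //; lra.
have ks' : 0 <= M * (k * s) by rewrite mulr_ge0 //; lra.
rewrite exprS -/k -mulrA mulrDr; lra.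
Qed.

(** [A S f] is the nearest function independent of [S], hence at least as near as the composed
    recolourings. *)
Lemma sqnorm_block_le_sites S f : N (fun x => f x - A S f x) <=
  (4%:R + 4%:R * M) ^+ #|S| * \sum_(v in S) N (fun x => f x - A [set v] f x).
Proof.
have := sqnorm_sub_unif_avgs (enum S) f; rewrite -cardE big_enum /= => H; apply: le_trans H.
apply: cond_exp_minimizes => //; apply: block_inv_of_sites => v vS; apply: unif_avgs_inv.
by rewrite mem_enum.
Qed.

End Compare.

End Gap.

(** * From a Poincare inequality to mixing *)

Section Mixing.
Variables (R : archiRealFieldType) (V : finType) (q : nat).
Local Notation Om := {ffun V -> 'I_q}.
Variable w : Om -> R.
Hypothesis w_gt0 : forall x, 0 < w x.
Hypothesis V0 : (0 < #|V|)%N.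
Implicit Types (x y z : Om) (f g : Om -> R) (v : V).
Local Notation N := (sqnorm w).
Local Notation ip := (inner_prod w).
Local Notation n := (#|V|%:R : R).

(** The heat-bath kernel of an arbitrary weight; [glauber_P_kern] identifies it with [glauber_P]. *)
Definition kern x y := n^-1 * \sum_v
  (if agree [set v] x y then w y / block_sum w [set v] x else 0).

Fixpoint kern_iter t x y : R :=
  if t is t'.+1 then \sum_z kern_iter t' x z * kern z y else (x == y)%:R.

Definition glauber_op f := block_avg w (fun v => [set v]) f.

Lemma glauber_opE f x : glauber_op f x = \sum_y kern x y * f y.
Proof.
under eq_bigr => y _ do rewrite /kern -mulrA mulr_suml.
rewrite -mulr_sumr exchange_big /glauber_op /block_avg /=; congr (_ * _); apply: eq_bigr => v _.
rewrite /cond_exp mulr_suml [RHS](bigID (agree [set v] x)) /= [X in _ + X]big1 ?addr0.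
  by apply: eq_bigr => y ->; rewrite mulrAC.
by move=> y /negbTE ->; rewrite mul0r.
Qed.

Lemma kern_rev x y : w x * kern x y = w y * kern y x.
Proof.
rewrite /kern mulrCA [RHS]mulrCA; congr (_ * _); rewrite !mulr_sumr; apply: eq_bigr => v _.
rewrite agree_sym; case: ifP => [xy|]; last by rewrite !mulr0.
by rewrite (block_sum_inv w xy) mulrCA.
Qed.

Lemma kern_ge0 x y : 0 <= kern x y.
Proof.
rewrite mulr_ge0 ?invr_ge0 ?ler0n ?sumr_ge0 // => v _; case: ifP => // _.
by rewrite divr_ge0 ?ltW // block_sum_gt0.
Qed.

Lemma kern_iter_ge0 t x y : 0 <= kern_iter t x y.
Proof.
elim: t y => /= [|t IH] y; first by rewrite ler0n.
by apply: sumr_ge0 => z _; rewrite mulr_ge0 ?kern_ge0.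
Qed.

Lemma sum_kern x : \sum_y kern x y = 1.
Proof.
transitivity (glauber_op (fun=> 1) x); first by rewrite glauber_opE; under [RHS]eq_bigr do rewrite mulr1.
rewrite /glauber_op /block_avg (eq_bigr (fun=> 1)); last by move=> v _; apply: cond_exp_of_inv.
by rewrite sumr_const mulVf // pnatr_eq0 -lt0n.
Qed.

Lemma sum_kern_iter t x : \sum_y kern_iter t x y = 1.
Proof.
elim: t => /= [|t IH].
  by rewrite (bigD1 x) //= eqxx big1 ?addr0 // => y; rewrite eq_sym => /negbTE ->.
rewrite exchange_big /= -[RHS]IH; apply: eq_bigr => z _.
by rewrite -mulr_sumr sum_kern mulr1.
Qed.

Lemma kern_stat y : \sum_x w x * kern x y = w y.
Proof.
under eq_bigr => x _ do rewrite kern_rev.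
by rewrite -mulr_sumr sum_kern mulr1.
Qed.

Lemma kern_iter_stat t y : \sum_x w x * kern_iter t x y = w y.
Proof.
elim: t y => /= [|t IH] y.
  by rewrite (bigD1 y) //= eqxx mulr1 big1 ?addr0 // => x /negbTE ->; rewrite mulr0.
under eq_bigr => x _ do rewrite mulr_sumr.
rewrite exchange_big /= -[RHS]kern_stat; apply: eq_bigr => z _.
by rewrite -[in RHS](IH z) mulr_suml; apply: eq_bigr => x _; rewrite mulrA.
Qed.

(** By reversibility, the density of the law at time [t] with respect to [w] evolves under the same
    operator as functions do. *)
Lemma kern_iter_glauber_op x0 t y :
  kern_iter t x0 y / w y = iter t glauber_op (fun y => (x0 == y)%:R / w y) y.
Proof.
elim: t y => //= t IH y; rewrite glauber_opE mulr_suml; apply: eq_bigr => z _.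
rewrite -IH; have : kern z y = w y * kern y z / w z.
  by rewrite -kern_rev mulrAC divff ?mul1r // gt_eqF.
move=> ->; field; by rewrite !gt_eqF.
Qed.

Lemma glauber_op_sub f a x : glauber_op (fun y => f y - a) x = glauber_op f x - a.
Proof.
rewrite !glauber_opE; under eq_bigr do rewrite mulrBr.
by rewrite sumrB -mulr_suml sum_kern mul1r.
Qed.

Lemma iter_glauber_op_sub f a t x : iter t glauber_op (fun y => f y - a) x = iter t glauber_op f x - a.
Proof.
elim: t x => //= t IH x; rewrite -glauber_op_sub !glauber_opE.
by apply: eq_bigr => y _; rewrite IH.
Qed.

Section Poincare.
Variable C : R.
Hypothesis C0 : 0 < C.
Hypothesis poincare : forall f, total w f = 0 ->
  N f <= C * \sum_v N (fun x => f x - cond_exp w [set v] f x).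
Let gam := (C * n)^-1.
Let n0 : 0 < n. Proof. by rewrite ltr0n. Qed.

(** Convexity bounds the left side by the mean of [N (cond_exp w [set v] f)], which Pythagoras turns
    into [N f] minus the Dirichlet form divided by [n]; the Poincare inequality bounds the latter
    from below. *)
Lemma sqnorm_glauber_op f : total w f = 0 -> N (glauber_op f) <= (1 - gam) * N f.
Proof.
move=> f0.
have H1 : 2%:R * N (glauber_op f) <= N (glauber_op f) + n^-1 * \sum_v N (cond_exp w [set v] f).
  have -> : 2%:R * N (glauber_op f) = n^-1 * \sum_v 2%:R * ip (cond_exp w [set v] f) (glauber_op f).
    by rewrite {1}/sqnorm /glauber_op inner_prod_avg -mulr_sumr mulrCA.
  have -> : N (glauber_op f) = n^-1 * \sum_(v : V) N (glauber_op f).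
    by rewrite sumr_const -[N (glauber_op f) *+ _]mulr_natl mulKf // gt_eqF.
  rewrite -mulrDr ler_pM2l ?invr_gt0 // -big_split; apply: ler_sum => v _ /=.
  have := inner_prod_amgm w_gt0 (cond_exp w [set v] f) (glauber_op f) (@ltr01 R).
  by rewrite mul1r divr1 addrC.
have H2 : n^-1 * \sum_v N (cond_exp w [set v] f) =
    N f - n^-1 * \sum_v N (fun x => f x - cond_exp w [set v] f x).
  have {1}-> : N f = n^-1 * \sum_(v : V) N f.
    by rewrite sumr_const -[N f *+ _]mulr_natl mulKf // gt_eqF.
  rewrite -mulrBr -sumrB; congr (_ * _); apply: eq_bigr => v _.
  by rewrite [N f](sqnorm_pythagoras w_gt0 [set v]); ring.
have H3 : gam * N f <= n^-1 * \sum_v N (fun x => f x - cond_exp w [set v] f x).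
  rewrite /gam invfM -mulrA mulrCA ler_pM2l ?invr_gt0 //.
  by rewrite mulrC ler_pdivrMr // mulrC; apply: poincare.
lra.
Qed.

Lemma gam_le1 f : 0 < N f -> total w f = 0 -> 0 <= 1 - gam.
Proof.
by move=> Nf f0; have := sqnorm_glauber_op f0 => /(le_trans (sqnorm_ge0 w_gt0 _)); rewrite pmulr_lge0.
Qed.

Lemma total_glauber_op f : total w (glauber_op f) = total w f. Proof. exact: total_block_avg. Qed.

Lemma sqnorm_iter_glauber_op f t : total w f = 0 -> N (iter t glauber_op f) <= (1 - gam) ^+ t * N f.
Proof.
move=> f0; have f0t s : total w (iter s glauber_op f) = 0 by elim: s => //= s IH; rewrite total_glauber_op.
have [Nf|Nf] := leP (N f) 0.
  have Nf0 : N f = 0 by apply/eqP; rewrite eq_le Nf sqnorm_ge0.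
  rewrite Nf0 mulr0; elim: t => [|t IH]; first by rewrite Nf0.
  have N0 : N (iter t glauber_op f) = 0 by apply/eqP; rewrite eq_le IH sqnorm_ge0.
  by apply: le_trans (sqnorm_glauber_op (f0t t)) _; rewrite N0 mulr0.
have g0 := gam_le1 Nf f0.
elim: t => [|t IH]; first by rewrite expr0 mul1r.
by apply: le_trans (sqnorm_glauber_op (f0t t)) _; rewrite exprS -mulrA; apply: ler_wpM2l.
Qed.

(** Cauchy-Schwarz against the constant 1, applied to the centred density of the chain. The absolute
    value is there because [1 - gam >= 0] is derived only from a mean-zero function of positive
    norm. *)
Lemma l1_kern_iter x0 t :
  (\sum_y `|kern_iter t x0 y - w y / \sum_x w x|) ^+ 2 <=
  (\sum_x w x) / w x0 * `|1 - gam| ^+ t.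
Proof.
set W := \sum_x w x.
have W0 : 0 < W by rewrite /W (bigD1 x0) //= ltr_wpDr // sumr_ge0 // => y _; apply: ltW.
pose h y := (x0 == y)%:R / w y.
pose g y := h y - W^-1.
have tot_g : total w g = 0.
  rewrite /total /g; under eq_bigr do rewrite mulrBr.
  rewrite sumrB -mulr_suml -/W divff ?gt_eqF // (bigD1 x0) //= /h eqxx mulrCA.
  rewrite divff ?gt_eqF // mulr1 big1 ?addr0 ?subrr // => y.
  by rewrite eq_sym => /negbTE ->; rewrite mul0r mulr0.
have N_g : N g <= (w x0)^-1.
  rewrite /g sqnorm_sub.
  have -> : N h = (w x0)^-1.
    rewrite /sqnorm /inner_prod (bigD1 x0) //= /h eqxx big1 => [|y].
      by rewrite addr0 /= ?mulr1n; field; rewrite gt_eqF.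
    by rewrite eq_sym => /negbTE ->; rewrite mul0r mulr0.
  have -> : ip h (fun=> W^-1) = W^-1.
    rewrite /inner_prod (bigD1 x0) //= /h eqxx big1 => [|y].
      by rewrite addr0 /= ?mulr1n; field; rewrite !gt_eqF.
    by rewrite eq_sym => /negbTE ->; rewrite mul0r mulr0 mul0r.
  have -> : N (fun=> W^-1) = W^-1.
    by rewrite /sqnorm /inner_prod -!mulr_suml -/W divff ?gt_eqF // mul1r.
  have : 0 < W^-1 by rewrite invr_gt0.
  lra.
pose gt := iter t glauber_op g.
have -> : \sum_y `|kern_iter t x0 y - w y / W| = ip (fun y => `|gt y|) (fun=> 1).
  apply: eq_bigr => y _; rewrite mulr1 -[w y in RHS]gtr0_norm // -normrM /gt.
  by rewrite iter_glauber_op_sub -kern_iter_glauber_op mulrBr mulrCA divff ?mulr1 // gt_eqF.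
apply: le_trans (Cauchy_Schwarz w_gt0 _ _) _.
have -> : N (fun=> 1) = W by apply: eq_bigr => x _; rewrite !mulr1.
have -> : N (fun y => `|gt y|) = N gt.
  apply: eq_bigr => y _; rewrite -!mulrA; congr (_ * _).
  by rewrite -!expr2 real_normK // num_real.
rewrite mulrC -mulrA ler_pM2l //.
apply: le_trans (sqnorm_iter_glauber_op t tot_g) _.
apply: (@le_trans _ _ (`|1 - gam| ^+ t * N g)).
  by apply: ler_wpM2r; [exact: sqnorm_ge0|rewrite -normrX ler_norm].
by rewrite mulrC; apply: ler_wpM2r N_g; rewrite exprn_ge0.
Qed.

Lemma mixing_bound x0 (m j : nat) : C * n <= m%:R -> 1 <= C * n ->
  (\sum_y `|kern_iter (m * j) x0 y - w y / \sum_x w x|) ^+ 2 <=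
  (\sum_x w x) / w x0 * 2%:R^-1 ^+ j.
Proof.
move=> Cm C1; apply: le_trans (l1_kern_iter x0 (m * j)) _.
have Cn0 : 0 < C * n by rewrite mulr_gt0.
have g1 : 0 <= 1 - gam by rewrite /gam subr_ge0 invf_le1.
have g0 : 0 <= gam by rewrite /gam invr_ge0 ltW.
rewrite ger0_norm //; apply: ler_wpM2l.
  by apply: divr_ge0; [apply: sumr_ge0 => y _|]; exact: ltW.
rewrite exprM; apply: lerXn2r; rewrite ?nnegrE ?invr_ge0 ?exprn_ge0 //.
have bern s : 1 + s%:R * gam <= (1 + gam) ^+ s.
  elim: s => [|s IH]; first by rewrite mul0r addr0 expr0.
  rewrite exprS -natr1; apply: (@le_trans _ _ ((1 + gam) * (1 + s%:R * gam))).
    have : 0 <= s%:R * gam * gam by rewrite !mulr_ge0.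
    by lra.
  by apply: ler_wpM2l => //; lra.
have H2 : 2%:R <= (1 + gam) ^+ m.
  apply: le_trans (bern m); have : 1 <= m%:R * gam by rewrite /gam ler_pdivlMr // mul1r.
  by lra.
(* Since [1 - gam ^+ 2 <= 1], the lower bound 2 on [(1 + gam) ^+ m] becomes an upper bound 1/2 on
   [(1 - gam) ^+ m]. *)
have H3 : (1 - gam) ^+ m * (1 + gam) ^+ m <= 1.
  rewrite -exprMn; apply: exprn_ile1; last by have := sqr_ge0 gam; lra.
  by rewrite mulr_ge0 //; lra.
rewrite -[leRHS]mul1r ler_pdivlMr //; apply: le_trans H3.
by apply: ler_wpM2l => //; rewrite exprn_ge0.
Qed.

End Poincare.
End Mixing.

(** * Partition function of a block *)

Lemma card_fibers (T I : finType) (P : {set T}) (f : T -> I) :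
  (#|P| = \sum_i #|[set p in P | f p == i]|)%N.
Proof.
rewrite -sum1_card (partition_big f xpredT) //=; apply: eq_bigr => i _.
by rewrite -sum1_card; apply: eq_bigl => p; rewrite inE.
Qed.

Section Counts.
Variables (V : finType) (e : rel V).
Hypothesis e_sym : symmetric e.
Implicit Types (S T : {set V}) (u v : V).

(** Ordered pairs count an edge inside [T] twice, whereas [adj_out] counts an edge leaving [S] once;
    hence the recurring combination [#|adj_in e T| + 2 * #|adj_out e S T|]. *)
Definition adj_in T := [set p : V * V | [&& e p.1 p.2, p.1 \in T & p.2 \in T]].
Definition adj_out S T := [set p : V * V | [&& e p.1 p.2, p.1 \in T & p.2 \notin S]].
Definition bd S := [set u | (u \notin S) && [exists v in S, e v u]].

Variable q : nat.
Local Notation Om := {ffun V -> 'I_q}.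
Implicit Types (x y : Om).

Definition mono_pairs x := [set p : V * V | e p.1 p.2 && (x p.1 == x p.2)].
Definition mono_on S x := [set p in mono_pairs x | (p.1 \in S) || (p.2 \in S)].
Definition mono_off S x := [set p in mono_pairs x | ~~ ((p.1 \in S) || (p.2 \in S))].

Lemma card_mono_pairs S x : #|mono_pairs x| = (#|mono_on S x| + #|mono_off S x|)%N.
Proof.
rewrite -(cardsID [set p | (p.1 \in S) || (p.2 \in S)] (mono_pairs x)); congr (_ + _)%N.
  by apply: eq_card => p; rewrite !inE.
by apply: eq_card => p; rewrite !inE andbC.
Qed.

Lemma mono_off_agree S x y : agree S x y -> mono_off S x = mono_off S y.
Proof.
move=> /agreeP H; apply/setP => p; rewrite !inE negb_or.
case: (boolP (p.1 \in S)) => [|p1]; first by rewrite !andbF.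
case: (boolP (p.2 \in S)) => [|p2]; first by rewrite !andbF.
by rewrite !H.
Qed.

Section Rep.
Variable S : {set V}.

(* Every vertex of [S] is sent to a canonical vertex of its colour, on the boundary
   if possible: a configuration on [S] is recovered from this map and from the
   colours of its fixed points. *)
Definition rep_map y v : V :=
  if v \in S then
    if [pick u in bd S | y u == y v] is Some u then u
    else odflt v [pick u in S | y u == y v]
  else v.

Definition nonroots y := [set v in S | rep_map y v != v].

Lemma rep_map_colour y v : y (rep_map y v) = y v.
Proof.
rewrite /rep_map; case: ifP => // vS; case: pickP => [u /andP[_ /eqP]|] // _.
by case: pickP => [u /andP[_ /eqP]|].
Qed.

Lemma rep_map_in y v : v \in S -> rep_map y v \in S :|: bd S.
Proof.
move=> vS; rewrite /rep_map vS; case: pickP => [u /andP[uB _]|_].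
  by rewrite inE uB orbT.
by case: pickP => [u /andP[uB _]|_]; rewrite inE ?uB ?vS.
Qed.

Lemma rep_map_eq y v v' : v \in S -> v' \in S -> y v = y v' -> rep_map y v = rep_map y v'.
Proof.
move=> vS v'S E; rewrite /rep_map vS v'S E; case: pickP => // _.
by case: pickP => // /(_ v); rewrite vS E eqxx.
Qed.

Lemma rep_mapK y v : v \in S -> rep_map y v \in S -> rep_map y (rep_map y v) = rep_map y v.
Proof. by move=> vS rS; apply: rep_map_eq => //; rewrite rep_map_colour. Qed.

Lemma card_rep_fiber x (g : {ffun V -> V}) :
  (#|[set y | agree S x y & [ffun v => rep_map y v] == g]| <=
   q ^ #|S :\: [set v in S | g v != v]|)%N.
Proof.
set F := [set y | _ & _].
pose h y : Om := [ffun v => if (v \in S) && (g v == v) then y v else x v].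
have hinj : {in F &, injective h}.
  move=> y y'; rewrite !inE => /andP[xy /eqP gy] /andP[xy' /eqP gy'] E.
  have rg v : rep_map y v = g v by rewrite -gy ffunE.
  have rg' v : rep_map y' v = g v by rewrite -gy' ffunE.
  apply/ffunP => v; case: (boolP (v \in S)) => vS; last first.
    by move/agreeP: xy => <- //; move/agreeP: xy' => <-.
  rewrite -(rep_map_colour y) -(rep_map_colour y') rg rg'.
  case: (boolP (g v \in S)) => gS; last first.
    by move/agreeP: xy => <- //; move/agreeP: xy' => <-.
  have gg : g (g v) = g v by rewrite -{1}rg -rg rep_mapK // ?rg.
  by move/ffunP: E => /(_ (g v)); rewrite !ffunE gS gg eqxx.
rewrite -(card_in_imset hinj) -(card_agree _ x); apply/subset_leq_card/subsetP => z.
case/imsetP => y _ ->; rewrite inE; apply/agreeP => u; rewrite !inE ffunE.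
by case: (u \in S) => //=; case: eqP.
Qed.

Lemma card_repmaps :
  (#|family (fun v => if v \in S then S :|: bd S else [set v])| <=
   (#|S| + #|bd S|) ^ #|S|)%N.
Proof.
rewrite card_family foldrE big_map big_enum /= (bigID (mem S)) /=.
rewrite [X in (_ * X)%N]big1 ?muln1; last by move=> u /negbTE ->; rewrite cards1.
rewrite -prod_nat_const; apply: leq_prod => u ->.
have := cardsUI S (bd S); rewrite /=; lia.
Qed.

Variables (R : archiRealFieldType) (s K : R).
Hypothesis s1 : 1 <= s.
Hypothesis K1 : 1 <= K.
Hypothesis G1 : forall T, T \subset S -> T != set0 -> s ^+ #|adj_in T| <= K ^+ #|T|.-1.
Hypothesis G2 : forall T, T \subset S ->
  s ^+ (#|adj_in T| + 2 * #|adj_out S T|) <= K ^+ #|T|.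

Lemma card_adj_out_swap T :
  #|[set p : V * V | [&& e p.1 p.2, p.1 \notin S & p.2 \in T]]| = #|adj_out S T|.
Proof.
pose h (p : V * V) := (p.2, p.1).
have hK : involutive h by case.
rewrite -(card_imset _ (inv_inj hK)) /=; apply: eq_card => -[a b].
rewrite !inE /=; apply/imsetP/and3P => [[[a' b']] | [ab aT bS]].
  by rewrite inE /= => /and3P[ab aS bT] [-> ->]; rewrite e_sym.
by exists (b, a) => //; rewrite inE /= e_sym ab bS.
Qed.

(** Colour by colour. A colour seen on the boundary makes its whole class [T] nonroots and may gain
    every edge inside [T] or leaving [S]: this is [G2]. A colour not seen there keeps one root and
    gains only edges inside [T]: this is [G1]. *)
Lemma weight_le_nonroots y : s ^+ #|mono_on S y| <= K ^+ #|nonroots y|.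
Proof.
rewrite (card_fibers _ (fun p => y p.1)) (card_fibers (nonroots y) y) -!prodrXr.
apply: ler_prod => c _; rewrite exprn_ge0 ?(le_trans ler01) //=.
pose T := [set v in S | y v == c].
have TS : T \subset S by apply/subsetP => v; rewrite inE => /andP[].
set E := [set p in mono_on S y | _]; set r := [set p in nonroots y | _].
case: (pickP (fun u => (u \in bd S) && (y u == c))) => [u /andP[uB uc]|nob].
  have -> : r = T.
    apply/setP => v; rewrite !inE; case: (boolP (v \in S)) => //= vS.
    case: (y v =P c) => vc; rewrite ?andbF // andbT /rep_map vS.
    case: pickP => [u' /andP[u'B _]|/(_ u)]; last by rewrite uB vc uc.
    by apply/eqP => u'v; move: u'B; rewrite u'v inE vS.
  apply: le_trans (G2 TS); apply: ler_weXn2l => //.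
  rewrite mul2n -addnn -{2}card_adj_out_swap addnA.
  apply: leq_trans (leq_trans (leq_card_setU _ _) (leq_add (leq_card_setU _ _) (leqnn _))).
  apply/subset_leq_card/subsetP => -[a b]; rewrite !inE /=.
  case/andP => /andP[/andP[ab /eqP yab] abS] /eqP ac; rewrite ab -yab ac eqxx /=.
  by move: abS; case: (a \in S); case: (b \in S).
have ET : E \subset adj_in T.
  apply/subsetP => -[a b]; rewrite !inE /=.
  case/andP => /andP[/andP[ab /eqP yab] abS] /eqP ac; rewrite ab -yab ac eqxx /= !andbT.
  have nobd a' b' : e a' b' -> y b' = c -> a' \in S -> b' \in S.
    move=> a'b' bc aS; apply: contraT => bS; have := nob b'.
    rewrite inE bS bc eqxx /= andbT => /existsP[]; exists a'; by rewrite aS.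
  case/orP: abS => H; rewrite H ?andbT /=.
    by apply: nobd H => //; rewrite -yab.
  by apply: nobd H => //; rewrite e_sym.
have [T0|T0] := eqVneq T set0.
  have A0 : adj_in set0 = set0 by apply/setP => p; rewrite !inE !andbF.
  have -> : #|E| = 0%N by have := subset_leq_card ET; rewrite T0 A0 cards0 leqn0 => /eqP.
  by rewrite expr0 exprn_ege1.
apply: le_trans (_ : K ^+ #|T|.-1 <= _).
  by apply: le_trans (G1 TS T0); apply: ler_weXn2l => //; apply: subset_leq_card.
apply: ler_weXn2l => //.
have [v0 v0T] := set0Pn _ T0.
have v0S : v0 \in S := subsetP TS _ v0T.
have v0c : y v0 = c by move: v0T; rewrite inE v0S => /eqP.
have sub : T :\ rep_map y v0 \subset r.
  apply/subsetP => v; rewrite !inE => /and3P[vr vS /eqP vc].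
  rewrite vS vc eqxx andbT /= (@rep_map_eq y v v0) ?vc //.
  by rewrite eq_sym.
apply: leq_trans (subset_leq_card sub).
have := cardsD1 (rep_map y v0) T; case: (_ \in T); lia.
Qed.

(** The sum is split by representative map. The identity contributes at most [q^|S|] to the main
    term; a map with r > 0 nonroots contributes at most q^(|S| - r) K^r <= q^|S| K / q, and
    [card_repmaps] bounds the number of maps. *)
Lemma block_partition x : K <= q%:R ->
  \sum_(y | agree S x y) s ^+ #|mono_on S y| <=
  q%:R ^+ #|S| * (1 + ((#|S| + #|bd S|) ^ #|S|)%:R * K / q%:R).
Proof.
move=> Kq; have q0 : 0 < q%:R :> R by apply: lt_le_trans Kq; apply: lt_le_trans K1.
pose G : pred {ffun V -> V} :=
  mem (family (fun v => if v \in S then S :|: bd S else [set v])).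
pose rp y := [ffun v => rep_map y v].
have rpG y : G (rp y).
  apply/familyP => v; rewrite ffunE; case: ifPn => vS; first exact: rep_map_in.
  by rewrite /rep_map (negbTE vS) inE.
apply: (@le_trans _ _ (\sum_(y | agree S x y) K ^+ #|nonroots y|)).
  by apply: ler_sum => y _; apply: weight_le_nonroots.
rewrite (partition_big rp G) //=.
pose nr (g : {ffun V -> V}) := [set v in S | g v != v].
apply: (@le_trans _ _ (\sum_(g in G)
   (if g == [ffun v => v] then q%:R ^+ #|S| else 0) + \sum_(g in G) q%:R ^+ #|S| * K / q%:R)).
  rewrite -big_split /=; apply: ler_sum => g gG.
  have nrE y : rp y == g -> nonroots y = nr g.
    by move/eqP <-; apply/setP => v; rewrite !inE ffunE.
  rewrite (eq_bigr (fun=> K ^+ #|nr g|)); last by move=> y /andP[_ /nrE ->].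
  rewrite sumr_const -[K ^+ _ *+ _]mulr_natl.
  have cardle : (#|[pred y | agree S x y & rp y == g]| <= q ^ #|S :\: nr g|)%N.
    by apply: leq_trans (card_rep_fiber x g); rewrite cardsE.
  apply: (@le_trans _ _ (q%:R ^+ #|S :\: nr g| * K ^+ #|nr g|)).
    apply: ler_wpM2r; first by rewrite exprn_ge0 // (le_trans ler01).
    by rewrite -natrX ler_nat.
  have cS : (#|S :\: nr g| + #|nr g| = #|S|)%N.
    rewrite -(cardsID (nr g) S) addnC; congr (_ + _)%N; apply: eq_card => v.
    by rewrite !inE; case: (v \in S).
  have K0 : 0 <= K := le_trans ler01 K1.
  case: (posnP #|nr g|) => nr0.
    have gid : g = [ffun v => v].
      apply/ffunP => v; rewrite ffunE; case: (boolP (v \in S)) => vS.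
        move/cards0_eq: nr0 => /setP/(_ v); rewrite !inE vS /=.
        by move/negbFE/eqP.
      by have := familyP gG v; rewrite (negbTE vS) inE => /eqP.
    rewrite gid eqxx -gid nr0 mulr1 -cS nr0 addn0 lerDl.
    by rewrite !mulr_ge0 ?invr_ge0 ?exprn_ge0 // ltW.
  have -> : q%:R ^+ #|S| * K / q%:R = q%:R ^+ #|S :\: nr g| * q%:R ^+ #|nr g|.-1 * K.
    rewrite -cS exprD -{1}(prednK nr0) exprS; field; by rewrite gt_eqF.
  apply: (@le_trans _ _ (q%:R ^+ #|S :\: nr g| * q%:R ^+ #|nr g|.-1 * K)).
    rewrite -{1}(prednK nr0) exprSr mulrA; apply: ler_wpM2r => //.
    apply: ler_wpM2l; first by rewrite exprn_ge0 // ltW.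
    by apply: lerXn2r; rewrite ?nnegrE // ltW.
  by rewrite lerDr; case: ifP => // _; rewrite exprn_ge0 // ltW.
rewrite mulrDr mulr1; apply: lerD.
  rewrite -big_mkcondr /= (big_pred1 [ffun v => v]) // => g.
  rewrite andbC /=; case: eqP => // -> /=.
  apply/familyP => v; rewrite ffunE; case: ifP => vS; rewrite inE ?vS //=.
rewrite sumr_const -[_ / _ *+ _]mulr_natl.
rewrite [leRHS](_ : _ = (((#|S| + #|bd S|) ^ #|S|)%:R) * (q%:R ^+ #|S| * K / q%:R)); last by ring.
apply: ler_wpM2r.
  apply: divr_ge0; last exact: ltW.
  by apply: mulr_ge0; [apply: exprn_ge0; exact: ltW|exact: le_trans ler01 K1].
by rewrite ler_nat card_repmaps.
Qed.

End Rep.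
End Counts.

(** * The Potts weight *)

Section PottsWeight.
Variables (R : archiRealFieldType) (V : finType) (e : rel V) (q : nat) (s : R).
Hypothesis e_sym : symmetric e.
Hypothesis s1 : 1 <= s.
Local Notation Om := {ffun V -> 'I_q}.
Implicit Types (x y : Om) (S T : {set V}) (u v : V).

(* [mono_pairs] counts every monochromatic edge twice, so [s] stands for [sqrt lambda]. *)
Definition potts_weight x : R := s ^+ #|mono_pairs e x|.

Let s0 : 0 < s. Proof. exact: lt_le_trans ltr01 s1. Qed.

Lemma potts_weight_gt0 x : 0 < potts_weight x. Proof. exact: exprn_gt0. Qed.

Lemma potts_weight_on_off S x : potts_weight x = s ^+ #|mono_off e S x| * s ^+ #|mono_on e S x|.
Proof. by rewrite /potts_weight (card_mono_pairs e S) exprD mulrC. Qed.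

Lemma block_sum_potts S x : block_sum potts_weight S x =
  s ^+ #|mono_off e S x| * \sum_(y | agree S x y) s ^+ #|mono_on e S y|.
Proof.
rewrite mulr_sumr; apply: eq_bigr => y xy.
by rewrite (potts_weight_on_off S) (mono_off_agree e xy).
Qed.

Lemma potts_weight_cond S x y : agree S x y ->
  potts_weight y / block_sum potts_weight S x =
  s ^+ #|mono_on e S y| / \sum_(z | agree S x z) s ^+ #|mono_on e S z|.
Proof.
move=> xy; rewrite block_sum_potts (potts_weight_on_off S) -(mono_off_agree e xy) -mulf_div divff ?mul1r //.
by rewrite gt_eqF // exprn_gt0.
Qed.

Lemma mono_on_upd S x v c : v \notin S -> v \notin bd e S ->
  mono_on e S (upd x v c) = mono_on e S x.
Proof.
move=> vS vB; have nadj u : u \in S -> e u v = false.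
  move=> uS; apply/negbTE; apply: contra vB => uv; rewrite inE vS /=.
  by apply/existsP; exists u; rewrite uS.
apply/setP => -[a b]; rewrite !inE /= !ffunE.
case: (eqVneq a v) => [->|av]; case: (eqVneq b v) => [->|bv] //.
- by rewrite (negbTE vS) !andbF.
- by rewrite (negbTE vS) /=; case: (boolP (b \in S)) => bS; rewrite ?andbF // e_sym nadj.
- by rewrite (negbTE vS) orbF; case: (boolP (a \in S)) => aS; rewrite ?andbF // nadj.
Qed.

Lemma potts_weight_local S v x x' y : v \notin S -> v \notin bd e S -> agree [set v] x x' ->
  agree S x y ->
  potts_weight y / block_sum potts_weight S x =
  potts_weight (upd y v (x' v)) / block_sum potts_weight S x'.
Proof.
move=> vS vB xx' xy; rewrite potts_weight_cond // potts_weight_cond.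
  rewrite mono_on_upd // [in RHS](reindex_agree _ vS xx'); congr (_ / _).
  by apply: eq_bigr => z _; rewrite mono_on_upd.
apply/agreeP => u uS; rewrite ffunE; case: eqP => [->//|/eqP uv].
by move/agreeP: xy => <- //; move/agreeP: xx' => ->; rewrite ?inE.
Qed.

Section Degree.
Variable D : nat.
Hypothesis deg : forall v, (#|[set u | e v u]| <= D)%N.

Lemma card_bd S : (#|bd e S| <= D * #|S|)%N.
Proof.
have sub : bd e S \subset \bigcup_(v in S) [set u | e v u].
  apply/subsetP => u; rewrite inE => /andP[_ /existsP[v /andP[vS vu]]].
  by apply/bigcupP; exists v; rewrite ?inE.
apply: leq_trans (subset_leq_card sub) _.
apply: (@leq_trans (\sum_(v in S) D)); last by rewrite sum_nat_const mulnC.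
elim/big_rec2: _ => [|v m T _ H]; first by rewrite cards0.
by apply: leq_trans (leq_card_setU _ _) _; apply: leq_add.
Qed.

Lemma sum_deg S : (\sum_(v in S) #|[set u | e v u]| =
  #|[set p : V * V | e p.1 p.2 && (p.1 \in S)]|)%N.
Proof.
rewrite (card_fibers _ fst) big_mkcond /=; apply: eq_bigr => v _.
case: ifPn => vS.
  rewrite -(card_imset _ (fun u u' => (fun E => congr1 snd E) : (v, u) = (v, u') -> u = u')).
  apply: eq_card => -[a b]; rewrite !inE /=; apply/imsetP/idP.
    by move=> [u]; rewrite inE => vu [-> ->]; rewrite vu vS eqxx.
  by move=> /andP[/andP[ab _] /eqP av]; exists b; rewrite ?inE -?av.
apply/esym/eqP; rewrite cards_eq0; apply/eqP/setP => -[a b]; rewrite !inE /=.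
by case: eqP => [->|]; rewrite ?andbF // (negbTE vS) andbF.
Qed.

Lemma card_mono_pairs_le x : (#|mono_pairs e x| <= D * #|V|)%N.
Proof.
apply: (@leq_trans (#|[set p : V * V | e p.1 p.2 && (p.1 \in setT)]|)).
  by apply/subset_leq_card/subsetP => p; rewrite !inE => /andP[->].
rewrite -sum_deg mulnC -sum_nat_const [leqRHS](eq_bigl (mem [set: V])).
  by apply: leq_sum.
by move=> v; rewrite !inE.
Qed.

Lemma card_mono_on1 x v : irreflexive e ->
  #|mono_on e [set v] x| = (2 * #|[set u | e v u && (x u == x v)]|)%N.
Proof.
move=> irr; set B := [set u | _].
have -> : mono_on e [set v] x = [set (v, u) | u in B] :|: [set (u, v) | u in B].
  apply/setP => -[a b]; rewrite !inE /=; apply/idP/orP.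
    case/andP => /andP[ab /eqP xab] /orP[] /eqP E.
      by left; apply/imsetP; exists b; rewrite ?E // inE -E ab xab eqxx.
    by right; apply/imsetP; exists a; rewrite ?E // inE e_sym -E ab xab eqxx.
  by case=> /imsetP[u]; rewrite inE => /andP[vu /eqP xu] [-> ->];
    rewrite eqxx ?orbT xu eqxx ?vu // e_sym vu.
rewrite cardsU (_ : _ :&: _ = set0) ?cards0 ?subn0.
  by rewrite !card_imset ?mul2n ?addnn // => u u' [].
apply/setP => -[a b]; rewrite !inE; apply/negP => /andP[/imsetP[u uB [-> ->]]].
by case/imsetP => u' _ [_ E]; move: uB; rewrite inE E irr.
Qed.

(** Only the at most [2 * D] ordered pairs containing [v] are affected; this supplies the constant
    [M] of the block comparison. *)
Lemma potts_weight_ratio x v c : potts_weight x <= s ^+ (2 * D) * potts_weight (upd x v c).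
Proof.
rewrite (potts_weight_on_off [set v]) [in leRHS](potts_weight_on_off [set v]).
rewrite -(mono_off_agree e (agree_upd x v c)) mulrCA ler_pM2l ?exprn_gt0 //.
apply: (@le_trans _ _ (s ^+ (2 * D))); last first.
  by apply: ler_peMr; [apply: exprn_ge0; exact: ltW|exact: exprn_ege1].
apply: ler_weXn2l => //.
apply: (@leq_trans (#|[set (v, u) | u in [set u | e v u]] :|: [set (u, v) | u in [set u | e v u]]|)).
  apply/subset_leq_card/subsetP => -[a b]; rewrite !inE /=.
  case/andP => /andP[ab _] /orP[] /eqP E; apply/orP.
    by left; apply/imsetP; exists b; rewrite ?E // inE -E.
  by right; apply/imsetP; exists a; rewrite ?E // inE e_sym -E.
apply: leq_trans (leq_card_setU _ _) _; rewrite mul2n -addnn.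
by apply: leq_add; apply: leq_trans (leq_imset_card _ _) _; apply: deg.
Qed.

(** The whole vertex set taken as one block, whose conditional expectation of a mean-zero function
    is zero; meant for graphs too small to contain a block of the chosen size. *)
Lemma poincare_size f : total potts_weight f = 0 ->
  sqnorm potts_weight f <= (4%:R + 4%:R * s ^+ (2 * D)) ^+ #|V| *
    \sum_v sqnorm potts_weight (fun x => f x - cond_exp potts_weight [set v] f x).
Proof.
move=> f0; have M1 : 1 <= s ^+ (2 * D) by apply: exprn_ege1.
have := sqnorm_block_le_sites potts_weight_gt0 M1 potts_weight_ratio setT f; rewrite cardsT.
rewrite [X in _ * X](eq_bigl xpredT); last by move=> v; rewrite inE.
apply: le_trans; rewrite le_eqVlt; apply/orP; left; apply/eqP; apply: eq_sqnorm => x.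
rewrite /cond_exp (eq_bigl xpredT); last by move=> y; rewrite agree_setT.
by rewrite -[\sum_y _]/(total potts_weight f) f0 mul0r subr0.
Qed.

Lemma poincare_blocks (k : nat) (K : R) (Sb : V -> {set V}) f :
  (0 < #|V|)%N -> (0 < k)%N -> (0 < D)%N -> 1 <= K -> K <= q%:R ->
  (forall u, u \in Sb u) -> (forall u, (#|Sb u| <= k)%N) ->
  (forall u T, T \subset Sb u -> T != set0 ->
     s ^+ #|adj_in e T| <= K ^+ #|T|.-1) ->
  (forall u T, T \subset Sb u ->
     s ^+ (#|adj_in e T| + 2 * #|adj_out e (Sb u) T|) <= K ^+ #|T|) ->
  8%:R * ((k + D * k) ^ k)%:R * (D * k)%:R * K <= q%:R ->
  total potts_weight f = 0 ->
  sqnorm potts_weight f <= (2%:R * #|V|%:R * (4%:R + 4%:R * s ^+ (2 * D)) ^+ k) *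
    \sum_v sqnorm potts_weight (fun x => f x - cond_exp potts_weight [set v] f x).
Proof.
move=> V0 k0 D0 K1 Kq Sself Sk G1 G2 Hq f0.
have q0 : 0 < q%:R :> R by apply: lt_le_trans Kq; apply: lt_le_trans K1.
have K0 : 0 < K by apply: lt_le_trans K1.
have M1 : 1 <= s ^+ (2 * D) by apply: exprn_ege1.
(* The relative error of [block_partition]; the assumed lower bound on [q] says exactly that
   [4 * eps] times the largest boundary is at most 1/2. *)
pose eps := ((k + D * k) ^ k)%:R * K / q%:R.
have eps0 : 0 <= eps by rewrite /eps !mulr_ge0 ?invr_ge0 ?ler0n // ltW.
have epsH : 4%:R * eps * (D * k)%:R <= 2%:R^-1.
  rewrite /eps (_ : _ * _ = 4%:R * ((k + D * k) ^ k)%:R * (D * k)%:R * K / q%:R); last by ring.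
  rewrite ler_pdivrMr //; lra.
have Bk u : (#|bd e (Sb u)| <= D * k)%N.
  by apply: leq_trans (card_bd _) _; rewrite leq_mul2l Sk orbT.
have Hunif u x y : agree (Sb u) x y ->
    (1 - eps) * block_sum potts_weight (Sb u) x <= potts_weight y * q%:R ^+ #|Sb u|.
  move=> xy; have [e1|e1] := leP eps 1; last first.
    apply: (@le_trans _ _ 0); last by rewrite mulr_ge0 ?exprn_ge0 ?ltW ?potts_weight_gt0.
    by rewrite nmulr_rle0 ?subr_lt0 // ltW // block_sum_gt0 //; apply: potts_weight_gt0.
  rewrite block_sum_potts mulrCA (potts_weight_on_off (Sb u)) -(mono_off_agree e xy) -mulrA ler_pM2l ?exprn_gt0 //.
  have H1 := block_partition e_sym s1 K1 (G1 u) (G2 u) x Kq.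
  have H2 : ((#|Sb u| + #|bd e (Sb u)|) ^ #|Sb u|)%:R * K / q%:R <= eps.
    rewrite /eps !ler_pM2r ?invr_gt0 // ler_nat.
    apply: (@leq_trans ((k + D * k) ^ #|Sb u|)).
      by rewrite leq_exp2r ?leq_add //; apply/card_gt0P; exists u.
    by rewrite leq_pexp2l // addn_gt0 k0.
  (* As [s >= 1], every local weight is at least 1; what remains is (1 - eps)(1 + eps) <= 1. *)
  apply: (@le_trans _ _ (q%:R ^+ #|Sb u|)); last first.
    by apply: ler_peMl; [apply: exprn_ge0; exact: ltW|exact: exprn_ege1].
  apply: (@le_trans _ _ ((1 - eps) * (q%:R ^+ #|Sb u| * (1 + eps)))).
    apply: ler_wpM2l; first by lra.
    apply: le_trans H1 _; apply: ler_wpM2l; first by rewrite exprn_ge0 // ltW.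
    by rewrite lerD2l.
  rewrite mulrCA -[leRHS]mulr1; apply: ler_wpM2l; first by rewrite exprn_ge0 // ltW.
  by have := sqr_ge0 eps; lra.
have Bsmall u : 4%:R * eps * #|bd e (Sb u)|%:R <= 2%:R^-1.
  by apply: le_trans epsH; apply: ler_wpM2l; [rewrite mulr_ge0|rewrite ler_nat].
apply: le_trans (block_poincare potts_weight_gt0 Sself eps0 Bsmall Hunif _ V0 f0) _.
  by move=> u v x x' y; apply: potts_weight_local.
rewrite -!mulrA ler_pM2l //.
set c := (4%:R + _) ^+ k; set t := (X in _ <= _ * (_ * X)).
have t0 : 0 <= t by apply: sumr_ge0 => v _; apply: sqnorm_ge0; apply: potts_weight_gt0.
have c1 : 1 <= 4%:R + 4%:R * s ^+ (2 * D) by lra.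
have -> : #|V|%:R * (c * t) = \sum_(u : V) c * t.
  by rewrite sumr_const -[c * t *+ _]mulr_natl.
apply: ler_sum => u _; apply: le_trans (sqnorm_block_le_sites potts_weight_gt0 M1 potts_weight_ratio _ _) _.
apply: ler_pM; rewrite ?exprn_ge0 ?sumr_ge0 ?(le_trans ler01) //.
- by move=> v _; apply: sqnorm_ge0; apply: potts_weight_gt0.
- by rewrite /c ler_weXn2l.
rewrite big_mkcond; apply: ler_sum => v _; case: ifP => // _.
by apply: sqnorm_ge0; apply: potts_weight_gt0.
Qed.

End Degree.
End PottsWeight.

(** * The Glauber dynamics over the reals *)

Lemma mono_edges_double (V : finType) (e : rel V) (q : nat) (x : {ffun V -> 'I_q}) :
  symmetric e -> irreflexive e -> #|mono_pairs e x| = (2 * mono_edges e x)%N.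
Proof.
move=> e_sym e_irr; rewrite (card_fibers _ (fun p => [set p.1; p.2])) /mono_edges mulnC.
rewrite -sum_nat_const big_mkcond [RHS]big_mkcond /=; apply: eq_bigr => E _.
rewrite inE; case: existsP => [[u /existsP[v /andP[/andP[/eqP -> uv] xuv]]]|no].
  have uDv : u != v by apply: contraTneq uv => ->; rewrite e_irr.
  rewrite (_ : [set p in mono_pairs e x | _] = [set (u, v); (v, u)]).
    by rewrite cards2 xpair_eqE (negbTE uDv).
  apply/setP => -[a b]; rewrite !inE /= !xpair_eqE; apply/idP/idP; last first.
    case/orP => /andP[/eqP -> /eqP ->]; first by rewrite uv xuv eqxx.
    by rewrite e_sym uv eq_sym xuv setUC eqxx.
  case/andP => /andP[ab _] /eqP Eab.
  have aDb : a != b by apply: contraTneq ab => ->; rewrite e_irr.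
  have : a \in [set u; v] by rewrite -Eab !inE eqxx.
  have : b \in [set u; v] by rewrite -Eab !inE eqxx orbT.
  rewrite !inE => /orP[] /eqP Eb /orP[] /eqP Ea; rewrite Ea Eb ?eqxx ?orbT //;
    by rewrite Ea Eb eqxx in aDb.
apply/eqP; rewrite cards_eq0; apply/eqP/setP => -[a b]; rewrite !inE /=.
apply/negP => /andP[/andP[ab xab] /eqP EE]; apply: no.
by exists a; apply/existsP; exists b; rewrite -EE eqxx ab xab.
Qed.

Section Bridge.
Variables (V : finType) (e : rel V) (q : nat) (lam : R).
Hypothesis e_simple : simple_graph e.
Hypothesis lam1 : 1 < lam.
Local Notation Om := {ffun V -> 'I_q}.
Implicit Types (x y : Om).
Let s : R := Num.sqrt lam.
Local Notation pw := (@potts_weight R V e q s).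

Let e_sym : symmetric e. Proof. by case: e_simple. Qed.
Let e_irr : irreflexive e. Proof. by case: e_simple. Qed.
Let lam_s : s ^+ 2 = lam. Proof. by rewrite sqr_sqrtr // ltW // (lt_trans ltr01). Qed.
Let s1 : 1 <= s. Proof. by rewrite -(ler_pXn2r (n := 2)) ?nnegrE ?sqrtr_ge0 // lam_s expr1n ltW. Qed.

Lemma pow_mono_edges x : pow lam (mono_edges e x) = pw x.
Proof. by rewrite RpowE -lam_s -exprM -(mono_edges_double x e_sym e_irr). Qed.

Lemma gibbs_potts_weight x : gibbs e lam x = pw x / \sum_y pw y.
Proof.
rewrite /gibbs /Zpart RdivE pow_mono_edges; congr (_ / _).
by apply: eq_bigr => y _; apply: pow_mono_edges.
Qed.

Lemma nbr_col_upd x v c c' : nbr_col e (upd x v c) v c' = nbr_col e x v c'.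
Proof.
apply: eq_card => u; rewrite !inE ffunE; case: (u =P v) => [->|//].
by rewrite e_irr.
Qed.

Lemma pow_nbr_col x v : pow lam (nbr_col e x v (x v)) = s ^+ #|mono_on e [set v] x|.
Proof.
rewrite RpowE -lam_s -exprM card_mono_on1 //; congr (_ ^+ (2 * _)).
Qed.

Lemma glauber_P_kern x y : glauber_P e lam x y = kern pw x y.
Proof.
rewrite /glauber_P /kern RmultE RinvE INRE; congr (_ * _); apply: eq_bigr => v _.
have -> : [forall u, (u != v) ==> (x u == y u)] = agree [set v] x y.
  by apply: eq_forallb => u; rewrite inE.
case: ifP => // xy; rewrite potts_weight_cond // RdivE sum_agree1.
have xE := agree1E xy.
congr (_ / _).
  by rewrite -pow_nbr_col {2}xE nbr_col_upd.
apply: eq_bigr => c _; rewrite -pow_nbr_col nbr_col_upd.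
by rewrite upd_same.
Qed.

Lemma glauber_Pt_kern t x y : glauber_Pt e lam t x y = kern_iter pw t x y.
Proof.
elim: t y => [|t IH] y /=; first by case: eqP.
by apply: eq_bigr => z _; rewrite IH glauber_P_kern.
Qed.

Lemma tv_distE t x : tv_dist e lam t x =
  2%:R^-1 * \sum_y `|kern_iter pw t x y - pw y / \sum_z pw z|.
Proof.
rewrite /tv_dist RmultE RinvE; congr (_ * _); apply: eq_bigr => y _.
by rewrite RabsE RminusE glauber_Pt_kern gibbs_potts_weight.
Qed.

End Bridge.

Lemma exp2_dominates (a : R) : exists j : nat, a <= 2%:R ^+ j.
Proof.
have [a0|a0] := leP a 0; first by exists 0%N; rewrite expr0 (le_trans a0).
exists (Num.bound a); apply: le_trans (ltW (archi_boundP (ltW a0))) _.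
by rewrite -natrX ler_nat ltnW // ltn_expl.
Qed.

(** [C0 * n^2] steps halve the bound on the squared l1 distance. It starts at most at 2^(j1 n),
    because every weight is at least 1 and the partition function is at most (q lam^2)^n;
    [j1 * n + j2] halvings bring it below 4 eps^2. *)
Lemma rapid_of_poincare (q : nat) (lam : R) (k : nat) (eps : R) : 1 < lam -> 0 < eps ->
  exists p : list R, forall (V : finType) (e : rel V),
   (0 < #|V|)%N -> simple_graph e -> max_deg_le e 4 ->
   (forall f : {ffun V -> 'I_q} -> R, total (potts_weight e (Num.sqrt lam)) f = 0 ->
     sqnorm (potts_weight e (Num.sqrt lam)) f <=
     2%:R * #|V|%:R * (4%:R + 4%:R * Num.sqrt lam ^+ 8) ^+ k *
     \sum_v sqnorm (potts_weight e (Num.sqrt lam))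
       (fun x => f x - cond_exp (potts_weight e (Num.sqrt lam)) [set v] f x)) ->
   mix_time_le e q lam eps (peval p (INR #|V|)).
Proof.
move=> lam1 eps0; set s : R := Num.sqrt lam.
have lam_s : s ^+ 2 = lam by rewrite sqr_sqrtr // ltW // (lt_trans ltr01).
have s1 : 1 <= s by rewrite -(ler_pXn2r (n := 2)) ?nnegrE ?sqrtr_ge0 // lam_s expr1n ltW.
have s0 : 0 < s by apply: lt_le_trans s1.
have [j1 Hj1] := exp2_dominates (q%:R * s ^+ 4).
have [j2 Hj2] := exp2_dominates (4%:R * eps ^+ 2)^-1.
pose c : R := 2%:R * (4%:R + 4%:R * s ^+ 8) ^+ k.
have c1 : 1 <= c.
  have : 1 <= (4%:R + 4%:R * s ^+ 8) ^+ k.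
    by apply: exprn_ege1; have := exprn_ege1 8 s1; lra.
  by move=> h; rewrite /c -[leLHS]mul1r; apply: ler_pM; rewrite ?ler1n. 
pose C0 := Num.bound c.
have HC0 : c <= C0%:R by apply/ltW/archi_boundP; apply: le_trans c1.
(* Coefficients from the constant term upwards, for [C0 * n^2 * (j1 * n + j2)]. *)
exists [:: 0; 0; (C0 * j2)%:R; (C0 * j1)%:R] => V e V0 simple deg HP x.
have n0 : 0 < #|V|%:R :> R by rewrite ltr0n.
have n1 : 1 <= #|V|%:R :> R by rewrite ler1n.
exists (C0 * #|V| ^ 2 * (j1 * #|V| + j2))%N; split.
  apply/RleP; rewrite !INRE /peval /= !RplusE !RmultE !natrM !natrD ?natrX !natrM.
  by rewrite le_eqVlt; apply/orP; left; apply/eqP; rewrite !R0E; ring.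
have e_sym : symmetric e by case: simple.
have w0 := @potts_weight_gt0 R V e q s s1.
pose C : R := 2%:R * #|V|%:R * (4%:R + 4%:R * s ^+ 8) ^+ k.
have CE : C = c * #|V|%:R by rewrite /C /c mulrAC.
have C_gt0 : 0 < C by rewrite CE mulr_gt0 // (lt_le_trans ltr01).
have C1 : 1 <= C * #|V|%:R.
  rewrite CE -mulrA -[leLHS]mulr1; apply: ler_pM => //.
  by rewrite -[leLHS]mulr1; apply: ler_pM.
have Cm : C * #|V|%:R <= (C0 * #|V| ^ 2)%:R.
  by rewrite CE -mulrA natrM natrX -expr2; apply: ler_wpM2r => //; apply: exprn_ge0; apply: ltW.
have := mixing_bound w0 V0 C_gt0 HP x (j1 * #|V| + j2)%N Cm C1.
rewrite -/s; set S := \sum_y `|_|; set W := \sum_x _ => HS.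
have W_le : W <= (q%:R * s ^+ 4) ^+ #|V|.
  apply: (@le_trans _ _ (\sum_(x : {ffun V -> 'I_q}) s ^+ (4 * #|V|))).
    by apply: ler_sum => y _; apply: ler_weXn2l => //; apply: card_mono_pairs_le.
  by rewrite sumr_const card_ffun card_ord -[_ ^+ _ *+ _]mulr_natl natrX exprMn exprM.
have W_ge0 : 0 <= W by apply: sumr_ge0 => y _; apply: ltW.
have Wx : W / potts_weight e s x <= W.
  rewrite ler_pdivrMr // ler_peMr //; exact: exprn_ege1.
have S_ge0 : 0 <= S by apply: sumr_ge0.
have Sle : S ^+ 2 <= (2%:R * eps) ^+ 2.
  apply: le_trans HS _; apply: (@le_trans _ _ ((2%:R ^+ j1) ^+ #|V| * 2%:R^-1 ^+ (j1 * #|V| + j2))).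
    apply: ler_wpM2r; first by rewrite exprn_ge0 // invr_ge0.
    apply: (le_trans Wx); apply: le_trans W_le _; apply: lerXn2r; rewrite ?nnegrE ?exprn_ge0 //.
    by rewrite mulr_ge0 // exprn_ge0 // ltW.
  rewrite exprD -exprM !exprVn mulrA divff ?expf_neq0 ?pnatr_eq0 // mul1r.
  rewrite -[leRHS]invrK; rewrite lef_pV2 ?posrE ?exprn_gt0 ?invr_gt0 ?exprn_gt0 ?mulr_gt0 //.
  by apply: le_trans Hj2; rewrite exprMn expr2 -natrM.
rewrite (tv_distE simple lam1); apply/RleP.
suff H : S <= 2%:R * eps by rewrite mulrC ler_pdivrMr // mulrC.
by rewrite -(ler_pXn2r (n := 2)) ?nnegrE ?mulr_ge0 // ltW.
Qed.

(** * Block geometry *)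

Section CutConnected.
Local Open Scope nat_scope.
Variables (V : finType) (e : rel V).
Hypothesis e_sym : symmetric e.
Implicit Types (S T U : {set V}) (u v : V).

(** Connectivity of the induced subgraph in terms of cuts, the form in which the counting below uses
    it. *)
Definition cutconn S := forall U, U \subset S -> U != set0 -> U != S ->
  exists u v, [/\ u \in U, v \in S, v \notin U & e u v].

Definition adj_touch S U := [set p : V * V |
  [&& e p.1 p.2, p.1 \in S, p.2 \in S & (p.1 \in U) || (p.2 \in U)]].

(** Peel off a vertex [u] of [U] with a neighbour in [S] outside [U]: their edge no longer touches
    what is left of [U], so every vertex is charged an edge of its own, counted in both
    directions. *)
Lemma card_touch_ge S U : cutconn S -> U \subset S -> U != S ->
  2 * #|U| <= #|adj_touch S U|.
Proof.
move=> cS; move Em : #|U| => m; elim: m U Em => // m IH U Em US UnS.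
have U0 : U != set0 by rewrite -cards_eq0 Em.
have [u [v [uU vS vU uv]]] := cS U US U0 UnS.
have uS : u \in S := subsetP US _ uU.
have uDv : u != v by apply: contraNneq vU => <-.
have Em' : #|U :\ u| = m by rewrite (cardsD1 u) uU in Em; case: Em.
have U'S : U :\ u \subset S by apply: subset_trans US; apply: subD1set.
have U'nS : U :\ u != S.
  by apply/eqP => /setP/(_ u); rewrite !inE eqxx uS.
have := IH _ Em' U'S U'nS => H.
have sub : adj_touch S (U :\ u) :|: [set (u, v); (v, u)] \subset adj_touch S U.
  apply/subsetP => -[a b]; rewrite !inE /= !xpair_eqE.
  case/orP => [/and4P[-> -> ->]|].
    by case/orP => /andP[_ ->]; rewrite ?orbT.
  by case/orP => /andP[/eqP-> /eqP->]; rewrite uS vS uU ?orbT ?uv // e_sym uv.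
apply: leq_trans (subset_leq_card sub).
rewrite cardsU (_ : _ :&: _ = set0) ?cards0 ?subn0.
  by rewrite cards2 xpair_eqE (negbTE uDv) /=; rewrite mulnSr; apply: leq_add.
apply/setP => -[a b]; rewrite !inE /= !xpair_eqE.
apply/negP => /andP[/and4P[_ _ _ H1] /orP[] /andP[/eqP E1 /eqP E2]];
  by move: H1; rewrite E1 E2 eqxx (negbTE vU) ?andbF.
Qed.

Lemma card_touch_self S : cutconn S -> 2 * #|S|.-1 <= #|adj_touch S S|.
Proof.
move=> cS; have [->|[x xS]] := set_0Vmem S; first by rewrite cards0.
have D1 : #|S :\ x| = #|S|.-1 by rewrite [in RHS](cardsD1 x) xS.
rewrite -D1; apply: leq_trans (card_touch_ge cS (subD1set _ _) _) _.
  by apply/eqP => /setP/(_ x); rewrite !inE eqxx xS.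
by apply/subset_leq_card/subsetP => p; rewrite !inE => /and4P[-> pS -> _]; rewrite pS.
Qed.

(** Let [X] be the pairs from [U] to the rest of [S]. Twice the degree bound on
    [adj_in + X + adj_out], minus the lower bound on [adj_in + 2 X] given by the touching edges; one
    edge is missing when [U = S]. *)
Lemma cutconn_out_bound D S U :
  (forall v, #|[set u | e v u]| <= D) -> cutconn S -> U \subset S ->
  #|adj_in e U| + 2 * #|adj_out e S U| + 2 * #|U| <= 2 * (D * #|U|) + 2 * (U == S).
Proof.
move=> deg cS US.
pose X := [set p : V * V | [&& e p.1 p.2, p.1 \in U, p.2 \in S & p.2 \notin U]].
have E1 : #|adj_in e U| + #|X| + #|adj_out e S U| <= D * #|U|.
  apply: (@leq_trans (\sum_(v in U) #|[set u | e v u]|)); last first.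
    apply: (@leq_trans (\sum_(v in U) D)); last by rewrite sum_nat_const mulnC.
    by apply: leq_sum.
  rewrite sum_deg -[leqRHS](cardsID (adj_in e U :|: X)); apply: leq_add.
    apply: (@leq_trans #|adj_in e U :|: X|).
      rewrite cardsU (_ : _ :&: _ = set0) ?cards0 ?subn0 //.
      apply/setP => p; rewrite !inE; case: (p.2 \in U); rewrite ?andbF //.
    apply/subset_leq_card/subsetP => p; rewrite !inE.
    by case/orP => [/and3P[-> -> ->]|/and4P[-> -> -> ->]]; rewrite ?orbT.
  apply/subset_leq_card/subsetP => p; rewrite !inE => /and3P[-> -> pS].
  have pU : p.2 \notin U by apply: contra pS; exact: (subsetP US).
  by rewrite (negbTE pS) (negbTE pU) !andbF.
have E2 : #|adj_touch S U| <= #|adj_in e U| + 2 * #|X|.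
  pose h (p : V * V) := (p.2, p.1).
  have hK : involutive h by case.
  rewrite mul2n -addnn -{2}(card_imset X (inv_inj hK)) addnA.
  apply: leq_trans (leq_trans (leq_card_setU _ _) (leq_add (leq_card_setU _ _) (leqnn _))).
  apply/subset_leq_card/subsetP => -[a b]; rewrite inE /= => /and4P[ab aS bS].
  case: (boolP (a \in U)) => aU; case: (boolP (b \in U)) => bU // _; rewrite !inE.
  - by rewrite /= ab aU bU.
  - by rewrite /= ab aU bS bU orbT.
  apply/orP; right; apply/imsetP; exists (b, a) => //.
  by rewrite inE /= e_sym ab bU aS aU.
have E3 : 2 * #|U| <= #|adj_touch S U| + 2 * (U == S).
  case: eqP => [->|/eqP UnS]; last by rewrite addn0 card_touch_ge.
  have := card_touch_self cS; lia.
lia.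
Qed.

(** The missing edge occurs only for [T = S], where it is shared among [#|S|] vertices:
    [D + 1 / #|S|] per vertex. *)
Lemma cutconn_G2 D S T : (forall v, #|[set u | e v u]| <= D.+1) ->
  cutconn S -> T \subset S ->
  #|S| * (#|adj_in e T| + 2 * #|adj_out e S T|) <= 2 * (D * #|S| + 1) * #|T|.
Proof.
move=> deg cS TS; have := cutconn_out_bound deg cS TS.
case: eqP => [->|_] H.
  rewrite [X in _ <= X]mulnC; apply: leq_mul => //; nia.
have H' : #|adj_in e T| + 2 * #|adj_out e S T| <= 2 * D * #|T| by nia.
by apply: leq_trans (leq_mul (leqnn _) H') _; nia.
Qed.

(** Edges stay inside the fibres of [f], so the bound adds up over them. On the torus the fibres are
    rows, for horizontal edges, or columns, for vertical ones. *)
Lemma cutconn_fibers_G2 (I : finType) (f : V -> I) (b D : nat) S T :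
  (forall v, #|[set u | e v u]| <= D.+1) ->
  (forall u v, e u v -> f u = f v) ->
  (forall i, [set v in S | f v == i] != set0 ->
     cutconn [set v in S | f v == i] /\ #|[set v in S | f v == i]| = b) ->
  T \subset S ->
  b * (#|adj_in e T| + 2 * #|adj_out e S T|) <= 2 * (D * b + 1) * #|T|.
Proof.
move=> deg ef cS TS.
rewrite (card_fibers (adj_in e T) (fun p => f p.1)) (card_fibers (adj_out e S T) (fun p => f p.1)).
rewrite (card_fibers T f) !big_distrr /= -big_split /= big_distrr /=.
apply: leq_sum => i _.
set Si := [set v in S | f v == i]; set Ti := [set v in T | _].
have TiS : Ti \subset Si.
  by apply/subsetP => v; rewrite !inE => /andP[/(subsetP TS) -> ->].
have -> : [set p in adj_in e T | f p.1 == i] = adj_in e Ti.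
  apply/setP => -[u v]; rewrite !inE /=; case: (boolP (e u v)) => //= /ef ->.
  by case: (f v == i); rewrite ?andbT ?andbF.
have -> : [set p in adj_out e S T | f p.1 == i] = adj_out e Si Ti.
  apply/setP => -[u v]; rewrite !inE /=; case: (boolP (e u v)) => //= /ef ->.
  by case: (f v == i); rewrite ?andbT ?andbF.
have [S0|S0] := eqVneq Si set0.
  have -> : #|Ti| = 0 by apply/eqP; rewrite -leqn0 (leq_trans (subset_leq_card TiS)) // S0 cards0.
  have T0 : Ti = set0 by apply/eqP; rewrite -subset0 -S0.
  have A0 : adj_in e set0 = set0 by apply/setP => p; rewrite !inE !andbF.
  have B0 : adj_out e Si set0 = set0 by apply/setP => p; rewrite !inE !andbF.
  by rewrite T0 A0 B0 !cards0 !muln0.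
have [cSi cb] := cS i S0; have := cutconn_G2 deg cSi TiS; rewrite cb //.
Qed.

Lemma cutconn_grow S : (forall u v, connect e u v) -> S != set0 -> S != setT ->
  cutconn S -> exists2 w, w \notin S & cutconn (w |: S).
Proof.
move=> conn S0 ST cS.
have [u [w [uS wS uw]]] : exists u w, [/\ u \in S, w \notin S & e u w].
  have [u uS] := set0Pn _ S0.
  have [w wS] : exists w, w \notin S.
    apply/existsP; rewrite -negb_forall; apply: contra ST => /forallP H.
    by apply/eqP/setP => v; rewrite H inE.
  case: (boolP [exists u', exists w', [&& u' \in S, w' \notin S & e u' w']]).
    by case/existsP => u' /existsP[w' /and3P[]]; exists u', w'.
  move=> no; have clS : closed e (mem S).
    have H x y : e x y -> x \in S -> y \in S.
      move=> xy xS; apply: contraT => yS; case/negP: no.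
      by apply/existsP; exists x; apply/existsP; exists y; rewrite xS yS.
    by move=> x y xy; apply/idP/idP; apply: H => //; rewrite e_sym.
  by move: wS; rewrite -(closed_connect clS (conn u w)) uS.
exists w => // U US U0 UnS.
case: (boolP (w \in U)) => wU.
  have [E|ne] := eqVneq (U :\ w) set0.
    exists w, u; split => //; [by rewrite !inE uS orbT| |by rewrite e_sym].
    apply/negP => uU; have : u \in U :\ w.
      by rewrite !inE uU andbT; apply: contraNneq wS => <-.
    by rewrite E inE.
  have sub : U :\ w \subset S.
    apply/subsetP => x; rewrite !inE => /andP[xw /(subsetP US)].
    by rewrite !inE (negbTE xw).
  have neS : U :\ w != S.
    apply: contraNneq UnS => E; apply/eqP/setP => x; rewrite !inE -E !inE.
    by case: eqP => // ->.
  have [a [b [aU bS bU ab]]] := cS _ sub ne neS.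
  exists a, b; split; rewrite ?inE ?bS ?orbT //; first by move: aU; rewrite !inE => /andP[].
  by move: bU; rewrite !inE; case: eqP => //= bw; rewrite bw (negbTE wS) in bS.
have sub : U \subset S.
  apply/subsetP => x xU; have := subsetP US _ xU; rewrite !inE => /orP[/eqP E|//].
  by rewrite -E xU in wU.
have [->|neS] := eqVneq U S.
  by exists u, w; split; rewrite // !inE eqxx.
have [a [b [aU bS bU ab]]] := cS _ sub U0 neS.
by exists a, b; split; rewrite ?inE ?bS ?orbT.
Qed.

Lemma cutconn_exists v k : (forall u v, connect e u v) -> 0 < k <= #|V| ->
  exists S, [/\ v \in S, #|S| = k & cutconn S].
Proof.
move=> conn; elim: k => // k IH /andP[_ kV].
have [k0|k0] := posnP k.
  exists [set v]; rewrite inE cards1 k0; split => // U.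
  by rewrite subset1 => /orP[/eqP ->|->]; rewrite ?eqxx.
have [|S [vS cS ccS]] := IH; first by rewrite k0 ltnW.
have [||w wS cw] := cutconn_grow conn _ _ ccS.
- by apply/set0Pn; exists v.
- by apply/eqP => E; rewrite E cardsT in cS; rewrite cS ltnn in kV.
exists (w |: S); split => //; first by rewrite !inE vS orbT.
by rewrite cardsU1 wS cS.
Qed.

(** A discrete intermediate value argument: membership in [U] changes between two consecutive
    vertices of the path. *)
Lemma path_cutconn (g : nat -> V) (l : nat) S :
  (forall v, v \in S -> exists2 i, i < l & v = g i) ->
  (forall i, i < l -> g i \in S) ->
  (forall i, i.+1 < l -> e (g i) (g i.+1)) -> cutconn S.
Proof.
move=> Sg gS ge U US U0 UnS.
have step (P : pred nat) i j : i <= j -> P i != P j ->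
    exists k, [/\ i <= k, k < j & P k != P k.+1].
  move=> ij; rewrite -(subnKC ij); elim: (j - i) => [|d IH]; first by rewrite addn0 eqxx.
  rewrite addnS => H; have [E|E] := eqVneq (P i) (P (i + d)).
    by exists (i + d); split; rewrite ?leq_addr // -E.
  by have [k [H1 H2 H3]] := IH E; exists k; split => //; apply: leq_trans H2 _.
have [u uU] := set0Pn _ U0.
have [w wS wU] : exists2 w, w \in S & w \notin U.
  have : ~~ (S \subset U) by apply: contra UnS => SU; rewrite eqEsubset US.
  by case/subsetPn => w; exists w.
have [i il ui] := Sg _ (subsetP US _ uU); have [j jl wj] := Sg _ wS.
have [k [kl Hk]] : exists k, k.+1 < l /\ (g k \in U) != (g k.+1 \in U).
  have ne : (g i \in U) != (g j \in U) by rewrite -ui -wj uU (negbTE wU).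
  have [ij|ij] := leqP i j.
    by have [k [_ kj Hk]] := step (fun k => g k \in U) _ _ ij ne; exists k; split; first exact: leq_ltn_trans jl.
  rewrite eq_sym in ne.
  by have [k [_ kj Hk]] := step (fun k => g k \in U) _ _ (ltnW ij) ne;
    exists k; split; first exact: leq_ltn_trans il.
have gk := ge _ kl.
case: (boolP (g k \in U)) Hk => gU; case: (boolP (g k.+1 \in U)) => gU' // _.
  by exists (g k), (g k.+1); split; rewrite ?gS.
by exists (g k.+1), (g k); split; rewrite ?gS 1?e_sym // ltnW.
Qed.

Lemma card_adj_in_le D T : irreflexive e -> (forall v, #|[set u | e v u]| <= D) ->
  #|adj_in e T| <= #|T| * minn D #|T|.-1.
Proof.
move=> irr deg; rewrite (card_fibers _ fst) (bigID (mem T)) /= [X in _ + X]big1.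
  rewrite addn0 -sum_nat_const; apply: leq_sum => v vT.
  have -> : #|[set p in adj_in e T | p.1 == v]| = #|[set u in T | e v u]|.
    rewrite -(card_imset _ (fun u u' => (fun E => congr1 snd E) : (v, u) = (v, u') -> u = u')).
    apply: eq_card => -[a b]; rewrite !inE /=; apply/idP/imsetP.
      by move=> /andP[/and3P[ab aT bT] /eqP av]; exists b; rewrite ?inE -?av ?ab ?bT.
    by move=> [u]; rewrite inE => /andP[uT vu] [-> ->]; rewrite vu vT uT eqxx.
  rewrite leq_min; apply/andP; split.
    by apply: leq_trans (deg v); apply/subset_leq_card/subsetP => u; rewrite !inE => /andP[].
  rewrite (cardsD1 v T) vT /=; apply/subset_leq_card/subsetP => u.
  rewrite !inE => /andP[-> vu]; rewrite andbT; apply: contraTneq vu => ->.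
  by rewrite irr.
move=> v vT; apply/eqP; rewrite cards_eq0; apply/eqP/setP => p; rewrite !inE.
by case: eqP => [->|]; rewrite ?(negbTE vT) ?andbF.
Qed.

(** An orientation with at most one edge out of each vertex, and none from [u0] into [T], leaves at
    most [#|T| - 1] edges. *)
Lemma card_adj_in_orient (r : rel V) T u0 :
  (forall u v, e u v -> r u v || r v u) -> (forall u v v', r u v -> r u v' -> v = v') ->
  u0 \in T -> (forall v, v \in T -> ~~ r u0 v) -> #|adj_in e T| <= 2 * #|T|.-1.
Proof.
move=> er rf u0T u0max; pose Q := [set p : V * V | [&& r p.1 p.2, p.1 \in T & p.2 \in T]].
have cQ : #|Q| <= #|T|.-1.
  have inj : {in Q &, injective (@fst V V)}.
    move=> [a b] [a' b']; rewrite !inE /= => /and3P[r1 _ _] /and3P[r2 _ _] E.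
    by rewrite -E in r2 *; rewrite (rf _ _ _ r1 r2).
  rewrite (cardsD1 u0 T) u0T /= -(card_in_imset inj); apply/subset_leq_card/subsetP => u.
  case/imsetP => -[a b]; rewrite !inE /= => /and3P[rab aT bT] ->; rewrite aT andbT.
  by apply: contraTneq rab => ->; apply: u0max.
pose h (p : V * V) := (p.2, p.1).
have hK : involutive h by case.
apply: (@leq_trans (#|Q :|: [set h p | p in Q]|)).
  apply/subset_leq_card/subsetP => -[a b]; rewrite !inE /= => /and3P[/er /orP[rab|rab] aT bT].
    by rewrite rab aT bT.
  by apply/orP; right; apply/imsetP; exists (b, a); rewrite // inE /= rab aT bT.
apply: leq_trans (leq_card_setU _ _) _; rewrite (card_imset _ (inv_inj hK)); lia.
Qed.

End CutConnected.

(** * Toroidal grids *)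

Section Torus.
Local Open Scope nat_scope.
Variable L : nat.
Local Notation V := ('I_L * 'I_L)%type.
Implicit Types (u v : V) (T : {set V}).

Definition cyc_next (a b : 'I_L) := nat_of_ord b == (a + 1) %% L.
Definition cyc (a b : 'I_L) := cyc_next a b || cyc_next b a.
Definition hadj : rel V := fun u v => (u.2 == v.2) && cyc u.1 v.1.
Definition vadj : rel V := fun u v => (u.1 == v.1) && cyc u.2 v.2.

Lemma torus_adjE u v : torus_adj L u v = hadj u v || vadj u v.
Proof.
rewrite /torus_adj /hadj /vadj /cyc /cyc_next.
by rewrite [X in _ && X || _]orbC [X in _ || _ && X]orbC.
Qed.

Lemma cyc_sym a b : cyc a b = cyc b a. Proof. exact: orbC. Qed.
Lemma hadj_sym : symmetric hadj.
Proof. by move=> u v; rewrite /hadj eq_sym cyc_sym. Qed.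
Lemma vadj_sym : symmetric vadj.
Proof. by move=> u v; rewrite /vadj eq_sym cyc_sym. Qed.

Lemma cyc_next_inj a b b' : cyc_next a b -> cyc_next a b' -> b = b'.
Proof. by move=> /eqP E /eqP E'; apply: ord_inj; rewrite E E'. Qed.

Lemma cyc_next_injl a a' b : cyc_next a b -> cyc_next a' b -> a = a'.
Proof.
rewrite /cyc_next => /eqP -> /eqP E; apply: ord_inj; have := ltn_ord a; have := ltn_ord a'.
have [aL|aL] := ltnP (a + 1) L; have [a'L|a'L] := ltnP (a' + 1) L => ? ?; move: E.
- by rewrite !modn_small //; lia.
- have -> : a' + 1 = L by lia.
  by rewrite modnn modn_small //; lia.
- have -> : a + 1 = L by lia.
  by rewrite modnn modn_small //; lia.
lia.
Qed.

Lemma card_cyc a : #|[set b | cyc a b]| <= 2.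
Proof.
have H (r : rel 'I_L) : (forall b b', r a b -> r a b' -> b = b') -> #|[set b | r a b]| <= 1.
  by move=> rf; apply/card_le1P => b; rewrite inE => rb b'; rewrite !inE; apply/idP/eqP => [rb'|-> //]; apply: rf.
apply: leq_trans (leq_trans (subset_leq_card _) (leq_card_setU [set b | cyc_next a b] [set b | cyc_next b a])) _.
  by apply/subsetP => b; rewrite !inE.
apply: (@leq_add _ _ 1 1); first by apply: (H cyc_next) => b b'; apply: cyc_next_inj.
by apply: (H (fun a b => cyc_next b a)) => b b'; apply: cyc_next_injl.
Qed.

Lemma hadj_deg v : #|[set u | hadj v u]| <= 2.
Proof.
apply: leq_trans (leq_trans (subset_leq_card _) (leq_imset_card (fun b => (b, v.2)) _)) (card_cyc v.1).
apply/subsetP => -[a b]; rewrite !inE /hadj /= => /andP[/eqP <- va].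
by apply/imsetP; exists a; rewrite ?inE.
Qed.

Lemma vadj_deg v : #|[set u | vadj v u]| <= 2.
Proof.
apply: leq_trans (leq_trans (subset_leq_card _) (leq_imset_card (fun b => (v.1, b)) _)) (card_cyc v.2).
apply/subsetP => -[a b]; rewrite !inE /vadj /= => /andP[/eqP <- va].
by apply/imsetP; exists b; rewrite ?inE.
Qed.

Variable l : nat.
Hypothesis l0 : 0 < l.
Hypothesis lL : l < L.

(* Squares are shifted towards the origin so as not to wrap around the torus. *)
Definition start (a : 'I_L) := minn a (L - l).
Definition segment (a b : 'I_L) := start a <= b < start a + l.
Definition square u := [set p : V | segment u.1 p.1 && segment u.2 p.2].

Lemma start_le a : start a + l <= L.
Proof. by rewrite /start; have := ltn_ord a; lia. Qed.

Lemma segment_self a : segment a a.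
Proof. by rewrite /segment /start; have := ltn_ord a; lia. Qed.

Let pt (k : nat) : 'I_L := insubd (Ordinal lL) k.

Lemma ptE k : k < L -> pt k = k :> nat.
Proof. by move=> kL; rewrite /pt val_insubd kL. Qed.

Lemma square_self u : u \in square u.
Proof. by rewrite inE !segment_self. Qed.

Lemma card_segment a : #|[set b | segment a b]| = l.
Proof.
pose g (i : 'I_l) := pt (start a + i).
have gE (i : 'I_l) : g i = start a + i :> nat.
  by apply: ptE; have := start_le a; have := ltn_ord i; lia.
have gi : injective g.
  by move=> i j /(congr1 (@nat_of_ord L)); rewrite !gE => E; apply: ord_inj; lia.
rewrite -[RHS]card_ord -(card_imset _ gi); apply: eq_card => b; rewrite inE.
apply/idP/imsetP => [/andP[ab bl]|[i _ ->]].
  have il : b - start a < l by lia.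
  by exists (Ordinal il) => //; apply: ord_inj; rewrite gE /=; lia.
by rewrite /segment gE; have := ltn_ord i; lia.
Qed.

Lemma card_square u : #|square u| = l * l.
Proof.
have -> : square u = setX [set b | segment u.1 b] [set b | segment u.2 b].
  by apply/setP => p; rewrite !inE.
by rewrite cardsX !card_segment.
Qed.

Lemma square_row u i : segment u.2 i ->
  [set v in square u | v.2 == i] = [set (b, i) | b in [set b | segment u.1 b]].
Proof.
move=> ui; apply/setP => -[a b]; rewrite !inE /=; apply/andP/imsetP.
  by move=> [/andP[ua _] /eqP ->]; exists a; rewrite ?inE.
by move=> [c]; rewrite inE => uc [-> ->]; rewrite uc ui.
Qed.

Lemma square_col u i : segment u.1 i ->
  [set v in square u | v.1 == i] = [set (i, b) | b in [set b | segment u.2 b]].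
Proof.
move=> ui; apply/setP => -[a b]; rewrite !inE /=; apply/andP/imsetP.
  by move=> [/andP[_ ub] /eqP ->]; exists b; rewrite ?inE.
by move=> [c]; rewrite inE => uc [-> ->]; rewrite uc ui.
Qed.

Lemma next_pt k : k.+1 < L -> cyc_next (pt k) (pt k.+1).
Proof. by move=> kL; rewrite /cyc_next !ptE // ?(ltnW kL) // addn1 modn_small. Qed.

Lemma square_row_cutconn u i : [set v in square u | v.2 == i] != set0 ->
  cutconn hadj [set v in square u | v.2 == i] /\ #|[set v in square u | v.2 == i]| = l.
Proof.
case/set0Pn => v; rewrite !inE => /andP[/andP[_ u2] /eqP vi]; rewrite vi in u2.
rewrite square_row //; split; last first.
  by rewrite card_imset ?card_segment // => b b' [].
have sl := start_le u.1.
apply: (@path_cutconn _ _ hadj_sym (fun k => (pt (start u.1 + k), i)) l).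
- move=> p /imsetP[b]; rewrite inE => /andP[ub bu] ->; exists (b - start u.1); first by lia.
  by congr (_, _); apply: ord_inj; rewrite ptE; lia.
- move=> k kl; apply/imsetP; exists (pt (start u.1 + k)) => //.
  by rewrite inE /segment ptE; lia.
by move=> k kl; rewrite /hadj eqxx /cyc addnS next_pt //; lia.
Qed.

Lemma square_col_cutconn u i : [set v in square u | v.1 == i] != set0 ->
  cutconn vadj [set v in square u | v.1 == i] /\ #|[set v in square u | v.1 == i]| = l.
Proof.
case/set0Pn => v; rewrite !inE => /andP[/andP[u1 _] /eqP vi]; rewrite vi in u1.
rewrite square_col //; split; last first.
  by rewrite card_imset ?card_segment // => b b' [].
have sl := start_le u.2.
apply: (@path_cutconn _ _ vadj_sym (fun k => (i, pt (start u.2 + k))) l).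
- move=> p /imsetP[b]; rewrite inE => /andP[ub bu] ->; exists (b - start u.2); first by lia.
  by congr (_, _); apply: ord_inj; rewrite ptE; lia.
- move=> k kl; apply/imsetP; exists (pt (start u.2 + k)) => //.
  by rewrite inE /segment ptE; lia.
by move=> k kl; rewrite /vadj eqxx /cyc addnS next_pt //; lia.
Qed.

(** A step to a smaller coordinate would wrap from L - 1 to 0, and a segment of length [l < L] does
    not contain both. *)
Lemma segment_max c a b : segment c a -> segment c b -> b <= a -> ~~ cyc_next a b.
Proof.
rewrite /segment /cyc_next => ca cb ba; have sl := start_le c.
have [aL|aL] := ltnP (a + 1) L; first by rewrite modn_small //; lia.
have aE : a + 1 = L by have := ltn_ord a; lia.
by rewrite aE modnn; lia.
Qed.

Lemma torus_adj_in T :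
  #|adj_in (torus_adj L) T| <= #|adj_in hadj T| + #|adj_in vadj T|.
Proof.
apply: leq_trans (leq_card_setU _ _); apply/subset_leq_card/subsetP => p.
by rewrite !inE torus_adjE => /and3P[/orP[]-> -> ->]; rewrite ?orbT.
Qed.

Lemma torus_adj_out S T :
  #|adj_out (torus_adj L) S T| <= #|adj_out hadj S T| + #|adj_out vadj S T|.
Proof.
apply: leq_trans (leq_card_setU _ _); apply/subset_leq_card/subsetP => p.
by rewrite !inE torus_adjE => /and3P[/orP[]-> -> ->]; rewrite ?orbT.
Qed.

(** Oriented by successor, each direction has no outgoing edge at a vertex of largest coordinate,
    hence at most [#|T| - 1] edges. *)
Lemma torus_G1 u T : T \subset square u -> T != set0 ->
  #|adj_in (torus_adj L) T| <= 4 * #|T|.-1.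
Proof.
move=> TS /set0Pn[t tT]; apply: leq_trans (torus_adj_in T) _.
have inS v : v \in T -> segment u.1 v.1 && segment u.2 v.2.
  by move/(subsetP TS); rewrite inE.
have -> : 4 * #|T|.-1 = 2 * #|T|.-1 + 2 * #|T|.-1 by lia.
apply: leq_add.
  case: (arg_maxnP (fun v : V => v.1 : nat) tT) => t0 t0T t0max.
  apply: (@card_adj_in_orient _ _ (fun u v => (u.2 == v.2) && cyc_next u.1 v.1) _ t0) => //.
  - by move=> a b /andP[/eqP ab]; rewrite ab eqxx.
  - move=> [a1 a2] [b1 b2] [c1 c2] /= /andP[/eqP <- n1] /andP[/eqP <- n2].
    by rewrite (cyc_next_inj n1 n2).
  move=> v vT; rewrite negb_and; apply/orP; right.
  have /andP[s1 _] := inS _ t0T; have /andP[s2 _] := inS _ vT.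
  by apply: segment_max s1 s2 _; apply: t0max.
case: (arg_maxnP (fun v : V => v.2 : nat) tT) => t0 t0T t0max.
apply: (@card_adj_in_orient _ _ (fun u v => (u.1 == v.1) && cyc_next u.2 v.2) _ t0) => //.
- by move=> a b /andP[/eqP ab]; rewrite ab eqxx.
- move=> [a1 a2] [b1 b2] [c1 c2] /= /andP[/eqP <- n1] /andP[/eqP <- n2].
  by rewrite (cyc_next_inj n1 n2).
move=> v vT; rewrite negb_and; apply/orP; right.
have /andP[_ s1] := inS _ t0T; have /andP[_ s2] := inS _ vT.
by apply: segment_max s1 s2 _; apply: t0max.
Qed.

Lemma torus_G2 u T : T \subset square u ->
  l * (#|adj_in (torus_adj L) T| + 2 * #|adj_out (torus_adj L) (square u) T|) <=
  2 * (2 * l + 2) * #|T|.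
Proof.
move=> TS.
have H1 := cutconn_fibers_G2 hadj_sym hadj_deg (f := snd) _ (@square_row_cutconn u) TS.
have H2 := cutconn_fibers_G2 vadj_sym vadj_deg (f := fst) _ (@square_col_cutconn u) TS.
have {}H1 := H1 (fun a b H => eqP (proj1 (andP H))).
have {}H2 := H2 (fun a b H => eqP (proj1 (andP H))).
apply: leq_trans (leq_mul (leqnn l) (leq_add (torus_adj_in T) (leq_mul (leqnn 2) (torus_adj_out _ T)))) _.
rewrite [2 * (#|_| + _)]mulnDr addnACA mulnDr.
apply: leq_trans (leq_add H1 H2) _; by rewrite -mulnDl leq_mul2r; apply/orP; right; lia.
Qed.

End Torus.

Lemma torus_max_deg (L : nat) : (1 < L)%N -> max_deg_le (torus_adj L) 4.
Proof.
move=> L1 v.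
apply: leq_trans (leq_trans (subset_leq_card _) (leq_card_setU [set u | hadj v u] [set u | vadj v u])) _.
  by apply/subsetP => u; rewrite !inE torus_adjE.
by apply: (@leq_add _ _ 2 2); [apply: hadj_deg|apply: vadj_deg].
Qed.

Lemma torus_simple (L : nat) : (1 < L)%N -> simple_graph (torus_adj L).
Proof.
move=> L1; have cycxx (a : 'I_L) : cyc a a = false.
  rewrite /cyc orbb /cyc_next; apply/negbTE; have := ltn_ord a; have [aL|aL] := ltnP (a + 1)%N L.
    by rewrite modn_small //; lia.
  have -> : (a + 1 = L)%N by have := ltn_ord a; lia.
  by rewrite modnn; lia.
split; first by move=> u v; rewrite !torus_adjE hadj_sym vadj_sym.
by move=> u; rewrite torus_adjE /hadj /vadj !cycxx !andbF.
Qed.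

(** * Rapid mixing *)

(** The equation [K ^+ b = lam ^+ a] lets edge counts be compared with powers of [K] through natural
    exponents only. *)
Lemma Rpower_frac (lam : R) (a b : nat) (x : R) : 1 < lam -> (0 < b)%N ->
  a%:R / b%:R <= x ->
  exists K : R, [/\ 1 <= K, K ^+ b = lam ^+ a & K <= Rpower lam x].
Proof.
move=> lam1 b0 abx; have br : 0 < b%:R :> R by rewrite ltr0n.
have lam0 : Rlt 0 lam by apply/RltP; apply: lt_trans lam1.
have lam1' : Rle 1 lam by apply/RleP; apply: ltW.
exists (Rpower lam (a%:R / b%:R)); split.
- rewrite -[leLHS](Rpower_O lam lam0); apply/RleP/Rle_Rpower => //; apply/RleP.
  by rewrite divr_ge0.
- rewrite -!RpowE -!Rpower_pow //; last exact: exp_pos.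
  by rewrite Rpower_mult !INRE; congr Rpower; rewrite RmultE divfK // gt_eqF.
by apply/RleP/Rle_Rpower => //; apply/RleP.
Qed.

Section Rapid.
Variables (q : nat) (lam : R).
Hypothesis lam1 : 1 < lam.
Let s : R := Num.sqrt lam.

Let lam_s : s ^+ 2 = lam. Proof. by rewrite sqr_sqrtr // ltW // (lt_trans ltr01). Qed.
Let s1 : 1 <= s. Proof. by rewrite -(ler_pXn2r (n := 2)) ?nnegrE ?sqrtr_ge0 // lam_s expr1n ltW. Qed.

Lemma pow_transfer (K : R) (a b m r : nat) : (0 < b)%N -> 1 <= K ->
  K ^+ b = lam ^+ a -> (b * m <= 2 * a * r)%N -> s ^+ m <= K ^+ r.
Proof.
move=> b0 K1 Kab H; rewrite -(ler_pXn2r b0) ?nnegrE ?exprn_ge0 ?(le_trans ler01) //.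
rewrite [leRHS]exprAC Kab -lam_s -!exprM; apply: ler_weXn2l => //.
by rewrite mulnC.
Qed.

(** Graphs with at most [k] vertices and graphs covered by blocks receive the same constant, so one
    polynomial serves the whole class. *)
Lemma potts_poincare (V : finType) (e : rel V) (k a b : nat) (K : R)
    (Sb : V -> {set V}) (f : {ffun V -> 'I_q} -> R) :
  simple_graph e -> max_deg_le e 4 -> (0 < #|V|)%N ->
  (0 < b)%N -> 1 <= K -> K ^+ b = lam ^+ a ->
  8%:R * ((k + 4 * k) ^ k)%:R * (4 * k)%:R * K <= q%:R ->
  (#|V| <= k)%N \/
  ((0 < k)%N /\ forall u, [/\ u \in Sb u, (#|Sb u| <= k)%N,
     forall T : {set V}, T \subset Sb u -> T != set0 -> (b * #|adj_in e T| <= 2 * a * #|T|.-1)%N &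
     forall T : {set V}, T \subset Sb u ->
       (b * (#|adj_in e T| + 2 * #|adj_out e (Sb u) T|) <= 2 * a * #|T|)%N]) ->
  total (potts_weight e s) f = 0 ->
  sqnorm (potts_weight e s) f <= 2%:R * #|V|%:R * (4%:R + 4%:R * s ^+ 8) ^+ k *
     \sum_v sqnorm (potts_weight e s) (fun x => f x - cond_exp (potts_weight e s) [set v] f x).
Proof.
move=> [e_sym e_irr] deg V0 b0 K1 Kab Hq H f0.
have w0 := @potts_weight_gt0 R V e q s s1.
have c1 : 1 <= 4%:R + 4%:R * s ^+ 8 by have := exprn_ege1 8 s1; lra.
case: H => [Vk|[k0 H]].
  apply: le_trans (poincare_size e_sym s1 deg f0) _.
  apply: ler_wpM2r; first by apply: sumr_ge0 => v _; apply: sqnorm_ge0.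
  apply: (@le_trans _ _ ((4%:R + 4%:R * s ^+ 8) ^+ k)); first by apply: ler_weXn2l.
  apply: ler_peMl; first by rewrite exprn_ge0 // (le_trans ler01).
  have : 1 <= #|V|%:R :> R by rewrite ler1n.
  lra.
have Kq : K <= q%:R.
  apply: le_trans Hq; apply: ler_peMl; first exact: le_trans ler01 K1.
  rewrite -!natrM ler1n !muln_gt0 /= expn_gt0 addn_gt0 k0 //.
apply: (poincare_blocks e_sym s1 deg (K := K) (Sb := Sb) (D := 4)) => //.
- by move=> u; case: (H u).
- by move=> u; case: (H u).
- move=> u T TS T0; have [_ _ H1 _] := H u.
  exact: pow_transfer (H1 T TS T0).
move=> u T TS; have [_ _ _ H2] := H u.
exact: pow_transfer (H2 T TS).
Qed.

Lemma rapid_maxdeg4_large (k : nat) (K : R) : (0 < k)%N -> 1 <= K ->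
  K ^+ k = lam ^+ (3 * k + 1) ->
  8%:R * ((k + 4 * k) ^ k)%:R * (4 * k)%:R * K <= q%:R -> rapid_maxdeg4 q lam.
Proof.
move=> k0 K1 Kk Hq eps /RltP eps0.
have [p Hp] := rapid_of_poincare q k lam1 eps0.
exists p => n e n0 simple conn deg; have [e_sym e_irr] := simple.
rewrite -[X in INR X](card_ord n); apply: Hp => //; first by rewrite card_ord.
have [nk|kn] := leqP n k.
  move=> f f0; apply: (potts_poincare (K := K) (Sb := fun=> setT) simple deg _ k0 K1 Kk Hq) => //.
    by rewrite card_ord.
  by left; rewrite card_ord.
have exSb (v : 'I_n) : exists S : {set 'I_n}, [/\ v \in S, #|S| = k & cutconn e S].
  by apply: cutconn_exists => //; rewrite k0 card_ord ltnW.
have [Sb HSb] := fin_all_exists exSb.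
move=> f f0; apply: (potts_poincare (K := K) (Sb := Sb) simple deg _ k0 K1 Kk Hq) => //.
  by rewrite card_ord.
right; split => // u; have [uS cS ccS] := HSb u; split; rewrite ?cS //.
  move=> T TS T0; have := card_adj_in_le T e_irr deg.
  have : (0 < #|T|)%N by rewrite lt0n cards_eq0.
  set t := #|T|; set m := #|adj_in e T| => t0 Hm.
  (* [t * minn 4 (t - 1) <= 6 * (t - 1)] for all [t >= 1]: a class off the boundary has at most
     three edges per nonroot. *)
  have Hm' : (m <= 6 * t.-1)%N.
    apply: (leq_trans Hm); case: (t) t0 => [//|[|[|t']]] _ /=; rewrite ?muln0 //; nia.
  by apply: leq_trans (leq_mul (leqnn k) Hm') _; nia.
move=> T TS; have := cutconn_G2 e_sym deg ccS TS.
by rewrite cS.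
Qed.

Lemma rapid_torus_large (l : nat) (K : R) : (0 < l)%N -> 1 <= K ->
  K ^+ l = lam ^+ (2 * l + 2) ->
  8%:R * ((l * l + 4 * (l * l)) ^ (l * l))%:R * (4 * (l * l))%:R * K <= q%:R ->
  rapid_torus q lam.
Proof.
move=> l0 K1 Kl Hq eps /RltP eps0.
have [p Hp] := rapid_of_poincare q (l * l) lam1 eps0.
exists p => L L3; have L1 : (1 < L)%N by exact: ltnW.
have simple := torus_simple L1; have deg := torus_max_deg L1.
have cV : #|{: 'I_L * 'I_L}| = (L * L)%N by rewrite card_prod card_ord.
have L0 : (0 < L * L)%N by rewrite muln_gt0 (ltnW L1).
rewrite -[X in INR X]cV; apply: Hp => //; first by rewrite cV.
move=> f f0; apply: (potts_poincare (K := K) (Sb := square l) simple deg _ l0 K1 Kl Hq) => //.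
  by rewrite cV.
have [Ll|lL] := leqP L l; first by left; rewrite cV leq_mul.
right; split; first by rewrite muln_gt0 l0.
move=> u; split; first exact: square_self.
- by rewrite card_square.
- move=> T TS T0; have H := torus_G1 l0 lL TS T0.
  by apply: leq_trans (leq_mul (leqnn l) H) _; by rewrite mulnA leq_mul2r; apply/orP; right; lia.
exact: torus_G2.
Qed.

End Rapid.

Lemma rapid_maxdeg4_threshold (eta : R) : 0 < eta -> exists2 c : R, 0 < c &
  forall (q : nat) (lam : R), 1 < lam -> c * Rpower lam (3 + eta) < q%:R ->
  rapid_maxdeg4 q lam.
Proof.
move=> eta0; pose k := (Num.bound eta^-1).+1.
have k0 : (0 < k)%N by [].
have kr : 0 < k%:R :> R by rewrite ltr0n.
have Hk : k%:R^-1 <= eta.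
  rewrite -[leRHS]invrK lef_pV2 ?posrE ?invr_gt0 //.
  have := archi_boundP (_ : 0 <= eta^-1); rewrite invr_ge0 ltW // => /(_ isT) H.
  by apply: (le_trans (ltW H)); rewrite ler_nat.
pose c : R := 8%:R * ((k + 4 * k) ^ k)%:R * (4 * k)%:R.
have c0 : 0 < c by rewrite /c !mulr_gt0 // ltr0n ?expn_gt0.
exists c => // q lam lam1 Hq.
have H3 : (3 * k + 1)%:R / k%:R <= 3%:R + eta.
  by rewrite natrD natrM mulrDl mulfK ?gt_eqF // mul1r lerD2l.
have [K [K1 Kk KR]] := Rpower_frac lam1 k0 H3.
apply: (rapid_maxdeg4_large lam1 k0 K1 Kk).
by apply: le_trans (ltW Hq); rewrite -/c ler_pM2l.
Qed.

Lemma rapid_torus_threshold (eta : R) : 0 < eta -> exists2 c : R, 0 < c &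
  forall (q : nat) (lam : R), 1 < lam -> c * Rpower lam (2 + eta) < q%:R ->
  rapid_torus q lam.
Proof.
move=> eta0; pose l := (Num.bound (2%:R / eta)).+1.
have l0 : (0 < l)%N by [].
have lr : 0 < l%:R :> R by rewrite ltr0n.
have Hl : 2%:R / l%:R <= eta.
  rewrite ler_pdivrMr // mulrC -ler_pdivrMr //.
  have H := archi_boundP (divr_ge0 (ler0n _ 2) (ltW eta0)).
  by apply: (le_trans (ltW H)); rewrite ler_nat.
pose c : R := 8%:R * ((l * l + 4 * (l * l)) ^ (l * l))%:R * (4 * (l * l))%:R.
have c0 : 0 < c by rewrite /c !mulr_gt0 // ltr0n ?expn_gt0.
exists c => // q lam lam1 Hq.
have H2 : (2 * l + 2)%:R / l%:R <= 2%:R + eta.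
  by rewrite natrD natrM mulrDl mulfK ?gt_eqF // lerD2l.
have [K [K1 Kk KR]] := Rpower_frac lam1 l0 H2.
apply: (rapid_torus_large lam1 l0 K1 Kk).
by apply: le_trans (ltW Hq); rewrite -/c ler_pM2l.
Qed.

(** * Switchings in 4-regular graphs *)

Section Switching.
Local Open Scope nat_scope.
Variable n : nat.
Local Notation I := 'I_n.
Implicit Types (A F : {set I * I}) (u v x y z t : I).

Lemma reg4P A : reflect [/\ forall u, (u, u) \notin A, forall u v, ((u, v) \in A) = ((v, u) \in A) &
  forall u, #|[set v | (u, v) \in A]| = 4] (reg4 A).
Proof.
rewrite /reg4; apply: (iffP andP) => [[/andP[/forallP H1 /forallP H2] /forallP H3]|[H1 H2 H3]].
  split=> // [u v|u]; last exact/eqP.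
  by have /forallP/(_ v)/eqP := H2 u.
split; last by apply/forallP => u; apply/eqP.
apply/andP; split; apply/forallP => u //.
by apply/forallP => v; apply/eqP.
Qed.

(* The eight ordered pairs of the 4-cycle [u v y x], in which the edges [uv], [xy] are
   exchanged for [ux], [vy]. *)
Definition swrel u v x y z t :=
  [|| (z == u) && ((t == v) || (t == x)), (z == v) && ((t == u) || (t == y)),
      (z == x) && ((t == y) || (t == u)) | (z == y) && ((t == x) || (t == v))].

(** A symmetric difference with the 4-cycle makes the move its own inverse, hence injective. *)
Definition switch u v x y A := [set p | (p \in A) (+) swrel u v x y p.1 p.2].

Lemma switchK u v x y : involutive (switch u v x y).
Proof. by move=> A; apply/setP => p; rewrite !inE -addbA addbb addbF. Qed.

Lemma card_xor2 (N : {set I}) a b : a \in N -> b \notin N ->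
  #|[set t | (t \in N) (+) ((t == a) || (t == b))]| = #|N|.
Proof.
move=> aN bN; have -> : [set t | (t \in N) (+) ((t == a) || (t == b))] = b |: (N :\ a).
  apply/setP => t; rewrite !inE; case: (eqVneq t b) => [->|tb].
    by rewrite (negbTE bN) orbT.
  by rewrite orbF; case: eqP => [->|] /=; rewrite ?aN ?addbF.
by rewrite cardsU1 !inE (negbTE bN) andbF (cardsD1 a N) aN.
Qed.

Section OneSwitch.
Variables (u v x y : I) (A : {set I * I}).
Hypothesis regA : reg4 A.
Hypothesis uv : (u, v) \in A.
Hypothesis xy : (x, y) \in A.
Hypothesis nux : (u, x) \notin A.
Hypothesis nvy : (v, y) \notin A.
Hypothesis xu : x != u.
Hypothesis yv : y != v.

Let irr := let: And3 H _ _ := reg4P A regA in H.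
Let sym := let: And3 _ H _ := reg4P A regA in H.
Let deg := let: And3 _ _ H := reg4P A regA in H.

Lemma switch_distinct : [/\ u != v, x != y, x != v & y != u].
Proof.
split.
- by apply: contraTneq uv => ->; apply: irr.
- by apply: contraTneq xy => ->; apply: irr.
- by apply: contraNneq nux => ->.
by apply: contraNneq nvy => ->; rewrite sym.
Qed.

Lemma swrel_sym z t : swrel u v x y z t = swrel u v x y t z.
Proof.
rewrite /swrel; do 4 case: (z == _) => //; by do 4 case: (t == _) => //.
Qed.

Lemma switch_reg4 : reg4 (switch u v x y A).
Proof.
have [uDv xDy xDv yDu] := switch_distinct.
have [vDu yDx vDx uDy] : [/\ v != u, y != x, v != x & u != y] by split; rewrite eq_sym.
apply/reg4P; split.
- move=> z; rewrite inE (negbTE (irr z)) /= /swrel.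
  apply/negP => /or4P[] /andP[/eqP -> /orP[]];
    by rewrite ?(negbTE uDv) ?(negbTE vDu) ?(negbTE xDy) ?(negbTE yDx) ?(negbTE xu)
       ?(negbTE yv) 1?eq_sym ?(negbTE xu) ?(negbTE yv).
- by move=> z t; rewrite !inE /= sym swrel_sym.
move=> z; rewrite -(deg z).
have E (a b : I) : (z, a) \in A -> (z, b) \notin A ->
   (forall t, swrel u v x y z t = (t == a) || (t == b)) ->
   #|[set t | (z, t) \in switch u v x y A]| = #|[set t | (z, t) \in A]|.
  move=> za zb H; rewrite -(@card_xor2 [set t | (z, t) \in A] a b) ?inE //.
  by apply: eq_card => t; rewrite !inE H.
rewrite /swrel in E.
have [zu|zu] := eqVneq z u.
  by apply: (E v x); rewrite zu // => t; rewrite eqxx (negbTE uDv) (eq_sym u x) (negbTE xu) (negbTE uDy) /= orbF.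
have [zv|zv] := eqVneq z v.
  apply: (E u y); rewrite zv //; first by rewrite sym.
  by move=> t; rewrite eqxx (negbTE vDu) (negbTE vDx) (eq_sym v y) (negbTE yv) /= orbF.
have [zx|zx] := eqVneq z x.
  apply: (E y u); rewrite zx //; first by rewrite sym.
  by move=> t; rewrite eqxx (negbTE xu) (negbTE xDv) (negbTE xDy) /= orbF.
have [zy|zy] := eqVneq z y.
  apply: (E x v); rewrite zy //; [by rewrite sym|by rewrite sym|].
  by move=> t; rewrite eqxx (negbTE yDu) (negbTE yv) (negbTE yDx) /=.
apply: eq_card => t; rewrite !inE /= /swrel (negbTE zu) (negbTE zv) (negbTE zx) (negbTE zy) /=.
exact: addbF.
Qed.

Lemma switch_sub (F : {set I * I}) : F \subset A -> (u, v) \notin F -> (v, u) \notin F ->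
  (x, y) \notin F -> (y, x) \notin F -> F \subset switch u v x y A.
Proof.
move=> FA uvF vuF xyF yxF; apply/subsetP => -[z t] ztF; have ztA := subsetP FA _ ztF.
rewrite inE ztA /= /swrel; apply/negP => H.
have no a b : (a, b) \notin F -> ~~ ((z == a) && (t == b)).
  by move=> abF; apply/negP => /andP[/eqP za /eqP tb]; rewrite -za -tb ztF in abF.
have nF a b : (a, b) \notin A -> (a, b) \notin F by apply: contra; apply: (subsetP FA).
have := no _ _ uvF; have := no _ _ vuF; have := no _ _ xyF; have := no _ _ yxF.
have := no _ _ (nF _ _ nux); have := no _ _ (nF _ _ nvy).
have := no x u (nF _ _ _); rewrite sym => /(_ nux).
have := no y v (nF _ _ _); rewrite sym => /(_ nvy).
move: H; do 4 case: (z == _) => //=; by do 4 case: (t == _) => //=.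
Qed.

Lemma switch_new : ((u, x) \in switch u v x y A) && ((v, y) \in switch u v x y A).
Proof.
rewrite !inE (negbTE nux) (negbTE nvy) /= /swrel !eqxx /= !orbT /=.
by rewrite ?orbT.
Qed.

End OneSwitch.

Definition regF F := [set A | reg4 A && (F \subset A)].

Lemma card_reg4 A : reg4 A -> #|A| = 4 * n.
Proof.
case/reg4P => _ _ deg.
transitivity #|[set p : I * I | adj_of A p.1 p.2 && (p.1 \in [set: I])]|.
  by apply: eq_card => -[a b]; rewrite !inE andbT.
rewrite -sum_deg (eq_bigr (fun=> 4)) => [|u _]; last exact: deg.
by rewrite sum_nat_const cardsT card_ord mulnC.
Qed.

Lemma card_reg4_from A (S : {set I}) : reg4 A ->
  #|[set p in A | p.1 \in S]| = 4 * #|S|.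
Proof.
case/reg4P => _ _ deg.
transitivity #|[set p : I * I | adj_of A p.1 p.2 && (p.1 \in S)]|.
  by apply: eq_card => -[a b]; rewrite !inE.
rewrite -sum_deg (eq_bigr (fun=> 4)) => [|u _]; last exact: deg.
by rewrite sum_nat_const mulnC.
Qed.

Definition switchable u v F A := [set p in A |
  [&& (u, p.1) \notin A, (v, p.2) \notin A, p.1 != u, p.2 != v, p \notin F & (p.2, p.1) \notin F]].

Let flip (p : I * I) := (p.2, p.1).
Let flipK : involutive flip. Proof. by case. Qed.

(** Of the 4n ordered edges, at most 4 * 5 start in the closed neighbourhood of [u], at most 4 * 5
    end in that of [v], and at most [2 * #|F|] belong to [F] in either direction. *)
Lemma card_switchable u v F A : reg4 A -> #|F| + 20 <= n ->
  2 * n <= #|switchable u v F A|.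
Proof.
move=> regA Fn; have [irr sym deg] := reg4P A regA.
pose Nb w := w |: [set t | (w, t) \in A].
have cN w : #|Nb w| <= 5.
  by apply: leq_trans (leq_card_setU _ _) _; rewrite cards1 deg.
pose Au := [set p in A | p.1 \in Nb u].
pose Av := [set flip p | p in [set p in A | p.1 \in Nb v]].
have cu : #|Au| <= 20 by rewrite card_reg4_from // -[20]/(4 * 5) leq_mul2l cN.
have cv : #|Av| <= 20.
  by rewrite card_imset; [rewrite card_reg4_from // -[20]/(4 * 5) leq_mul2l cN|exact: inv_inj].
have sub : A \subset switchable u v F A :|: (F :|: [set flip p | p in F]) :|: (Au :|: Av).
  apply/subsetP => -[a b] ab; rewrite !inE ab /=.
  case: (boolP ((a, b) \in F)) => abF; rewrite ?orbT //.
  case: (boolP ((b, a) \in F)) => baF.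
    by rewrite (_ : _ \in flip @: F) ?orbT //; apply/imsetP; exists (b, a).
  case: (boolP ((u, a) \in A)) => ua; rewrite ?orbT //.
  case: (eqVneq a u) => au; rewrite ?orbT //=.
  have inAv : b \in Nb v -> (a, b) \in Av.
    by move=> bv; apply/imsetP; exists (b, a) => //; rewrite inE -sym ab.
  case: (boolP ((v, b) \in A)) => vb.
    by rewrite inAv ?orbT // !inE vb orbT.
  by case: (eqVneq b v) => bv; rewrite ?orbT //= inAv ?orbT // !inE bv eqxx.
have := subset_leq_card sub; rewrite card_reg4 // => H.
have {}H : 4 * n <= #|switchable u v F A| + (#|F| + #|F|) + (20 + 20).
  apply: (leq_trans H); apply: leq_trans (leq_card_setU _ _) _; apply: leq_add.
    apply: leq_trans (leq_card_setU _ _) _; rewrite leq_add2l.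
    apply: leq_trans (leq_card_setU _ _) _; rewrite leq_add2l.
    by rewrite card_imset //; exact: inv_inj.
  by apply: leq_trans (leq_card_setU _ _) _; apply: leq_add.
move: H; set s := #|_|; lia.
Qed.

(** Double counting: a graph containing [uv] admits at least 2n switchings, while in the resulting
    graph [x] is a neighbour of [u] and [y] one of [v], so each graph arises at most 4 * 4 times. *)
Lemma switching_step u v F : u < v -> (u, v) \notin F ->
  (forall p, p \in F -> p.1 < p.2) -> #|F| + 20 <= n ->
  n * #|regF ((u, v) |: F)| <= 8 * #|regF F|.
Proof.
move=> uv uvF Finc Fn.
pose X := [set z : {set I * I} * (I * I) |
  (z.1 \in regF ((u, v) |: F)) && (z.2 \in switchable u v F z.1)].
pose Y := [set z : {set I * I} * (I * I) |
  [&& z.1 \in regF F, (u, z.2.1) \in z.1 & (v, z.2.2) \in z.1]].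
have HX : 2 * n * #|regF ((u, v) |: F)| <= #|X|.
  rewrite (card_fibers X fst) mulnC -sum_nat_const big_mkcond; apply: leq_sum => A _.
  case: ifP => // AF.
  have regA : reg4 A by move: AF; rewrite inE => /andP[].
  apply: leq_trans (card_switchable u v regA Fn) _.
  rewrite -(card_imset _ (fun p p' => (fun E => congr1 snd E) : (A, p) = (A, p') -> p = p')).
  apply/subset_leq_card/subsetP => z /imsetP[p pS ->].
  by rewrite !inE /= eqxx andbT; rewrite !inE in AF pS; rewrite AF pS.
have HY : #|Y| <= 16 * #|regF F|.
  rewrite (card_fibers Y fst) [leqRHS]mulnC -sum_nat_const [leqRHS]big_mkcond; apply: leq_sum => A _.
  case: ifP => AF; last first.
    by rewrite leqn0 cards_eq0; apply/eqP/setP => z; rewrite !inE;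
      case: eqP => [->|]; rewrite ?andbF //; rewrite inE in AF; rewrite AF.
  have regA : reg4 A by move: AF; rewrite inE => /andP[].
  have [_ _ deg] := reg4P A regA.
  rewrite -[16]/(4 * 4) -{1}(deg u) -(deg v) -cardsX.
  rewrite -(card_imset (setX _ _) (fun p p' => (fun E => congr1 snd E) : (A, p) = (A, p') -> p = p')).
  apply/subset_leq_card/subsetP => -[B [a b]]; rewrite !inE /=.
  case/andP => /and3P[_ ua vb] /eqP BA; rewrite BA in ua vb *.
  by apply/imsetP; exists (a, b); rewrite // !inE /= ua vb.
pose h (z : {set I * I} * (I * I)) := (switch u v z.2.1 z.2.2 z.1, z.2).
have hK : involutive h by move=> [A [a b]]; rewrite /h /= switchK.
have XY : #|X| <= #|Y|.
  rewrite -(card_imset X (inv_inj hK)); apply/subset_leq_card/subsetP => w /imsetP[[A [a b]]].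
  rewrite !inE /= => /andP[/andP[regA FA] /andP[abA /and5P[nua nvb au bv /andP[abF baF]]]] ->.
  have uvA : (u, v) \in A by apply: (subsetP FA); rewrite !inE eqxx.
  have FA' : F \subset A by apply: subset_trans FA; apply: subsetUr.
  (* [F] stores each edge once, in increasing order. *)
  have vuF : (v, u) \notin F by apply/negP => /Finc /=; rewrite ltnNge ltnW.
  rewrite switch_reg4 //= switch_sub //=.
  by have /andP[] := switch_new nua nvb; rewrite !inE /= => -> ->.
lia.
Qed.

Lemma card_regF_le F : (forall p, p \in F -> p.1 < p.2) -> #|F| + 20 <= n ->
  n ^ #|F| * #|regF F| <= 8 ^ #|F| * #|regF set0|.
Proof.
move Em : #|F| => m; elim: m F Em => [|m IH] F Em Finc Fn.
  by move/eqP: Em; rewrite cards_eq0 => /eqP ->; rewrite !mul1n.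
have [[u v] uvF] : exists p, p \in F by apply/set0Pn; rewrite -cards_eq0 Em.
have Em' : #|F :\ (u, v)| = m by rewrite (cardsD1 (u, v)) uvF in Em; case: Em.
have Finc' p : p \in F :\ (u, v) -> p.1 < p.2 by rewrite !inE => /andP[_ /Finc].
have Fn' : #|F :\ (u, v)| + 20 <= n by rewrite Em'; lia.
have H := switching_step (Finc _ uvF) (_ : (u, v) \notin F :\ (u, v)) Finc' Fn'.
rewrite setD1K // !inE eqxx /= in H; have {}H := H isT.
have := IH _ Em' Finc' _; rewrite -{1}Em' => /(_ Fn') H2.
rewrite !expnS -[n * _]mulnC -!mulnA.
apply: leq_trans (leq_mul (leqnn _) H) _.
by rewrite mulnCA leq_mul2l.
Qed.

End Switching.

(** * Edges inside a small set *)

Lemma sum_pow_subset (R : comNzRingType) (T : finType) (B : {set T}) (y : R) :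
  \sum_(F : {set T} | F \subset B) y ^+ #|F| = (1 + y) ^+ #|B|.
Proof.
transitivity (\prod_(i : T) ((if i \in B then y else 0) + 1)).
  rewrite bigA_distr big_mkcond /=; apply: eq_bigr => F _; case: ifPn => FB.
    rewrite -prodr_const big_mkcond /=; apply: eq_bigr => i _.
    by case: ifP => // /(subsetP FB) ->.
  case/subsetPn: FB => i iF iB; rewrite (bigD1 i) //= iF (negbTE iB) mul0r //.
rewrite -prodr_const [RHS]big_mkcond /=; apply: eq_bigr => i _.
by case: ifP; rewrite ?add0r // addrC.
Qed.

Section Increasing.
Local Open Scope nat_scope.
Variable n : nat.
Local Notation I := 'I_n.
Implicit Types (A P : {set I * I}) (W : {set I}) (u v : I).

Let flip (p : I * I) := (p.2, p.1).
Let flipK : involutive flip. Proof. by case. Qed.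

Definition incr_pairs W := [set p : I * I | [&& p.1 \in W, p.2 \in W & p.1 < p.2]].

Lemma card_sym_incr_pairs P : (forall p, p \in P -> flip p \in P) -> (forall u, (u, u) \notin P) ->
  #|P| = 2 * #|[set p in P | p.1 < p.2]|.
Proof.
move=> Psym Pirr; set Q := [set p in P | _].
have -> : P = Q :|: [set flip p | p in Q].
  apply/setP => -[a b]; rewrite !inE /=; apply/idP/orP.
    move=> ab; case: (ltngtP a b) => lt; [by left; rewrite ab| |].
      by right; apply/imsetP; exists (b, a); rewrite // inE /= lt andbT; exact: (Psym _ ab).
    by move: ab; rewrite (ord_inj lt) (negbTE (Pirr b)).
  by case=> [/andP[]|/imsetP[p]] //; rewrite inE => /andP[/Psym + _] ->.
rewrite cardsU (_ : _ :&: _ = set0) ?cards0 ?subn0.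
  by rewrite (card_imset _ (inv_inj flipK)) mul2n addnn.
apply/setP => -[a b]; rewrite !inE /=; apply/negP => /andP[/andP[_ ab]].
case/imsetP => -[c d]; rewrite inE /= => /andP[_ cd] [ac bd].
by rewrite ac bd ltnNge ltnW in ab.
Qed.

Lemma card_incr_pairs W : 2 * #|incr_pairs W| <= #|W| * #|W|.
Proof.
rewrite -cardsX; pose P := [set p in setX W W | p.1 != p.2].
have -> : incr_pairs W = [set p in P | p.1 < p.2].
  apply/setP => -[a b]; rewrite !inE /=; case: (a \in W) => //; case: (b \in W) => //=.
  by case: (ltngtP a b) => [ab|ab|ab]; rewrite ?andbT ?andbF // -val_eqE /= neq_ltn ab.
rewrite -card_sym_incr_pairs.
- by apply/subset_leq_card/subsetP => p; rewrite inE => /andP[].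
- by move=> [a b]; rewrite !inE /= => /andP[/andP[-> ->]]; rewrite eq_sym.
by move=> u; rewrite !inE eqxx andbF.
Qed.

Definition inner_edges A W := #|A :&: incr_pairs W|.

Lemma adj_in_inner A W : reg4 A -> #|adj_in (adj_of A) W| = 2 * inner_edges A W.
Proof.
case/reg4P => irr sym _; rewrite card_sym_incr_pairs.
- congr (2 * _); apply: eq_card => -[a b]; rewrite !inE /= /adj_of.
  by rewrite -!andbA.
- by move=> [a b]; rewrite !inE /= /adj_of sym => /and3P[-> -> ->].
by move=> u; rewrite inE /= /adj_of (negbTE (irr u)).
Qed.

Lemma adj_in_deg A W : reg4 A ->
  #|adj_in (adj_of A) W| + #|adj_out (adj_of A) W W| = 4 * #|W|.
Proof.
move=> regA; rewrite -(card_reg4_from W regA) -[RHS](cardsID (adj_in (adj_of A) W)); congr (_ + _).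
  apply: eq_card => p; rewrite !inE /adj_of -surjective_pairing.
  by case: (p \in A); case: (p.1 \in W).
apply: eq_card => p; rewrite !inE /adj_of -surjective_pairing.
by case: (p \in A); case: (p.1 \in W); rewrite ?andbF ?andbT.
Qed.

Lemma inner_le A W : reg4 A -> inner_edges A W <= 2 * #|W|.
Proof.
move=> regA; have := adj_in_inner W regA; have := adj_in_deg W regA; lia.
Qed.

Lemma adj_in_setC A W : reg4 A ->
  #|adj_in (adj_of A) (~: W)| + 8 * #|W| = 4 * n + 2 * inner_edges A W.
Proof.
move=> regA; have := adj_in_deg W regA; have := adj_in_deg (~: W) regA.
rewrite -(adj_in_inner W regA).
have -> : #|adj_out (adj_of A) (~: W) (~: W)| = #|adj_out (adj_of A) W W|.
  rewrite -(card_imset _ (inv_inj flipK)); apply: eq_card => -[a b].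
  have [_ sym _] := reg4P A regA.
  apply/imsetP/idP; rewrite !inE /= /adj_of.
    by move=> [[c d]]; rewrite !inE /= /adj_of negbK => /and3P[cd cW dW] [-> ->]; rewrite sym cd cW dW.
  by move=> /and3P[ab aW bW]; exists (b, a); rewrite // !inE /= /adj_of sym ab aW bW.
have := cardsC W; rewrite card_ord; set a := #|adj_out _ _ _|; set b := #|_|; lia.
Qed.

End Increasing.

Section Expectation.
Variables (R : realFieldType) (n : nat).
Local Notation I := 'I_n.
Implicit Types (A F : {set I * I}) (W : {set I}).

(** Writing x^e as the sum of (x - 1)^|F| over the sets [F] of inner edges reduces the moment to the
    chance of containing [F], at most (8 / n)^|F|. *)
Lemma sum_pow_inner (x : R) W : 1 <= x -> (2 * #|W| + 20 <= n)%N ->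
  \sum_(A : {set I * I} | reg4 A) x ^+ inner_edges A W <=
  #|[set A : {set I * I} | reg4 A]|%:R * (1 + 8%:R * x / n%:R) ^+ #|incr_pairs W|.
Proof.
move=> x1 Wn; have n0 : 0 < n%:R :> R by rewrite ltr0n; lia.
have x0 : 0 <= x by apply: le_trans x1.
rewrite (eq_bigr (fun A => \sum_(F : {set I * I} | F \subset A :&: incr_pairs W) (x - 1) ^+ #|F|));
  last by move=> A _; rewrite sum_pow_subset subrKC.
rewrite -sum_pow_subset mulr_sumr (exchange_big_dep (fun F => F \subset incr_pairs W)) /=; last first.
  by move=> A F _; rewrite subsetI => /andP[].
apply: ler_sum => F FW.
rewrite (eq_bigl (fun A => A \in regF F)); last first.
  by move=> A; rewrite inE subsetI FW andbT.
rewrite sumr_const -[_ ^+ _ *+ _]mulr_natl.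
(* Larger sets lie in no 4-regular graph; the others are small enough for the switching bound. *)
have [F2|F2] := leqP #|F| (2 * #|W|); last first.
  rewrite (_ : #|regF F| = 0)%N ?mul0r.
    by rewrite mulr_ge0 ?exprn_ge0 // divr_ge0 ?mulr_ge0 // ltW.
  apply/eqP; rewrite cards_eq0; apply/eqP/setP => A; rewrite !inE.
  apply/negP => /andP[regA FA]; move: F2; rewrite ltnNge => /negP; apply.
  by apply: leq_trans (inner_le W regA); apply: subset_leq_card; rewrite subsetI FA.
have Finc p : p \in F -> (p.1 < p.2)%N.
  by move/(subsetP FW); rewrite inE => /and3P[].
have H := card_regF_le Finc (_ : #|F| + 20 <= n)%N.
have {}H := H (leq_trans (leq_add F2 (leqnn _)) Wn).
have regE : regF set0 = [set A : {set I * I} | reg4 A].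
  by apply/setP => A; rewrite !inE sub0set andbT.
rewrite regE in H.
have Hr : n%:R ^+ #|F| * #|regF F|%:R <= 8%:R ^+ #|F| * #|[set A : {set I * I} | reg4 A]|%:R :> R.
  by rewrite -!natrX -!natrM ler_nat.
apply: (@le_trans _ _ (#|regF F|%:R * x ^+ #|F|)).
  apply: ler_wpM2l => //; apply: lerXn2r; rewrite ?nnegrE ?subr_ge0 //; lra.
rewrite expr_div_n [(8%:R * x) ^+ _]exprMn !mulrA ler_pdivlMr ?exprn_gt0 //.
by rewrite mulrAC [_ * n%:R ^+ _]mulrC [_ * 8%:R ^+ _]mulrC; apply: ler_wpM2r; rewrite ?exprn_ge0.
Qed.

End Expectation.

(** * Summing over colourings *)

Section Sequential.
Variables (R : archiRealFieldType) (n q : nat).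
Local Notation I := 'I_n.
Local Notation Om := {ffun I -> 'I_q}.
Implicit Types (x : Om) (u v : I).

Lemma sum_prod_sequential (f : I -> Om -> R) (b : I -> R) : (0 < q)%N ->
  (forall v x, 0 <= f v x) ->
  (forall u v x c, (u < v)%N -> f u (upd x v c) = f u x) ->
  (forall v x, \sum_c f v (upd x v c) <= b v) ->
  \sum_x \prod_v f v x <= \prod_v b v.
Proof.
move=> q0 f0 fu fb; have qr : 0 < q%:R :> R by rewrite ltr0n.
have b0 v x : 0 <= b v by apply: le_trans (fb v x); apply: sumr_ge0.
(* Every sum runs over all configurations: the colours from [k] on are free and give q^(n - k),
   which the factor q^k completes to q^n. *)
have H k : (k <= n)%N ->
  q%:R ^+ k * \sum_x \prod_(v : I | (v < k)%N) f v x <=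
  q%:R ^+ n * \prod_(v : I | (v < k)%N) b v.
  elim: k => [|k IH] kn.
    rewrite [X in _ <= _ * X]big_pred0 // (eq_bigr (fun=> 1)); last by move=> x _; rewrite big_pred0.
    by rewrite sumr_const card_ffun !card_ord expr0 mul1r mulr1 natrX.
  pose vk := Ordinal kn.
  have split_prod (g : I -> R) :
      \prod_(v : I | (v < k.+1)%N) g v = g vk * \prod_(v : I | (v < k)%N) g v.
    rewrite (bigD1 vk) //=; congr (_ * _); apply: eq_bigl => v.
    by rewrite ltnS -val_eqE /= ltn_neqAle andbC.
  rewrite split_prod; under eq_bigr => x _ do rewrite split_prod.
  rewrite exprS -mulrA mulrCA -(@sum_upd R _ _ _ vk).
  apply: (@le_trans _ _ (q%:R ^+ k * \sum_x b vk * \prod_(v : I | (v < k)%N) f v x)).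
    apply: ler_wpM2l; first by rewrite exprn_ge0 // ltW.
    apply: ler_sum => x _.
    rewrite (eq_bigr (fun c => f vk (upd x vk c) * \prod_(v : I | (v < k)%N) f v x)).
      by rewrite -mulr_suml; apply: ler_wpM2r; [exact: prodr_ge0|exact: fb].
    by move=> c _; congr (_ * _); apply: eq_bigr => v vk'; apply: fu.
  rewrite -mulr_sumr mulrCA [leRHS]mulrCA.
  have [x _|no] := pickP (mem {: Om}).
    by apply: ler_wpM2l; [exact: b0 x|exact: IH (ltnW kn)].
  have [c _|noc] := pickP (mem 'I_q); first by have := no [ffun=> c].
  by have := noc (Ordinal q0).
have := H n (leqnn n); rewrite ler_pM2l ?exprn_gt0 //.
rewrite (eq_bigr (fun x => \prod_v f v x)); last first.
  by move=> x _; apply: eq_bigl => v; rewrite ltn_ord.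
by rewrite [X in _ <= X](eq_bigl xpredT) // => v; rewrite ltn_ord.
Qed.

End Sequential.

(** Superadditivity of y^k - 1: the worst case has all earlier neighbours in a single colour. *)
Lemma sum_pow_super (R : realDomainType) (I : Type) (r : seq I) (k : I -> nat) (y : R) :
  1 <= y -> \sum_(i <- r) (y ^+ k i - 1) <= y ^+ (\sum_(i <- r) k i) - 1.
Proof.
move=> y1; elim: r => [|i r IH]; first by rewrite !big_nil expr0 subrr.
rewrite !big_cons exprD; set a := y ^+ k i; set c := y ^+ _ in IH *.
have a1 : 1 <= a by apply: exprn_ege1.
have c1 : 1 <= c by apply: exprn_ege1.
have := mulr_ge0 (_ : 0 <= a - 1) (_ : 0 <= c - 1); rewrite !subr_ge0 a1 c1 => /(_ isT isT).
by rewrite mulrBl mulrBr mul1r mulr1; lra.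
Qed.

Section ColourSum.
Variables (n q : nat).
Local Notation I := 'I_n.
Local Notation Om := {ffun I -> 'I_q}.
Variables (A : {set I * I}) (W : {set I}) (c0 : 'I_q).
Hypothesis regA : reg4 A.
Implicit Types (x : Om) (u v : I).

Definition excited x := [set v | x v != c0].
Definition back_nbrs v := [set u in W | (u < v)%N && ((u, v) \in A)].
Definition mono_inner x := #|[set p in A :&: incr_pairs W | x p.1 == x p.2]|.

Let q0 : (0 < q)%N. Proof. by case: (q) c0 => [[]|]. Qed.

Lemma mono_inner_back x : mono_inner x = (\sum_(v in W) #|[set u in back_nbrs v | x u == x v]|)%N.
Proof.
rewrite /mono_inner (card_fibers _ snd) (bigID (mem W)) /= [X in (_ + X)%N]big1 ?addn0.
  apply: eq_bigr => v vW.
  rewrite -(card_imset [set u in back_nbrs v | x u == x v]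
    (fun u u' => (fun E => congr1 fst E) : (u, v) = (u', v) -> u = u')).
  apply: eq_card => -[a b]; rewrite !inE /=; apply/idP/imsetP.
    by move=> /andP[/andP[/andP[ab /and3P[aW bW lt]] xab] /eqP <-]; exists a; rewrite // !inE aW lt ab.
  move=> [u]; rewrite !inE => /andP[/and3P[uW uv uvA] xuv] [-> ->].
  by rewrite uvA uW vW uv xuv eqxx.
move=> v vW; apply/eqP; rewrite cards_eq0; apply/eqP/setP => -[a b]; rewrite !inE /=.
by case: (b =P v) => [->|]; rewrite ?(negbTE vW) ?andbF.
Qed.

Lemma inner_back : inner_edges A W = (\sum_(v in W) #|back_nbrs v|)%N.
Proof.
have := mono_inner_back [ffun=> c0]; rewrite /mono_inner /inner_edges => H.
transitivity #|[set p in A :&: incr_pairs W | [ffun=> c0] p.1 == [ffun=> c0] p.2]|.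
  by apply: eq_card => p; rewrite !inE !ffunE eqxx andbT.
rewrite H; apply: eq_bigr => v _; apply: eq_card => u.
by rewrite !inE !ffunE eqxx andbT.
Qed.

Lemma card_back v : (#|back_nbrs v| <= 4)%N.
Proof.
have [_ sym deg] := reg4P A regA; rewrite -(deg v).
by apply/subset_leq_card/subsetP => u; rewrite !inE sym => /and3P[_ _ ->].
Qed.

Lemma mono_edges_excited x : excited x = W ->
  (mono_edges (adj_of A) x + 4 * #|W| = 2 * n + inner_edges A W + mono_inner x)%N.
Proof.
move=> E; have [irr sym _] := reg4P A regA.
have Esym : symmetric (adj_of A) by move=> u v; rewrite /adj_of sym.
have Eirr : irreflexive (adj_of A) by move=> u; rewrite /adj_of (negbTE (irr u)).
have D := mono_edges_double x Esym Eirr.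
have S : #|mono_pairs (adj_of A) x| = (#|adj_in (adj_of A) (~: W)| + 2 * mono_inner x)%N.
  have -> : mono_inner x = #|[set p in mono_pairs (adj_of A) x :&: setX W W | (p.1 < p.2)%N]|.
    apply: eq_card => -[a b]; rewrite !inE /= /adj_of.
    by case: ((a, b) \in A); case: (a \in W); case: (b \in W); case: (x a == x b); case: (a < b)%N.
  rewrite -card_sym_incr_pairs.
  - rewrite -(cardsID (adj_in (adj_of A) (~: W)) (mono_pairs (adj_of A) x)); congr (_ + _)%N.
      apply: eq_card => -[a b]; rewrite !inE /= -E !inE !negbK.
      by case: (adj_of A a b) => //=; case: (x a =P c0) => [->|_];
        case: (x b =P c0) => [->|_]; rewrite ?eqxx ?andbF.
    apply: eq_card => -[a b]; rewrite !inE /= -E !inE !negbK.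
    by case: (adj_of A a b) => //=; case: (x a =P x b) => [->|_]; case: (x b == c0); rewrite ?andbF.
  - move=> [a b]; rewrite !inE /= => /andP[/andP[ab xab] /andP[-> ->]].
    by rewrite Esym ab eq_sym xab.
  by move=> u; rewrite !inE /= Eirr.
have := adj_in_setC W regA; lia.
Qed.

Variables (R : archiRealFieldType) (lam : R).
Hypothesis lam1 : 1 <= lam.

(** Outside [W] the colour is forced and contributes 1. Inside [W], summing over the colour of [v]
    with the earlier ones fixed gives at most [q + lam ^+ #|back_nbrs v|]. *)
Lemma sum_excited_back :
  \sum_(x : Om | excited x == W) lam ^+ mono_inner x <=
  \prod_(v in W) (q%:R + lam ^+ #|back_nbrs v|).
Proof.
have l0 : 0 <= lam by apply: le_trans lam1.
pose f v x := if v \in W then lam ^+ #|[set u in back_nbrs v | x u == x v]| else (x v == c0)%:R.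
pose b v := if v \in W then q%:R + lam ^+ #|back_nbrs v| else 1.
rewrite [leRHS]big_mkcond -/(b _).
apply: (@le_trans _ _ (\sum_x \prod_v f v x)).
  rewrite big_mkcond; apply: ler_sum => x _; case: eqP => [E|_]; last first.
    by apply: prodr_ge0 => v _; rewrite /f; case: ifP => _; rewrite ?exprn_ge0.
  rewrite mono_inner_back -prodrXr big_mkcond le_eqVlt; apply/orP; left; apply/eqP.
  apply: eq_bigr => v _; rewrite /f; case: ifPn => // vW.
  by move: vW; rewrite -E inE negbK => ->.
apply: sum_prod_sequential => //.
- by move=> v x; rewrite /f; case: ifP => _; rewrite ?exprn_ge0.
- move=> u v x c uv; have ne (w : I) : (w <= u)%N -> w != v.
    by move=> wu; rewrite -val_eqE neq_ltn /= (leq_ltn_trans wu uv).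
  rewrite /f upd_diff ?ne //; case: ifP => // _; congr (_ ^+ _); apply: eq_card => w.
  rewrite !inE; case: (ltnP w u) => wu; rewrite ?andbF //.
  by rewrite upd_diff // ne // ltnW.
move=> v x; rewrite /f /b; case: ifP => vW; last first.
  under eq_bigr => c _ do rewrite upd_same.
  by rewrite (bigD1 c0) //= eqxx big1 ?addr0 // => c /negbTE ->.
pose k c := #|[set u in back_nbrs v | x u == c]|.
rewrite (eq_bigr (fun c => (lam ^+ k c - 1) + 1)); last first.
  move=> c _; rewrite subrK; congr (_ ^+ _); apply: eq_card => u; rewrite !inE upd_same.
  case: (ltnP u v) => uv; rewrite ?andbF //.
  have ne : u != v by rewrite -val_eqE neq_ltn uv.
  by rewrite upd_diff.
rewrite big_split /= sumr_const card_ord addrC lerD2l.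
apply: le_trans (sum_pow_super _ _ lam1) _.
by rewrite -(card_fibers (back_nbrs v) x) gerBl.
Qed.

(** The reason for q^(1/4): a vertex has d <= 4 earlier neighbours, so Q^d <= q and both summands
    are at most q (lam / Q)^d. *)
Lemma sum_excited (Q : R) : 1 <= Q -> Q <= lam -> Q ^+ 4 = q%:R ->
  \sum_(x : Om | excited x == W) lam ^+ mono_inner x <=
  (2%:R * q%:R) ^+ #|W| * (lam / Q) ^+ inner_edges A W.
Proof.
move=> Q1 Ql Qq; apply: (le_trans sum_excited_back).
have Q0 : 0 < Q by apply: lt_le_trans Q1.
rewrite inner_back -prodrXr -prodr_const -big_split /=; apply: ler_prod => v vW.
rewrite addr_ge0 ?ler0n ?exprn_ge0 ?(le_trans ler01 lam1) //=.
have d4 := card_back v; set d := #|_| in d4 *.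
have H1 : 1 <= (lam / Q) ^+ d by apply: exprn_ege1; rewrite ler_pdivlMr // mul1r.
have H2 : lam ^+ d <= q%:R * (lam / Q) ^+ d.
  rewrite expr_div_n mulrA mulrAC ler_peMl ?exprn_ge0 ?(le_trans ler01) //.
  by rewrite ler_pdivlMr ?exprn_gt0 // mul1r -Qq ler_weXn2l.
have H3 : q%:R <= q%:R * (lam / Q) ^+ d :> R by apply: ler_peMr.
rewrite -mulrA; lra.
Qed.

End ColourSum.

(** * Expected weight of the bottleneck *)

Section Boundary.
Variables (R : archiRealFieldType) (n q w : nat) (lam Q : R) (c0 : 'I_q).
Local Notation I := 'I_n.
Local Notation Om := {ffun I -> 'I_q}.
Implicit Types (A : {set I * I}) (x : Om) (W : {set I}).
Hypothesis lam1 : 1 <= lam.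
Hypothesis Q1 : 1 <= Q.
Hypothesis Ql : Q <= lam.
Hypothesis Qq : Q ^+ 4 = q%:R.
Hypothesis w0 : (0 < w)%N.
Hypothesis wn : (2 * w + 20 <= n)%N.
Hypothesis Qw : Q * n%:R <= lam ^+ 2 * w%:R.

Definition boundary_weight A :=
  \sum_(x : Om | #|excited c0 x| == w) lam ^+ mono_edges (adj_of A) x.

Let n0 : 0 < n%:R :> R. Proof. rewrite ltr0n; lia. Qed.
Let wr : 0 < w%:R :> R. Proof. by rewrite ltr0n. Qed.
Let l0 : 0 < lam. Proof. exact: lt_le_trans lam1. Qed.
Let Q0 : 0 < Q. Proof. exact: lt_le_trans Q1. Qed.
Let r := lam ^+ 2 * w%:R / (Q * n%:R).
Let reg := [set A : {set I * I} | reg4 A].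

Lemma boundary_weight_le A : reg4 A ->
  lam ^+ (4 * w) * boundary_weight A <=
  \sum_(W : {set I} | #|W| == w)
    (lam ^+ (2 * n) * (2%:R * q%:R) ^+ w * r ^+ (2 * w)) * (n%:R / w%:R) ^+ inner_edges A W.
Proof.
move=> regA; rewrite /boundary_weight (partition_big (excited c0) (fun W => #|W| == w)) //=.
rewrite mulr_sumr; apply: ler_sum => W /eqP cW.
rewrite (eq_bigl (fun x => excited c0 x == W)); last first.
  by move=> x; case: (excited c0 x =P W) => [->|_]; rewrite ?andbF // cW eqxx.
rewrite mulr_sumr.
rewrite (eq_bigr (fun x => lam ^+ (2 * n) * lam ^+ inner_edges A W * lam ^+ mono_inner A W x)); last first.
  move=> x /eqP E; rewrite -!exprD -(mono_edges_excited regA E) cW; congr (_ ^+ _).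
  exact: addnC.
rewrite -mulr_sumr.
apply: (@le_trans _ _ (lam ^+ (2 * n) * lam ^+ inner_edges A W *
    ((2%:R * q%:R) ^+ w * (lam / Q) ^+ inner_edges A W))).
  apply: ler_wpM2l; first by rewrite mulr_ge0 // exprn_ge0 // ltW.
  by rewrite -cW; apply: sum_excited.
have r1 : 1 <= r by rewrite /r ler_pdivlMr ?mulr_gt0 // mul1r.
(* The factor of an inner edge splits into [n / w], left to the exponential moment, and [r >= 1],
   bounded through the at most [2 * w] inner edges. *)
have E : lam * (lam / Q) = n%:R / w%:R * r.
  by rewrite /r; field; rewrite !gt_eqF.
have -> : lam ^+ (2 * n) * lam ^+ inner_edges A W * ((2%:R * q%:R) ^+ w * (lam / Q) ^+ inner_edges A W)
   = lam ^+ (2 * n) * (2%:R * q%:R) ^+ w * (lam * (lam / Q)) ^+ inner_edges A W.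
  by rewrite [(lam * (lam / Q)) ^+ _]exprMn -!mulrA; congr (_ * _); rewrite mulrCA.
rewrite E [(n%:R / w%:R * r) ^+ _]exprMn -!mulrA; apply: ler_wpM2l; first by rewrite exprn_ge0 // ltW.
apply: ler_wpM2l; first by rewrite exprn_ge0 // mulr_ge0.
rewrite mulrC; apply: ler_wpM2r; first by rewrite exprn_ge0 // divr_ge0.
by apply: ler_weXn2l => //; rewrite -cW; apply: inner_le.
Qed.

Lemma sum_boundary_weight :
  (forall m, (2 * m <= w * w)%N -> (1 + 8%:R / w%:R) ^+ m <= 81%:R ^+ w :> R) ->
  'C(n, w)%:R <= (3%:R * n%:R / w%:R) ^+ w :> R ->
  1944%:R * Q ^+ 2 * w%:R <= n%:R ->
  \sum_(A in reg) boundary_weight A <= #|reg|%:R * (lam ^+ (2 * n) * 4%:R^-1 ^+ w).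
Proof.
move=> HE HC Hw.
have nw1 : 1 <= n%:R / w%:R :> R by rewrite ler_pdivlMr // mul1r ler_nat; lia.
have r0 : 0 <= r by rewrite /r divr_ge0 ?mulr_ge0 ?exprn_ge0 // ltW.
rewrite -(ler_pM2l (exprn_gt0 (4 * w) l0)) mulr_sumr.
pose c := lam ^+ (2 * n) * (2%:R * q%:R) ^+ w * r ^+ (2 * w).
have c_ge0 : 0 <= c.
  by apply: mulr_ge0; [apply: mulr_ge0; apply: exprn_ge0; [exact: ltW|exact: mulr_ge0]|exact: exprn_ge0].
apply: (@le_trans _ _ (\sum_(A in reg) \sum_(W : {set I} | #|W| == w)
    c * (n%:R / w%:R) ^+ inner_edges A W)).
  by apply: ler_sum => A; rewrite inE => regA; apply: boundary_weight_le.
rewrite exchange_big /=.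
apply: (@le_trans _ _ (\sum_(W : {set I} | #|W| == w) c * (#|reg|%:R * 81%:R ^+ w))).
  apply: ler_sum => W /eqP cW; rewrite -mulr_sumr; apply: ler_wpM2l => //.
  rewrite (eq_bigl (fun A => reg4 A)); last by move=> A; rewrite inE.
  have cW' : (2 * #|W| + 20 <= n)%N by rewrite cW.
  apply: le_trans (sum_pow_inner nw1 cW') _; apply: ler_wpM2l => //.
  have -> : 8%:R * (n%:R / w%:R) / n%:R = 8%:R / w%:R :> R by field; rewrite !gt_eqF.
  by apply: HE; rewrite -cW card_incr_pairs.
rewrite sumr_const -[_ * _ *+ _]mulr_natl.
have -> : #|[pred W : {set I} | #|W| == w]| = 'C(n, w).
  by rewrite -[n in RHS]card_ord -card_draws; apply: eq_card => W; rewrite !inE.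
apply: (@le_trans _ _ ((3%:R * n%:R / w%:R) ^+ w * (c * (#|reg|%:R * 81%:R ^+ w)))).
  by apply: ler_wpM2r HC; apply: mulr_ge0 => //; apply: mulr_ge0 => //; exact: exprn_ge0.
(* The factor per vertex of [W]; it equals [486 * Q^2 * w / n * lam^4], at most a quarter of [lam^4]
   by [Hw]. *)
pose g : R := 3%:R * n%:R / w%:R * (2%:R * q%:R) * r ^+ 2 * 81%:R.
have -> : (3%:R * n%:R / w%:R) ^+ w * (c * (#|reg|%:R * 81%:R ^+ w)) =
    #|reg|%:R * (lam ^+ (2 * n) * g ^+ w).
  have gE : g ^+ w = (3%:R * n%:R / w%:R) ^+ w * (2%:R * q%:R) ^+ w * r ^+ (2 * w) * 81%:R ^+ w.
    by rewrite exprM -3!exprMn.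
  rewrite gE /c; move: (_ ^+ (2 * n)) (r ^+ _) (_ ^+ w) (_ ^+ w) (_ ^+ w) (#|reg|%:R).
  by move=> t1 t2 t3 t4 t5 t6; ring.
rewrite [leRHS]mulrCA; apply: ler_wpM2l => //; rewrite [leRHS]mulrCA; apply: ler_wpM2l.
  by rewrite exprn_ge0 // ltW.
rewrite exprM -exprMn; apply: lerXn2r; rewrite ?nnegrE /g.
- apply: mulr_ge0 => //; apply: mulr_ge0; last exact: exprn_ge0.
  by apply: mulr_ge0; [apply: divr_ge0; rewrite ?mulr_ge0|rewrite mulr_ge0].
- by apply: mulr_ge0; [apply: exprn_ge0; exact: ltW|rewrite invr_ge0].
have -> : 3%:R * n%:R / w%:R * (2%:R * q%:R) * r ^+ 2 * 81%:R =
   (486%:R * Q ^+ 2 * w%:R / n%:R) * lam ^+ 4.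
  by rewrite -Qq /r; field; rewrite !gt_eqF.
rewrite mulrC; apply: ler_wpM2l; first by rewrite exprn_ge0 // ltW.
by rewrite ler_pdivrMr //; lra.
Qed.

End Boundary.

(** * Bottlenecks and slow mixing *)

Section Bottleneck.
Variables (R : archiRealFieldType) (V : finType) (q : nat).
Local Notation Om := {ffun V -> 'I_q}.
Variable w : Om -> R.
Hypothesis w_gt0 : forall x, 0 < w x.
Hypothesis V0 : (0 < #|V|)%N.
Implicit Types (x y z : Om).
Local Notation kern := (kern w).
Local Notation kern_iter := (kern_iter w).
Let W := \sum_x w x.

Definition l1_dist t x := \sum_y `|kern_iter t x y - w y / W|.

Lemma l1_dist_S t x : l1_dist t.+1 x <= l1_dist t x.
Proof.
apply: (@le_trans _ _ (\sum_y \sum_z `|kern_iter t x z - w z / W| * kern z y)).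
  apply: ler_sum => y _.
  have -> : kern_iter t.+1 x y - w y / W = \sum_z (kern_iter t x z - w z / W) * kern z y.
    under [RHS]eq_bigr => z _ do rewrite mulrBl mulrAC.
    by rewrite sumrB -mulr_suml kern_stat.
  apply: le_trans (ler_norm_sum _ _ _) _; apply: ler_sum => z _.
  by rewrite normrM (ger0_norm (kern_ge0 w_gt0 _ _)).
rewrite exchange_big /=; apply: ler_sum => z _.
by rewrite -mulr_sumr sum_kern // mulr1.
Qed.

Lemma l1_dist_mono t t' x : (t <= t')%N -> l1_dist t' x <= l1_dist t x.
Proof.
move/subnKC <-; elim: (t' - t)%N => [|d IH]; first by rewrite addn0.
by rewrite addnS; apply: le_trans (l1_dist_S _ _) IH.
Qed.

Variables S B : {set Om}.
Hypothesis inner_stay : forall x y, x \in S -> x \notin B -> y \notin S -> kern x y = 0.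
Hypothesis S_half : 2%:R * \sum_(x in S) w x <= W.

Definition escape t x := \sum_(y | y \notin S) kern_iter t x y.

(** Mass that is newly outside [S] after a step was in [B] just before it; by stationarity a start
    distributed as [w] on [S] puts mass at most [w(B)] there at any time. *)
Lemma escape_bound t :
  \sum_(x in S) w x * escape t x <= t%:R * \sum_(x in B) w x.
Proof.
elim: t => [|t IH].
  rewrite mul0r big1 // => x xS; rewrite /escape big1 ?mulr0 //= => y yS.
  by case: eqP => // E; rewrite -E xS in yS.
pose k z := \sum_(y | y \notin S) kern z y.
have k1 z : k z <= 1.
  rewrite -(sum_kern w_gt0 V0 z) [leRHS](bigID (mem S)) /= lerDr.
  by apply: sumr_ge0 => y _; exact: (kern_ge0 w_gt0).
have k0 z : 0 <= k z by apply: sumr_ge0 => y _; exact: (kern_ge0 w_gt0).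
have escS x : escape t.+1 x <= escape t x + \sum_(z in B) kern_iter t x z.
  rewrite /escape /= exchange_big /= [leLHS](bigID (mem S)) /= addrC; apply: lerD.
    apply: ler_sum => z _; rewrite -mulr_sumr; apply: ler_piMr; [exact: (kern_iter_ge0 w_gt0)|exact: k1].
  rewrite big_mkcond [leRHS]big_mkcond; apply: ler_sum => z _.
  rewrite -mulr_sumr; case: ifPn => zS; case: ifPn => zB //.
  - by apply: ler_piMr; [exact: (kern_iter_ge0 w_gt0)|exact: k1].
  - by rewrite big1 ?mulr0 // => y yS; apply: inner_stay.
  exact: (kern_iter_ge0 w_gt0).
apply: (@le_trans _ _ (\sum_(x in S) w x * escape t x +
    \sum_(x in S) w x * \sum_(z in B) kern_iter t x z)).
  rewrite -big_split /=; apply: ler_sum => x _.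
  by rewrite -mulrDr ler_pM2l.
rewrite -natr1 mulrDl mul1r; apply: lerD => //.
under eq_bigr => x _ do rewrite mulr_sumr.
rewrite exchange_big /=; apply: ler_sum => z _.
rewrite -[leRHS](kern_iter_stat w_gt0 V0 t) [leRHS](bigID (mem S)) /= lerDl.
by apply: sumr_ge0 => x _; rewrite mulr_ge0 ?(kern_iter_ge0 w_gt0) // ltW.
Qed.

(** The complement of [S] has stationary mass at least 1/2 but receives only [escape t x]; the
    deviation is counted on [S] and on its complement. *)
Lemma l1_dist_escape t x : 1 - 2%:R * escape t x <= l1_dist t x.
Proof.
have W0 : 0 < W by rewrite /W (bigD1 x) //= ltr_wpDr // sumr_ge0 // => y _; apply: ltW.
pose a y := kern_iter t x y - w y / W.
have a0 : \sum_(y in S) a y + \sum_(y | y \notin S) a y = 0.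
  rewrite -(bigID (mem S) xpredT) /= sumrB sum_kern_iter // -mulr_suml divff ?subrr //.
  exact: lt0r_neq0.
have aS : \sum_(y | y \notin S) a y <= escape t x - 2%:R^-1.
  rewrite sumrB lerD2l lerN2 -mulr_suml ler_pdivlMr //.
  have : W = \sum_(y in S) w y + \sum_(y | y \notin S) w y by rewrite /W (bigID (mem S)).
  have := S_half; lra.
have H1 : `|\sum_(y in S) a y| <= \sum_(y in S) `|a y| by apply: ler_norm_sum.
have H2 : `|\sum_(y | y \notin S) a y| <= \sum_(y | y \notin S) `|a y| by apply: ler_norm_sum.
have -> : l1_dist t x = \sum_(y in S) `|a y| + \sum_(y | y \notin S) `|a y|.
  by rewrite /l1_dist (bigID (mem S)).
have := ler_norm (\sum_(y in S) a y).
have := ler_norm (- \sum_(y | y \notin S) a y); rewrite normrN.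
lra.
Qed.

(** Averaging yields a start with small escape at time [t]; monotonicity of the distance then covers
    all earlier times. *)
Lemma bottleneck_l1 (phi eps : R) t : S != set0 ->
  \sum_(x in B) w x <= phi * \sum_(x in S) w x ->
  2%:R * (t%:R * phi) < 1 - eps ->
  exists x, forall t', (t' <= t)%N -> eps < l1_dist t' x.
Proof.
move=> S0 Hphi Ht.
have [x0 x0S] := set0Pn _ S0.
have [x [xS Hx]] : exists x, x \in S /\ escape t x <= t%:R * phi.
  case: (pickP (fun x => (x \in S) && (escape t x <= t%:R * phi))) => [x /andP[]|no].
    by exists x.
  have : \sum_(x in S) w x * (t%:R * phi) < \sum_(x in S) w x * escape t x.
    apply: ltr_sum => [|x xS]; first by apply/hasP; exists x0; rewrite ?mem_index_enum.
    by rewrite ltr_pM2l // ltNge; have := no x; rewrite xS => /= ->.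
  move/lt_le_trans => /(_ _ (escape_bound t)).
  rewrite -mulr_suml mulrC -mulrA => H.
  have := lt_le_trans H (ler_wpM2l (ler0n _ t) Hphi); by rewrite ltxx.
exists x => t' tt'; apply: lt_le_trans (l1_dist_mono x tt').
by have := l1_dist_escape t x; lra.
Qed.

End Bottleneck.

Lemma IZR_natr (n : nat) : IZR (Z.of_nat n) = n%:R :> R.
Proof. by rewrite -INRE INR_IZR_INZ. Qed.

Section Slow.
Variables (n q w : nat) (lam : R) (c0 : 'I_q) (A : {set 'I_n * 'I_n}).
Local Notation I := 'I_n.
Local Notation Om := {ffun I -> 'I_q}.
Hypothesis regA : reg4 A.
Hypothesis lam1 : 1 < lam.
Hypothesis q2 : (1 < q)%N.
Hypothesis n0 : (0 < n)%N.
Hypothesis wn : (2 * w < n)%N.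
Implicit Types (x y : Om).
Let s : R := Num.sqrt lam.
Local Notation pw := (@potts_weight R I (adj_of A) q s).

Let simple : simple_graph (adj_of A).
Proof.
have [irr sym _] := reg4P A regA; split; first by move=> u v; rewrite /adj_of sym.
by move=> u; rewrite /adj_of (negbTE (irr u)).
Qed.

Lemma excited_const (c : 'I_q) : excited c [ffun=> c] = set0 :> {set I}.
Proof. by apply/setP => v; rewrite !inE ffunE eqxx. Qed.

Lemma mono_edges_const : mono_edges (adj_of A) ([ffun=> c0] : Om) = (2 * n)%N.
Proof.
have I0 : incr_pairs (set0 : {set I}) = set0 by apply/setP => p; rewrite !inE.
have := mono_edges_excited regA (excited_const c0).
rewrite /inner_edges /mono_inner I0 setI0 cards0 (_ : [set p in set0 | _] = set0) ?cards0; first by lia.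
by apply/setP => p; rewrite !inE.
Qed.

Definition mostly (c : 'I_q) := [set x : Om | (#|excited c x| <= w)%N].

(** Exchanging two colours maps [mostly c0] to a set of equal weight, disjoint from it because
    [2 * w < n]. *)
Lemma potts_weight_mostly_half : 2%:R * \sum_(x in mostly c0) pw x <= \sum_x pw x.
Proof.
have [c1 c10] : exists c1 : 'I_q, c1 != c0.
  have : (0 < #|[set~ c0]|)%N by rewrite cardsC1 card_ord -subn1 subn_gt0.
  by case/card_gt0P => c1; rewrite !inE; exists c1.
pose h x : Om := [ffun v => tperm c0 c1 (x v)].
have hK : involutive h by move=> x; apply/ffunP => v; rewrite !ffunE tpermK.
have E : \sum_(x in mostly c1) pw x = \sum_(x in mostly c0) pw x.
  rewrite (reindex_inj (inv_inj hK)) /=; apply: eq_big => [x|x _].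
    rewrite !inE; congr (_ <= _)%N; apply: eq_card => v; rewrite !inE ffunE.
    by rewrite -[X in _ == X](tpermL c0 c1) (inj_eq perm_inj).
  congr (_ ^+ _); apply: eq_card => p; rewrite !inE !ffunE.
  by rewrite (inj_eq perm_inj).
rewrite mulr_natl mulr2n -{2}E [leRHS](bigID (mem (mostly c0))) /= lerD2l.
rewrite big_mkcond [leRHS]big_mkcond /=; apply: ler_sum => x _.
case: ifPn => x1; case: ifPn => x0 //; first 1 last.
  by apply/ltW/potts_weight_gt0;
    rewrite -(ler_pXn2r (n := 2)) ?nnegrE ?sqrtr_ge0 // sqr_sqrtr ?expr1n ltW // (lt_trans ltr01).
exfalso; move: x0 x1; rewrite !inE negbK => x0 x1.
have : excited c0 x :|: excited c1 x = setT.
  by apply/setP => v; rewrite !inE; case: (eqVneq (x v) c0) => //= ->; rewrite eq_sym.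
move/(congr1 (fun T : {set I} => #|T|)); rewrite cardsT card_ord => cE.
have H := leq_card_setU (excited c0 x) (excited c1 x).
by have := leq_trans H (leq_add x0 x1); rewrite cE addnn -mul2n leqNgt wn.
Qed.

Lemma kern_inside x y : x \in mostly c0 -> x \notin [set x : Om | #|excited c0 x| == w] ->
  y \notin mostly c0 -> kern pw x y = 0.
Proof.
rewrite !inE => xS xB yS; rewrite /kern big1 ?mulr0 // => v _.
case: ifP => // /agreeP xy; exfalso; case/negP: yS.
apply: (@leq_trans #|v |: excited c0 x|).
  apply/subset_leq_card/subsetP => u; rewrite !inE.
  by case: (eqVneq u v) => //= uv; rewrite xy // inE.
have lt : (#|excited c0 x| < w)%N by rewrite ltn_neqAle xB.
by apply: leq_trans lt; rewrite cardsU1 -[leqRHS]add1n leq_add2r leq_b1.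
Qed.

Lemma slow_of_boundary (m : nat) (phi : R) :
  boundary_weight w lam c0 A <= lam ^+ (2 * n) * phi -> 0 <= phi ->
  2%:R * (2%:R ^+ m * phi) <= 2%:R^-1 ->
  forall T : R, T <= 2%:R ^+ m -> mix_time_ge (adj_of A) q lam eps0 T.
Proof.
move=> Hb phi0 Hm T HT.
have lam0 : 0 < lam by apply: lt_trans lam1.
have s1 : 1 <= s by rewrite -(ler_pXn2r (n := 2)) ?nnegrE ?sqrtr_ge0 // sqr_sqrtr ?expr1n ltW.
have pwE x : pw x = lam ^+ mono_edges (adj_of A) x.
  by rewrite -RpowE; rewrite (pow_mono_edges simple lam1).
have w0 := @potts_weight_gt0 R I (adj_of A) q s s1.
have V0 : (0 < #|'I_n|)%N by rewrite card_ord.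
have cst : [ffun=> c0] \in mostly c0 by rewrite inE excited_const cards0.
have S0 : mostly c0 != set0 by apply/set0Pn; exists [ffun=> c0].
have Hphi : \sum_(x in [set x : Om | #|excited c0 x| == w]) pw x <=
    phi * \sum_(x in mostly c0) pw x.
  apply: (@le_trans _ _ (lam ^+ (2 * n) * phi)).
    apply: le_trans Hb; rewrite le_eqVlt; apply/orP; left; apply/eqP.
    by apply: eq_big => [x|x _]; [rewrite inE|exact: pwE].
  rewrite mulrC; apply: ler_wpM2l => //.
  (* The constant colouring alone already has weight [lam ^+ (2 * n)]. *)
  rewrite (bigD1 [ffun=> c0]) //= pwE mono_edges_const lerDl.
  by apply: sumr_ge0 => x _; apply: ltW.
(* Total variation is half the l1 distance, hence [2 * eps0]; as e > 2 this is below 1/2. *)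
have He : 2%:R * ((2 ^ m)%:R * phi) < 1 - 2%:R * (eps0 : R).
  have e2 : 2%:R < exp 1 by apply/RltP; exact: (exp_ineq1 1 R1_neq_R0).
  have : eps0 < 4%:R^-1.
    rewrite /eps0 RinvE RmultE (IZR_natr 2) ltf_pV2 ?posrE //.
      have : 2%:R * 2%:R < 2%:R * exp 1 by rewrite ltr_pM2l.
      by rewrite -natrM.
    by rewrite mulr_gt0 //; apply/RltP; exact: exp_pos.
  by move: Hm; rewrite natrX; lra.
have [x Hx] := bottleneck_l1 w0 V0 kern_inside potts_weight_mostly_half S0 Hphi He.
exists x => t Ht; apply/RleP; rewrite INRE.
apply: (le_trans HT); rewrite -natrX ler_nat leqNgt; apply/negP => tm.
have := Hx t (ltnW tm); move/RleP: Ht; rewrite (tv_distE simple lam1) -/(l1_dist _ _ _).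
lra.
Qed.

End Slow.

(** * Slow mixing of almost all 4-regular graphs *)

(** The circulant graph with steps 1, 2, -1, -2, which are distinct and nonzero modulo [n] as soon
    as [n >= 5]; it keeps the denominator of the fraction positive. *)
Lemma reg4_exists n : (4 < n)%N -> (0 < #|[set A : {set 'I_n * 'I_n} | reg4 A]|)%N.
Proof.
case: n => // n n4.
pose D : {set 'I_n.+1} := [set inZp 1; inZp 2; - inZp 1; - inZp 2].
have v1 : (inZp 1 : 'I_n.+1) = 1%N :> nat by rewrite /= modn_small //; lia.
have v2 : (inZp 2 : 'I_n.+1) = 2%N :> nat by rewrite /= modn_small //; lia.
have v1' : (- inZp 1 : 'I_n.+1) = n :> nat.
  by rewrite /= (@modn_small 1) ?subn1 ?modn_small //; lia.
have v2' : (- inZp 2 : 'I_n.+1) = n.-1 :> nat.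
  by rewrite /= (@modn_small 2) ?modn_small //; lia.
have cD : #|D| = 4%N.
  have neq (a b : 'I_n.+1) : (a : nat) <> b -> (a == b) = false.
    by move=> ab; apply/eqP => E; apply: ab; rewrite E.
  rewrite /D -!setUA !cardsU1 cards1 !inE !neq ?v1 ?v2 ?v1' ?v2' //; lia.
have D0 : 0 \notin D.
  have neq (b : 'I_n.+1) : 0%N <> b -> (0 == b) = false.
    by move=> b0; apply/eqP => E; apply: b0; rewrite -E.
  rewrite !inE !neq ?v1 ?v2 ?v1' ?v2' //; lia.
have Dopp d : (- d \in D) = (d \in D).
  have H a : a \in D -> - a \in D.
    by rewrite !inE => /orP[/orP[/orP[]|]|] /eqP ->; rewrite ?opprK eqxx ?orbT.
  by apply/idP/idP => /H //; rewrite opprK.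
clearbody D; apply/card_gt0P; exists [set p | p.2 - p.1 \in D]; rewrite inE; apply/reg4P; split.
- by move=> u; rewrite inE subrr.
- by move=> u v; rewrite !inE -Dopp opprB.
move=> u; rewrite -cD -(card_imset D (addrI u)); apply: eq_card => v.
rewrite !inE /=; apply/idP/imsetP => [H|[d dD ->]].
  by exists (v - u) => //; rewrite addrC subrK.
by rewrite addrC addKr.
Qed.

Lemma expR_ge1D (x : R) : 0 <= x -> 1 + x <= exp x.
Proof.
move=> x0; apply/RleP; have [->|xn] := eqVneq x 0; first by rewrite exp_0 addr0; exact: Rle_refl.
by apply: Rlt_le; apply: exp_ineq1; apply/eqP.
Qed.

(** Through (1 + x)^m <= e^(mx), with e <= 3 to keep the constants integral. *)
Lemma pow_exp_le (x : R) (m k : nat) : 0 <= x -> m%:R * x <= k%:R ->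
  (1 + x) ^+ m <= 3%:R ^+ k.
Proof.
move=> x0 H; apply: (@le_trans _ _ (exp x ^+ m)).
  by apply: lerXn2r; rewrite ?nnegrE ?expR_ge1D ?addr_ge0 //; apply/ltW/RltP; exact: exp_pos.
rewrite expRX -[x *+ m]mulr_natl; apply: (@le_trans _ _ (exp k%:R)).
  have := H; rewrite le_eqVlt => /orP[/eqP ->//|/RltP lt].
  by apply/ltW/RltP; exact: exp_increasing.
have -> : k%:R = (1 : R) *+ k by [].
rewrite -expRX; apply: lerXn2r; rewrite ?nnegrE //.
  by apply/ltW/RltP; exact: exp_pos.
by rewrite -(IZR_natr 3); apply/RleP; exact: exp_le_3.
Qed.

(** A single term of the expansion of (1 + w / n)^n, which is at most e^w. *)
Lemma binomial_le (n w : nat) : (0 < w)%N -> (w <= n)%N ->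
  'C(n, w)%:R <= (3%:R * n%:R / w%:R) ^+ w :> R.
Proof.
move=> w0 wn; have wr : 0 < w%:R :> R by rewrite ltr0n.
have nr : 0 < n%:R :> R by rewrite ltr0n; apply: leq_trans wn.
pose x : R := w%:R / n%:R.
have x0 : 0 < x by rewrite divr_gt0.
have H : x ^+ w *+ 'C(n, w) <= 3%:R ^+ w.
  apply: (@le_trans _ _ ((1 + x) ^+ n)); last first.
    by apply: pow_exp_le; [exact: ltW|rewrite /x mulrC divfK // gt_eqF].
  have wn' : (w < n.+1)%N by [].
  rewrite exprDn (bigD1 (Ordinal wn')) //= expr1n mul1r lerDl.
  by apply: sumr_ge0 => i _; rewrite mulrn_wge0 // mulr_ge0 ?exprn_ge0 // ltW.
rewrite -mulrA exprMn -[n%:R / _]invf_div -/x exprVn ler_pdivlMr ?exprn_gt0 //.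
by rewrite mulr_natl.
Qed.

Section SlowAas.
Variables (q D : nat) (lam Q : R).
Hypothesis q2 : (2 <= q)%N.
Hypothesis lam1 : 1 < lam.
Hypothesis Q1 : 1 <= Q.
Hypothesis Qq : Q ^+ 4 = q%:R.
(* [1944 = 4 * 2 * 3 * 3^4]: [4] is the wanted decay, [2 * q], [3 * n / w] and [3^4] come
   from the colour sum, the binomial and the exponential moment; [3890 = 2 * 1945]. *)
Hypothesis Q3 : 3890%:R * Q ^+ 3 <= lam ^+ 2.

Hypothesis D_gt : 1944%:R * Q ^+ 2 <= D%:R.
Hypothesis D_le : D%:R <= 1945%:R * Q ^+ 2.

Let Q0 : 0 < Q. Proof. exact: lt_le_trans Q1. Qed.

Let Q2 : 1 <= Q ^+ 2. Proof. exact: exprn_ege1. Qed.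

Let D10 : (10 <= D)%N.
Proof.
rewrite -(ler_nat R); apply: le_trans D_gt.
by have := Q2; lra.
Qed.

Let Ql : Q <= lam.
Proof.
have l0 : 0 < lam := lt_trans ltr01 lam1.
rewrite -(ler_pXn2r (n := 2)) ?nnegrE ?(ltW Q0) ?(ltW l0) //.
apply: le_trans Q3; apply: (@le_trans _ _ (Q ^+ 3)); first by apply: ler_weXn2l.
by rewrite ler_peMl ?ler1n // exprn_ge0 // ltW.
Qed.

Let c0 : 'I_q := Ordinal (ltnW q2).

Lemma slow_fraction (n : nat) (b : R) : (3 * D <= n)%N -> b = (4%:R * D%:R)^-1 ->
  1 - 2%:R^-1 ^+ (n %/ D) <=
  #|[set A : {set 'I_n * 'I_n} | reg4 A &&
      pbool (mix_time_ge (adj_of A) q lam eps0 (Rpower (IZR 2) (b * n%:R)))]|%:R /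
  #|[set A : {set 'I_n * 'I_n} | reg4 A]|%:R :> R.
Proof.
move=> nD bE; set w := (n %/ D)%N; set G := [set A | _ && _]; set reg := [set A | reg4 A].
have D0 : (0 < D)%N by apply: leq_trans D10.
have Dr : 0 < D%:R :> R by rewrite ltr0n.
have w3 : (3 <= w)%N by rewrite leq_divRL.
have w0 : (0 < w)%N by apply: leq_trans w3.
have wD : (w * D <= n)%N by exact: leq_trunc_div.
have nwD : (n < w.+1 * D)%N by rewrite -ltn_divLR.
have w10 : (10 * w <= n)%N by apply: leq_trans wD; rewrite mulnC leq_mul2l D10 orbT.
have [wn wle n4 wn2] : [/\ 2 * w + 20 <= n, w <= n, 4 < n & 2 * w < n]%N.
  by clear -w3 w10; split; lia.
have n0 : (0 < n)%N by apply: leq_trans n4.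
have wr : 0 < w%:R :> R by rewrite ltr0n.
have Qw : Q * n%:R <= lam ^+ 2 * w%:R.
  (* Rounding in [n %/ D] costs at most a factor 2. *)
  have H1 : n%:R <= 2%:R * w%:R * D%:R :> R.
    by rewrite -!natrM ler_nat; apply: leq_trans (ltnW nwD) _; rewrite leq_mul2r; apply/orP; right; clear -w3; lia.
  have H2 : 2%:R * Q * D%:R <= lam ^+ 2.
    apply: le_trans Q3; apply: (@le_trans _ _ (2%:R * Q * (1945%:R * Q ^+ 2))).
      by rewrite ler_pM2l // mulr_gt0.
    by rewrite le_eqVlt; apply/orP; left; apply/eqP; ring.
  apply: (@le_trans _ _ (Q * (2%:R * w%:R * D%:R))); first by rewrite ler_pM2l.
  apply: (@le_trans _ _ (2%:R * Q * D%:R * w%:R)); last by rewrite ler_pM2r.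
  by rewrite le_eqVlt; apply/orP; left; apply/eqP; ring.
(* Here 8 m / w <= 4 w, and 3^4 = 81. *)
have HE m : (2 * m <= w * w)%N -> (1 + 8%:R / w%:R) ^+ m <= 81%:R ^+ w :> R.
  move=> mw; have -> : 81%:R ^+ w = 3%:R ^+ (4 * w) :> R by rewrite exprM; congr (_ ^+ w); rewrite -natrX.
  apply: pow_exp_le; first by rewrite divr_ge0.
  by rewrite mulrA ler_pdivrMr // -!natrM ler_nat; clear -mw; lia.
have HC : 'C(n, w)%:R <= (3%:R * n%:R / w%:R) ^+ w :> R by apply: binomial_le.
have Hw : 1944%:R * Q ^+ 2 * w%:R <= n%:R.
  apply: (@le_trans _ _ (D%:R * w%:R)); first by rewrite ler_pM2r.
  by rewrite -natrM ler_nat mulnC.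
have reg0 : (0 < #|reg|)%N by apply: reg4_exists.
have regr : 0 < #|reg|%:R :> R by rewrite ltr0n.
have Hsum := sum_boundary_weight c0 (ltW lam1) Q1 Ql Qq w0 wn Qw HE HC Hw.
rewrite -/reg in Hsum.
have l2n : 0 < lam ^+ (2 * n) by rewrite exprn_gt0 // (lt_trans ltr01).
(* The square root of the mean bound 4^-w serves both as the Markov threshold and as the bound on
   the exceptional fraction. *)
pose h : R := 2%:R^-1 ^+ w.
have h0 : 0 < h by rewrite exprn_gt0 // invr_gt0.
have good A : A \in reg -> boundary_weight w lam c0 A <= lam ^+ (2 * n) * h -> A \in G.
  rewrite !inE => regA HA; rewrite regA /= /pbool; case: excluded_middle_informative => // no.
  exfalso; apply: no.
  (* [w - 2] because 2 * 2^(w - 2) * 2^-w = 1/2. *)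
  apply: (slow_of_boundary regA lam1 q2 n0 wn2 HA (m := (w - 2)%N)).
  - exact: ltW.
  - rewrite /h exprVn mulrA -exprS ler_pdivrMr ?exprn_gt0 // mulrC ler_pdivlMr //.
    by rewrite -exprSr; apply: ler_weXn2l; [rewrite ler1n|clear -w3; lia].
  have -> : 2%:R ^+ (w - 2) = Rpower (IZR 2) (w - 2)%N%:R :> R.
    rewrite -(INRE (w - 2)) Rpower_pow ?RpowE ?(IZR_natr 2) //.
    by apply/RltP; rewrite ltr0n.
  apply/RleP/Rle_Rpower; apply/RleP; first by rewrite (IZR_natr 2) ler1n.
  (* The 4 in [b] absorbs the rounding: n / (4 D) < (w + 1) / 4 <= w - 2 once w >= 3. *)
  rewrite ?RmultE bE [_^-1 * _]mulrC ler_pdivrMr ?mulr_gt0 // -!natrM ler_nat.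
  apply: leq_trans (ltnW nwD) _; rewrite mulnA leq_mul2r; apply/orP; right; clear -w3; lia.
have markov : #|reg :\: G|%:R <= #|reg|%:R * h.
  have H1 : \sum_(A in reg :\: G) lam ^+ (2 * n) * h <= \sum_(A in reg) boundary_weight w lam c0 A.
    rewrite big_mkcond [leRHS]big_mkcond; apply: ler_sum => A _; rewrite in_setD.
    case: (boolP (A \in reg)) => Areg; rewrite ?andbF // andbT; case: ifPn => AG.
      by rewrite leNgt; apply: contra AG => /ltW; apply: good.
    by apply: sumr_ge0 => x _; rewrite exprn_ge0 // (le_trans ler01) // ltW.
  have := le_trans H1 Hsum; rewrite sumr_const -[_ * _ *+ _]mulr_natl.
  have -> : #|reg|%:R * (lam ^+ (2 * n) * 4%:R^-1 ^+ w) = #|reg|%:R * h * (lam ^+ (2 * n) * h).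
    have -> : 4%:R^-1 ^+ w = h * h :> R.
      by rewrite /h -exprMn -invfM -natrM.
    by ring.
  by rewrite ler_pM2r // mulr_gt0.
have cG : #|reg|%:R = #|G|%:R + #|reg :\: G|%:R :> R.
  rewrite -natrD -(cardsID G reg); congr (_ + _)%:R; apply: eq_card => A.
  by rewrite !inE; case: (reg4 A).
rewrite ler_pdivlMr // mulrBl mul1r [h * _]mulrC.
lra.
Qed.

Lemma slow_aas_of_bound : slow_aas q lam.
Proof.
have D0 : (0 < D)%N by apply: leq_trans D10.
have Dr : 0 < D%:R :> R by rewrite ltr0n.
pose b : R := (4%:R * D%:R)^-1.
exists b; split; first by apply/RltP; rewrite invr_gt0 mulr_gt0.
move=> eps /RltP eps_gt0.
have [N1 HN1] := exp2_dominates eps^-1.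
exists (3 * D + N1.+1 * D + 5)%N => n /ssrnat.leP nN.
have nD : (3 * D <= n)%N by clear -nN; lia.
have wN : (N1 < n %/ D)%N by rewrite leq_divRL //; clear -nN; lia.
apply/RltP; rewrite RdistE RdivE !INRE RmultE.
have H := slow_fraction nD (erefl b).
set r := _ / _ in H *.
have r1 : r <= 1.
  rewrite /r ler_pdivrMr; last by rewrite ltr0n reg4_exists //; clear -nN; lia.
  rewrite mul1r ler_nat; apply/subset_leq_card/subsetP => A.
  by rewrite !inE => /andP[].
have hN : 2%:R^-1 ^+ (n %/ D) < eps :> R.
  rewrite exprVn -[ltRHS]invrK ltf_pV2 ?posrE ?exprn_gt0 ?invr_gt0 //.
  by apply: le_lt_trans HN1 _; rewrite ltr_eXn2l // ltr1n.
rewrite distrC ger0_norm ?subr_ge0 //; by apply: le_lt_trans hN; rewrite lerBlDr addrC -lerBlDr.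
Qed.

End SlowAas.

Lemma slow_aas_threshold (eta : R) : 0 < eta -> exists2 c : R, 0 < c &
  forall (q : nat) (lam : R), (2 <= q)%N -> 1 < lam ->
  INR q < c * Rpower lam (Rdiv 8 3 - eta) -> slow_aas q lam.
Proof.
move=> eta0; pose c1 : R := 3890%:R^-1.
have c10 : 0 < c1 by rewrite invr_gt0.
(* The power 3/4 turns q <= c1^(4/3) lam^(8/3) into Q^3 <= c1 lam^2. *)
exists (Rpower c1 (Rdiv 4 3)); first by apply/RltP; exact: exp_pos.
move=> q lam q2 lam1 Hq.
have q0 : 0 < INR q by rewrite INRE ltr0n ltnW.
have l0 : 0 < lam := lt_trans ltr01 lam1.
pose Q : R := Rpower (INR q) (Rdiv 1 4).
have QE (k : nat) : Q ^+ k = Rpower (INR q) (Rmult (Rdiv 1 4) (INR k)).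
  rewrite -RpowE -Rpower_pow ?Rpower_mult //; exact: exp_pos.
have Q1 : 1 <= Q.
  rewrite -[leLHS](Rpower_O (INR q)); last exact/RltP.
  apply/RleP; apply: Rle_Rpower; last by Lra.lra.
  by apply/RleP; rewrite INRE ler1n ltnW.
have Qq : Q ^+ 4 = q%:R.
  rewrite QE -INRE; have -> : Rmult (Rdiv 1 4) (INR 4) = IZR 1 by rewrite /=; Lra.lra.
  by rewrite Rpower_1 //; exact/RltP.
have T0 : 0 <= 1944%:R * Q ^+ 2 by apply: mulr_ge0 => //; apply: exprn_ge0; exact: le_trans ler01 Q1.
(* [D] will be this truncation plus one, at most [1945 * Q ^+ 2] because [Q ^+ 2 >= 1]. *)
have /andP[t1 t2] := truncn_itv T0.
have Q2 : 1 <= Q ^+ 2 by apply: exprn_ege1.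
apply: (slow_aas_of_bound q2 lam1 Q1 Qq _ (ltW t2)); last by rewrite -natr1; lra.
have c1E : c1 * 3890%:R = 1 by rewrite mulVf // pnatr_eq0.
rewrite -ler_pdivlMl // -/c1.
rewrite QE.
have E34 : Rmult (Rdiv 1 4) (INR 3) = Rdiv 3 4 by rewrite /=; Lra.lra.
have q_le : Rle (INR q) (Rmult (Rpower c1 (Rdiv 4 3)) (Rpower lam (Rdiv 8 3))).
  apply/RleP; apply: (le_trans (ltW Hq)); rewrite RmultE ler_pM2l; last first.
    by apply/RltP; exact: exp_pos.
  apply/RleP; apply: Rle_Rpower; first exact/RleP/ltW.
  by apply/RleP; rewrite gerBl ltW.
have H := Rle_Rpower_l _ _ (Rdiv 3 4) _ (conj _ q_le).
apply: (@le_trans _ _ (Rpower (Rmult (Rpower c1 (Rdiv 4 3)) (Rpower lam (Rdiv 8 3))) (Rdiv 3 4))).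
  by rewrite E34; apply/RleP; apply: H; [Lra.lra|exact/RltP].
rewrite -Rpower_mult_distr; try exact: exp_pos.
rewrite !Rpower_mult.
have -> : Rmult (Rdiv 4 3) (Rdiv 3 4) = IZR 1 by Lra.lra.
have -> : Rmult (Rdiv 8 3) (Rdiv 3 4) = INR 2 by rewrite /=; Lra.lra.
by rewrite Rpower_1 ?Rpower_pow ?RpowE ?RmultE //; exact/RltP.
Qed.

(** * The window between the two thresholds *)

Lemma eventually_gap (c4 c5 : R) : 0 < c4 -> 0 < c5 ->
  exists lam0 : R, forall lam : R, lam0 < lam -> 1 < lam /\
    exists q : nat, [/\ (2 <= q)%N, Rlt (Rmult c4 (Rpower lam (Rplus 2 (Rdiv 1 4)))) (INR q) &
      Rlt (INR q) (Rmult c5 (Rpower lam (Rminus (Rdiv 8 3) (Rdiv 1 4))))].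
Proof.
move=> c40 c50; pose k : R := (c4 + 2%:R) / c5.
have k0 : 0 < k by rewrite divr_gt0 // addr_gt0.
(* The exponents 2 + 1/4 and 8/3 - 1/4 differ by 1/6, so the window opens once lam^(1/6) > k. *)
exists (1 + k ^+ 6) => lam Hlam.
have lam1 : 1 < lam by apply: lt_trans Hlam; rewrite ltrDl exprn_gt0.
have l0 : Rlt 0 lam by apply/RltP; apply: lt_trans lam1.
split => //.
have klam : k < Rpower lam (Rdiv 1 6).
  have -> : k = Rpower (k ^+ 6) (Rdiv 1 6).
    rewrite -RpowE -Rpower_pow; last exact/RltP.
    rewrite Rpower_mult; have -> : Rmult (INR 6) (Rdiv 1 6) = IZR 1 by rewrite /=; Lra.lra.
    by rewrite Rpower_1 //; exact/RltP.
  apply/RltP; apply: Rlt_Rpower_l; first by Lra.lra.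
  split; apply/RltP; first exact: exprn_gt0.
  by apply: le_lt_trans Hlam; rewrite lerDr.
set y := Rpower lam (Rplus 2 (Rdiv 1 4)).
have y1 : 1 <= y.
  rewrite -[leLHS](Rpower_O lam) //; apply/RleP; apply: Rle_Rpower; last by Lra.lra.
  by apply/RleP/ltW.
have y0 : 0 < y by apply: lt_le_trans y1.
have -> : Rpower lam (Rminus (Rdiv 8 3) (Rdiv 1 4)) = y * Rpower lam (Rdiv 1 6).
  by rewrite /y -RmultE -Rpower_plus; congr Rpower; Lra.lra.
have cy0 : 0 <= c4 * y by rewrite mulr_ge0 // ltW.
have /andP[t1 t2] := truncn_itv cy0.
(* Plus two makes [q] at least 2 and larger than [c4 * y], yet at most [(c4 + 2) * y] since
   [y >= 1]. *)
exists (Num.truncn (c4 * y)).+2; split=> //; apply/RltP; rewrite INRE RmultE.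
  by apply: lt_trans t2 _; rewrite ltr_nat.
apply: (@le_lt_trans _ _ (y * (c4 + 2%:R))).
  by rewrite -addn2 natrD; lra.
rewrite mulrCA ltr_pM2l //.
by move: klam; rewrite /k ltr_pdivrMr // mulrC.
Qed.

Local Close Scope ring_scope.
Local Open Scope R_scope.

Theorem theorem3 :
  (forall eta : R, 0 < eta < 1 ->
    exists c3 c4 c5 : R, 0 < c3 /\ 0 < c4 /\ 0 < c5 /\
      forall (q : nat) (lam : R), (0 < q)%N -> 1 < lam ->
        (c3 * Rpower lam (3 + eta) < INR q -> rapid_maxdeg4 q lam) /\
        (c4 * Rpower lam (2 + eta) < INR q -> rapid_torus q lam) /\
        ((2 <= q)%N -> INR q < c5 * Rpower lam (8 / 3 - eta) ->
           slow_aas q lam))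
  /\
  (exists lam0 : R, forall lam : R, lam0 < lam ->
     exists q : nat, (0 < q)%N /\ rapid_torus q lam /\ slow_aas q lam).
Proof.
have thresholds : forall eta : R, 0 < eta < 1 ->
    exists c3 c4 c5 : R, 0 < c3 /\ 0 < c4 /\ 0 < c5 /\
      forall (q : nat) (lam : R), (0 < q)%N -> 1 < lam ->
        (c3 * Rpower lam (3 + eta) < INR q -> rapid_maxdeg4 q lam) /\
        (c4 * Rpower lam (2 + eta) < INR q -> rapid_torus q lam) /\
        ((2 <= q)%N -> INR q < c5 * Rpower lam (8 / 3 - eta) ->
           slow_aas q lam).
  move=> eta [/RltP eta0 _].
  have [c3 /RltP c30 H3] := rapid_maxdeg4_threshold eta0.
  have [c4 /RltP c40 H4] := rapid_torus_threshold eta0.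
  have [c5 /RltP c50 H5] := slow_aas_threshold eta0.
  exists c3, c4, c5; do 3 split => //.
  move=> q lam q0 /RltP lam1; split; [|split].
  - by move/RltP; rewrite INRE (IZR_natr 3); apply: H3.
  - by move/RltP; rewrite INRE (IZR_natr 2); apply: H4.
  by move=> q2 /RltP; apply: H5.
split => //.
(* Any [eta] below 1/3 would leave 2 + eta < 8/3 - eta; 1/4 matches [eventually_gap]. *)
have [|c3 [c4 [c5 [_ [/RltP c40 [/RltP c50 H]]]]]] := thresholds (1 / 4).
  by split; Lra.lra.
have [lam0 Hlam] := eventually_gap c40 c50.
exists lam0 => lam /RltP /Hlam [/RltP lam1 [q [q2 Hq4 Hq5]]].
have q0 : (0 < q)%N by apply: ltnW.
have [_ [Hr Hs]] := H q lam q0 lam1.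
by exists q; split => //; split; [apply: Hr|apply: Hs].
Qed.
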